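(* Let $\lambda\in P^+$. The functor $\mathbf W_A^\lambda:\operatorname{mod}\mathbf A_\lambda\to\mathcal I_A^\lambda$ is exact if and only if for all $U\in\mathcal I_A^\lambda$ with $U_\lambda=0$ we have $$\operatorname{Ext}^2_{\mathcal I_A^\lambda}(\mathbf W_A^\lambda M,U)=0\quad\text{for all } M\in\operatorname{mod}\mathbf A_\lambda.$$
   Context: $\mathfrak g$ is a finite-dimensional simple Lie algebra over $\mathbb C$ of rank $n$, $I=\{1,\dots,n\}$, $\mathfrak h$ a Cartan subalgebra, $\alpha_i,\omega_i$ ($i\in I$) the simple roots and fundamental weights, $Q^+$ and $P^+$ the $\mathbb Z_{\ge 0}$-spans of the $\alpha_i$ and of the $\omega_i$; $\mu\le\lambda$ iff $\lambda-\mu\in Q^+$. $\mathbf U(-)$ denotes universal enveloping algebra. $A$ is a commutative associative unital $\mathbb C$-algebra (containing $\mathbb C=\mathbb C\cdot 1$); $\mathfrak g\otimes A$ is the Lie algebra with $[x\otimes a,y\otimes b]=[x,y]\otimes ab$, and $\mathfrak g$ is identified with $\mathfrak g\otimes 1$. A $\mathfrak g$-module is locally finite-dimensional if each element lies in a finite-dimensional $\mathfrak g$-submodule; then $V=\bigoplus_\mu V_\mu$ (weight spaces) and $\operatorname{wt}(V)=\{\mu: V_\mu\neq 0\}$. $V(\lambda)$ is the irreducible finite-dimensional $\mathfrak g$-module of highest weight $\lambda\in P^+$ with highest weight vector $v_\lambda$. $\mathcal I_A$ is the category of $\mathfrak g\otimes A$-modules that are locally finite-dimensional as $\mathfrak g$-modules,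 with all $\mathfrak g\otimes A$-module maps. For $\nu\in P^+$ and $V\in\mathcal I_A$, $V^\nu=V/\sum_{\mu\not\le\nu}\mathbf U(\mathfrak g\otimes A)V_\mu$, the maximal quotient with $\operatorname{wt}(V^\nu)\subset\nu-Q^+$; $\mathcal I_A^\nu$ is the full subcategory of $V$ with $V=V^\nu$. Global Weyl module: $P_A(V(\lambda))=\mathbf U(\mathfrak g\otimes A)\otimes_{\mathbf U(\mathfrak g)}V(\lambda)$, $W_A(\lambda)=P_A(V(\lambda))^\lambda$, and $w_\lambda$ is the image of $1\otimes v_\lambda$. $\operatorname{Ann}_{\mathfrak h\otimes A}(w_\lambda)=\{u\in\mathbf U(\mathfrak h\otimes A):uw_\lambda=0\}$ and $\mathbf A_\lambda=\mathbf U(\mathfrak h\otimes A)/\operatorname{Ann}_{\mathfrak h\otimes A}(w_\lambda)$, a commutative algebra. $W_A(\lambda)$ is a $(\mathfrak g\otimes A,\mathbf A_\lambda)$-bimodule, with right action $(uw_\lambda)(h\otimes a)=u(h\otimes a)w_\lambda$ for $u\in\mathbf U(\mathfrak g\otimes A)$, $h\in\mathfrak h$, $a\in A$. $\operatorname{mod}\mathbf A_\lambda$ is the category of left $\mathbf A_\lambda$-modules. The Weyl functor is $\mathbf W_A^\lambda:\operatorname{mod}\mathbf A_\lambda\to\mathcal I_A^\lambda$, $\mathbf W_A^\lambda M=W_A(\lambda)\otimes_{\mathbf A_\lambda}M$, $\mathbf W_A^\lambda f=1\otimes f$. *)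

(* Defs.v *)
From HB Require Import structures.
From Stdlib Require Import Relation_Operators.
From mathcomp Require Import all_boot all_order all_algebra.
From mathcomp Require Import finmap monalg.
From mathcomp Require Import boolp classical_sets reals complex.

Set Implicit Arguments.
Unset Strict Implicit.
Unset Printing Implicit Defensive.

Import GRing.Theory.
Local Open Scope classical_set_scope.
Local Open Scope ring_scope.
Local Open Scope quotient_scope.

Section ModuleQuotient.
Context (R : pzRingType) (V : lmodType R).

Definition is_submodule (N : set V) : Prop :=
  N 0 /\ forall (a : R) x y, N x -> N y -> N (a *: x + y).

Definition span (S : set V) : set V := smallest is_submodule S.

Lemma span_submodule S : is_submodule (span S).
Proof.
split=> [N [[]//]|a x y sx sy N [/[dup] [[_ +]] sN SN]].
by apply; [exact: sx|exact: sy].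
Qed.

Lemma span_gen S : S `<=` span S.
Proof. exact: sub_gen_smallest. Qed.

Lemma spanZ S a x : span S x -> span S (a *: x).
Proof.
by have [s0 sD] := span_submodule S => sx; rewrite -[_ *: _]addr0; exact: sD.
Qed.

Definition span_pred (S : set V) : {pred V} := fun v => `[< span S v >].

Lemma span_predP S v : reflect (span S v) (v \in span_pred S).
Proof. exact: asboolP. Qed.

Lemma span_zmod_closed S : zmod_closed (span_pred S).
Proof.
have [s0 sD] := span_submodule S; split; first exact/span_predP.
move=> x y /span_predP sx /span_predP sy; apply/span_predP.
by rewrite addrC -scaleN1r; exact: sD.
Qed.

HB.instance Definition _ S :=
  GRing.isZmodClosed.Build V (span_pred S) (span_zmod_closed S).

Variable S : set V.

Definition modquot : Type := {ideal_quot (span_pred S : zmodClosed V)}.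

HB.instance Definition _ := GRing.Zmodule.on modquot.
HB.instance Definition _ := EqQuotient.on modquot.
HB.instance Definition _ := ZmodQuotient.on modquot.

(* The [locked_with] below only keep unification from unfolding quotients. *)
Fact mpi_key : unit. Proof. by []. Qed.
Definition mpi : V -> modquot := locked_with mpi_key (fun v => \pi v).

Let mpiE v : mpi v = \pi v.
Proof. by rewrite /mpi locked_withE. Qed.

Lemma mpi_eq x y : mpi x = mpi y <-> span S (x - y).
Proof.
rewrite !mpiE.
split=> [/eqP|sxy]; last apply/eqP.
  by rewrite -(Quotient.idealrBE (span_pred S : zmodClosed V)) => /span_predP.
by rewrite -(Quotient.idealrBE (span_pred S : zmodClosed V)); apply/span_predP.
Qed.

Lemma mpi_repr q : mpi (repr q) = q.
Proof. by rewrite mpiE reprK. Qed.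

Lemma mpi_surj q : exists v, q = mpi v.
Proof. by exists (repr q); rewrite mpi_repr. Qed.

Lemma mpiB : zmod_morphism mpi.
Proof. by move=> x y; rewrite !mpiE raddfB. Qed.

HB.instance Definition _ := GRing.isZmodMorphism.Build V modquot mpi mpiB.

Fact modquot_scale_key : unit. Proof. by []. Qed.
Definition modquot_scale : R -> modquot -> modquot :=
  locked_with modquot_scale_key (fun a q => mpi (a *: repr q)).

Lemma modquot_scaleE a v : modquot_scale a (mpi v) = mpi (a *: v).
Proof.
rewrite /modquot_scale locked_withE; apply/mpi_eq; rewrite -scalerBr.
by apply: spanZ; apply/mpi_eq; rewrite mpi_repr.
Qed.

Fact modquot_scalerA a b q :
  modquot_scale a (modquot_scale b q) = modquot_scale (a * b) q.
Proof. by have [v ->] := mpi_surj q; rewrite !modquot_scaleE scalerA. Qed.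

Fact modquot_scale1r : left_id 1 modquot_scale.
Proof. by move=> q; have [v ->] := mpi_surj q; rewrite modquot_scaleE scale1r. Qed.

Fact modquot_scalerDr : right_distributive modquot_scale +%R.
Proof.
move=> a p q; have [u ->] := mpi_surj p; have [v ->] := mpi_surj q.
by rewrite -raddfD !modquot_scaleE -raddfD -scalerDr.
Qed.

Fact modquot_scalerDl q : {morph modquot_scale^~ q : a b / a + b}.
Proof.
move=> a b; have [v ->] := mpi_surj q.
by rewrite !modquot_scaleE -raddfD -scalerDl.
Qed.

HB.instance Definition _ := GRing.Zmodule_isLmodule.Build R modquot
  modquot_scalerA modquot_scale1r modquot_scalerDr modquot_scalerDl.

Fact mpi_scalable : scalable mpi.
Proof. by move=> a v; rewrite -modquot_scaleE. Qed.

HB.instance Definition _ := GRing.isScalable.Build R V modquot *:%R mpi mpi_scalable.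

End ModuleQuotient.

Section RingQuotient.
Context (B : nzRingType).

Definition is_ideal2 (I : set B) : Prop :=
  [/\ I 0, (forall x y, I x -> I y -> I (x - y)),
      (forall b x, I x -> I (b * x)) & (forall b x, I x -> I (x * b))].

Definition ideal_gen (S : set B) : set B := smallest is_ideal2 S.

Lemma ideal_gen_ideal S : is_ideal2 (ideal_gen S).
Proof.
split=> [N [[]//]|x y sx sy N|b x sx N|b x sx N] [/[dup] [[_ sB sL sR]] sN SN].
- by apply: sB; [exact: sx|exact: sy].
- by apply: sL; exact: sx.
- by apply: sR; exact: sx.
Qed.

Definition ideal_pred (S : set B) : {pred B} := fun v => `[< ideal_gen S v >].

Lemma ideal_predP S v : reflect (ideal_gen S v) (v \in ideal_pred S).
Proof. exact: asboolP. Qed.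

Lemma ideal_zmod_closed S : zmod_closed (ideal_pred S).
Proof.
have [s0 sB _ _] := ideal_gen_ideal S; split; first exact/ideal_predP.
by move=> x y /ideal_predP sx /ideal_predP sy; apply/ideal_predP; exact: sB.
Qed.

HB.instance Definition _ S :=
  GRing.isZmodClosed.Build B (ideal_pred S) (ideal_zmod_closed S).

Variable S : set B.

Definition ringquot : Type := {ideal_quot (ideal_pred S : zmodClosed B)}.

HB.instance Definition _ := GRing.Zmodule.on ringquot.
HB.instance Definition _ := EqQuotient.on ringquot.
HB.instance Definition _ := ZmodQuotient.on ringquot.

Fact rpi_key : unit. Proof. by []. Qed.
Definition rpi : B -> ringquot := locked_with rpi_key (fun v => \pi v).

Let rpiE v : rpi v = \pi v.
Proof. by rewrite /rpi locked_withE. Qed.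

Lemma rpi_eq x y : rpi x = rpi y <-> ideal_gen S (x - y).
Proof.
rewrite !rpiE.
split=> [/eqP|sxy]; last apply/eqP.
  by rewrite -(Quotient.idealrBE (ideal_pred S : zmodClosed B)) => /ideal_predP.
by rewrite -(Quotient.idealrBE (ideal_pred S : zmodClosed B)); apply/ideal_predP.
Qed.

Lemma rpi_repr q : rpi (repr q) = q.
Proof. by rewrite rpiE reprK. Qed.

Lemma rpi_surj q : exists v, q = rpi v.
Proof. by exists (repr q); rewrite rpi_repr. Qed.

Lemma rpiB : zmod_morphism rpi.
Proof. by move=> x y; rewrite !rpiE raddfB. Qed.

HB.instance Definition _ := GRing.isZmodMorphism.Build B ringquot rpi rpiB.

Fact ringquot_mul_key : unit. Proof. by []. Qed.
Definition ringquot_mul : ringquot -> ringquot -> ringquot :=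
  locked_with ringquot_mul_key (fun p q => rpi (repr p * repr q)).

Lemma ringquot_mulE u v : ringquot_mul (rpi u) (rpi v) = rpi (u * v).
Proof.
have [_ _ sL sR] := ideal_gen_ideal S.
rewrite /ringquot_mul locked_withE.
transitivity (rpi (repr (rpi u) * v)); apply/rpi_eq.
  by rewrite -mulrBr; apply: sL; apply/rpi_eq; rewrite rpi_repr.
by rewrite -mulrBl; apply: sR; apply/rpi_eq; rewrite rpi_repr.
Qed.

Fact ringquot_mulA : associative ringquot_mul.
Proof.
move=> p q r; have [u ->] := rpi_surj p; have [v ->] := rpi_surj q.
have [w ->] := rpi_surj r.
by rewrite !ringquot_mulE mulrA.
Qed.

Fact ringquot_mul1r : left_id (rpi 1) ringquot_mul.
Proof. by move=> q; have [v ->] := rpi_surj q; rewrite ringquot_mulE mul1r. Qed.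

Fact ringquot_mulr1 : right_id (rpi 1) ringquot_mul.
Proof. by move=> q; have [v ->] := rpi_surj q; rewrite ringquot_mulE mulr1. Qed.

Fact ringquot_mulDl : left_distributive ringquot_mul +%R.
Proof.
move=> p q r; have [u ->] := rpi_surj p; have [v ->] := rpi_surj q.
have [w ->] := rpi_surj r.
by rewrite -raddfD !ringquot_mulE -raddfD -mulrDl.
Qed.

Fact ringquot_mulDr : right_distributive ringquot_mul +%R.
Proof.
move=> p q r; have [u ->] := rpi_surj p; have [v ->] := rpi_surj q.
have [w ->] := rpi_surj r.
by rewrite -raddfD !ringquot_mulE -raddfD -mulrDr.
Qed.

HB.instance Definition _ := GRing.Zmodule_isPzRing.Build ringquot
  ringquot_mulA ringquot_mul1r ringquot_mulr1 ringquot_mulDl ringquot_mulDr.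

Fact rpi_monoid_morphism : monoid_morphism rpi.
Proof. by split=> // x y; rewrite -ringquot_mulE. Qed.

HB.instance Definition _ := GRing.isMonoidMorphism.Build B ringquot rpi
  rpi_monoid_morphism.

End RingQuotient.

Section FreeModule.
Context (R : nzRingType) (X : choiceType) (V : lmodType R).

Definition free_lift (f : X -> V) (g : {malg R[X]}) : V :=
  \sum_(x <- msupp g) g@_x *: f x.

Lemma free_liftEw (d : {fset X}) f g : (msupp g `<=` d)%fset ->
  free_lift f g = \sum_(x <- d) g@_x *: f x.
Proof.
move=> le_gd; rewrite /free_lift (big_fset_incl _ le_gd) // => x _ xNg.
by rewrite (mcoeff_outdom xNg) scale0r.
Qed.

Fact free_lift_linear f : linear (free_lift f).
Proof.
move=> a g h.
pose d := (msupp g `|` msupp h `|` msupp (a *: g + h))%fset.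
have gd : (msupp g `<=` d)%fset by rewrite /d -fsetUA fsubsetUl.
have hd : (msupp h `<=` d)%fset.
  by rewrite /d (fsetUC (msupp g)) -fsetUA fsubsetUl.
have ghd : (msupp (a *: g + h) `<=` d)%fset by rewrite fsubsetUr.
rewrite !(free_liftEw _ gd, free_liftEw _ hd, free_liftEw _ ghd).
rewrite scaler_sumr -big_split; apply: eq_bigr => x _.
by rewrite mcoeffD mcoeffZ scalerDl scalerA.
Qed.

HB.instance Definition _ f :=
  GRing.isLinear.Build R {malg R[X]} V *:%R (free_lift f) (free_lift_linear f).

Lemma free_liftZ f a g : free_lift f (a *: g) = a *: free_lift f g.
Proof. exact: linearZ. Qed.

Lemma free_mkZ (a b : R) x : a *: << b *g x >> = << a * b *g x >> :> {malg R[X]}.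
Proof. by apply/malgP=> k; rewrite mcoeffZ !mcoeffU mulrnAr. Qed.

Lemma free_liftcU f (c : R) x : free_lift f << c *g x >> = c *: f x.
Proof.
by rewrite (@free_liftEw [fset x]%fset) ?msuppU_le // big_seq_fset1 mcoeffUU.
Qed.

Lemma free_liftU f x : free_lift f << x >> = f x.
Proof.
rewrite (@free_liftEw [fset x]%fset) ?msuppU_le // big_seq_fset1.
by rewrite mcoeffUU scale1r.
Qed.

End FreeModule.

Section Tensor.
Context (R : nzRingType) (B : pzRingType).
Variables (W : lmodType R) (ract : W -> B -> W -> Prop) (M : lmodType B).

Local Notation F := {malg R[[the choiceType of (W * M)%type]]}.

Variant tensor_rel : F -> Prop :=
| TensorDl w w' m : tensor_rel (<< (w + w', m) >> - << (w, m) >> - << (w', m) >>)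
| TensorDr w m m' : tensor_rel (<< (w, m + m') >> - << (w, m) >> - << (w, m') >>)
| TensorZ (r : R) w m : tensor_rel (<< (r *: w, m) >> - r *: << (w, m) >>)
| TensorB w b w' m of ract w b w' :
    tensor_rel (<< (w', m) >> - << (w, b *: m) >>).

(* W (x)_B M, a left R-module, for an (R, B)-bimodule W; the right action of
   B on W is given by its graph: [ract w b w'] means w b = w'. *)
Definition tensor : Type := modquot (tensor_rel : set F).

HB.instance Definition _ := GRing.Lmodule.on tensor.

Fact tpure_key : unit. Proof. by []. Qed.
Definition tpure : W -> M -> tensor :=
  locked_with tpure_key (fun w m => mpi _ << (w, m) >>).

Lemma tpureE w m : tpure w m = mpi _ << (w, m) >>.
Proof. by rewrite /tpure locked_withE. Qed.

Lemma tpureDl w w' m : tpure (w + w') m = tpure w m + tpure w' m.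
Proof.
rewrite !tpureE -raddfD; apply/mpi_eq; rewrite opprD addrA.
exact: span_gen (TensorDl w w' m).
Qed.

Lemma tpureDr w m m' : tpure w (m + m') = tpure w m + tpure w m'.
Proof.
rewrite !tpureE -raddfD; apply/mpi_eq; rewrite opprD addrA.
exact: span_gen (TensorDr w m m').
Qed.

Lemma tpureZ r w m : tpure (r *: w) m = r *: tpure w m.
Proof.
rewrite !tpureE -linearZ; apply/mpi_eq.
exact: span_gen (TensorZ r w m).
Qed.

Lemma tpureB w b w' m : ract w b w' -> tpure w' m = tpure w (b *: m).
Proof.
by move=> wbw'; rewrite !tpureE; apply/mpi_eq; exact: span_gen (TensorB m wbw').
Qed.

Lemma tensor_ind (P : tensor -> Prop) :
  P 0 -> (forall s t, P s -> P t -> P (s + t)) ->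
  (forall w m, P (tpure w m)) -> forall t, P t.
Proof.
move=> P0 PD Pp; move=> q; have [g ->] := mpi_surj q; rewrite (monalgE g) raddf_sum.
apply: big_ind => // -[w m] _.
have e : tpure (g@_(w, m) *: w) m = mpi _ << g@_(w, m) *g (w, m) >>.
  rewrite tpureZ tpureE -linearZ; congr (mpi _ _); apply/malgP => k.
  by rewrite mcoeffZ !mcoeffU mulrnAr mulr1.
by move: (Pp (g@_(w, m) *: w) m); rewrite e.
Qed.

Lemma tensor_ext (N : lmodType R) (f g : {linear tensor -> N}) :
  (forall w m, f (tpure w m) = g (tpure w m)) -> f =1 g.
Proof.
move=> fg; apply: tensor_ind => [|s t fs ft|w m]; last exact: fg.
  by rewrite !raddf0.
by rewrite !raddfD; congr (_ + _).
Qed.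

Section Lift.
Variables (N : lmodType R) (f : W -> M -> N).

Fact tlift_key : unit. Proof. by []. Qed.
Definition tlift : tensor -> N :=
  locked_with tlift_key (fun t => free_lift (fun p => f p.1 p.2) (repr t)).

Definition balanced : Prop :=
  [/\ forall w w' m, f (w + w') m = f w m + f w' m,
      forall w m m', f w (m + m') = f w m + f w m',
      forall r w m, f (r *: w) m = r *: f w m
    & forall w b w' m, ract w b w' -> f w' m = f w (b *: m)].

Hypothesis fB : balanced.

Lemma tlift_pi g : tlift (mpi _ g) = free_lift (fun p => f p.1 p.2) g.
Proof.
rewrite /tlift locked_withE; apply/eqP; rewrite -subr_eq0 -raddfB; apply/eqP.
have : span (tensor_rel : set F) (repr (mpi (tensor_rel : set F) g) - g).
  by apply/mpi_eq; rewrite mpi_repr.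
apply: (@smallest_sub _ _ _ [set z | free_lift (fun p => f p.1 p.2) z = 0]).
  split=> [|a x y /= x0 y0]; first exact: raddf0.
  by rewrite free_lift_linear x0 y0 scaler0 addr0.
have [fDl fDr fZ fb] := fB.
move=> _ [w w' m|w m m'|r w m|w b w' m wb] /=;
  rewrite !raddfB /= ?free_liftZ !free_liftU /=.
- by rewrite fDl -addrA -opprD subrr.
- by rewrite fDr -addrA -opprD subrr.
- by rewrite fZ subrr.
- by rewrite (fb _ _ _ _ wb) subrr.
Qed.

Lemma tlift_pure w m : tlift (tpure w m) = f w m.
Proof. by rewrite tpureE tlift_pi free_liftU. Qed.

Lemma tlift_linear : linear tlift.
Proof.
move=> a s t; have [u ->] := mpi_surj s; have [v ->] := mpi_surj t.
by rewrite -linearP !tlift_pi linearP.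
Qed.

End Lift.
End Tensor.

Section TensorMap.
Context (R : nzRingType) (B : pzRingType) (W : lmodType R).
Variables (ract : W -> B -> W -> Prop).

Definition tmap (M M' : lmodType B) (f : {linear M -> M'}) :
  tensor ract M -> tensor ract M' := tlift (fun w m => tpure ract w (f m)).

Variables (M M' : lmodType B) (f : {linear M -> M'}).

Fact tmap_balanced : balanced ract (fun w m => tpure ract w (f m)).
Proof.
split=> [w w' m|w m m'|r w m|w b w' m wb].
- exact: tpureDl.
- by rewrite raddfD tpureDr.
- exact: tpureZ.
- by rewrite linearZ (tpureB _ wb).
Qed.

Lemma tmap_pure w m : tmap f (tpure ract w m) = tpure ract w (f m).
Proof. by rewrite /tmap tlift_pure //; exact: tmap_balanced. Qed.

HB.instance Definition _ := GRing.isLinear.Build R _ _ *:%R (tmap f)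
  (tlift_linear tmap_balanced).

End TensorMap.

HB.mixin Record Lmodule_isLie (K : fieldType) (L : Type) of GRing.Lmodule K L := {
  lie : L -> L -> L;
  lie_linearl : forall a x y z, lie (a *: x + y) z = a *: lie x z + lie y z;
  lie_linearr : forall a x y z, lie x (a *: y + z) = a *: lie x y + lie x z;
  liexx : forall x, lie x x = 0;
  lie_jacobi : forall x y z,
    lie x (lie y z) + lie y (lie z x) + lie z (lie x y) = 0
}.

#[short(type="lieAlgType")]
HB.structure Definition LieAlgebra (K : fieldType) :=
  {L of Lmodule_isLie K L & GRing.Lmodule K L}.

#[short(type="finLieAlgType")]
HB.structure Definition FinLieAlgebra (K : fieldType) :=
  {L of Lmodule_isLie K L & Vector K L}.

Section LieTheory.
Context (K : fieldType) (L : lieAlgType K).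
Implicit Types x y z : L.

Lemma lieDl x y z : lie (x + y) z = lie x z + lie y z.
Proof. by have := lie_linearl 1 x y z; rewrite !scale1r. Qed.

Lemma lieDr x y z : lie x (y + z) = lie x y + lie x z.
Proof. by have := lie_linearr 1 x y z; rewrite !scale1r. Qed.

Lemma lie0x z : lie 0 z = 0.
Proof. by apply: (addrI (lie 0 z)); rewrite -lieDl !addr0. Qed.

Lemma liex0 x : lie x 0 = 0.
Proof. by apply: (addrI (lie x 0)); rewrite -lieDr !addr0. Qed.

Lemma lieZl a x z : lie (a *: x) z = a *: lie x z.
Proof. by have := lie_linearl a x 0 z; rewrite lie0x !addr0. Qed.

Lemma lieZr a x y : lie x (a *: y) = a *: lie x y.
Proof. by have := lie_linearr a x y 0; rewrite liex0 !addr0. Qed.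

Lemma lieC x y : lie y x = - lie x y.
Proof.
apply/eqP; rewrite -addr_eq0; apply/eqP.
by have := liexx (x + y); rewrite lieDl !lieDr !liexx add0r addr0 addrC.
Qed.

End LieTheory.

Record lieHom (K : fieldType) (L L' : lieAlgType K) := LieHom {
  lie_fun :> {linear L -> L'};
  lie_funM : forall x y, lie_fun (lie x y) = lie (lie_fun x) (lie_fun y)
}.

Record lieSub (K : fieldType) (g : finLieAlgType K) := LieSub {
  lie_vs :> {vspace g};
  lie_vsP : forall x y, x \in lie_vs -> y \in lie_vs -> lie x y \in lie_vs
}.

Section LieSub.
Context (K : fieldType) (g : finLieAlgType K) (h : lieSub g).

Definition liesub_of : Type := subvs_of h.

HB.instance Definition _ := Vector.on liesub_of.

Definition liesub_lie (x y : liesub_of) : liesub_of :=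
  Subvs (lie_vsP (subvsP x) (subvsP y)).

Fact liesub_linearl a x y z :
  liesub_lie (a *: x + y) z = a *: liesub_lie x z + liesub_lie y z.
Proof. by apply: val_inj; exact: lie_linearl. Qed.

Fact liesub_linearr a x y z :
  liesub_lie x (a *: y + z) = a *: liesub_lie x y + liesub_lie x z.
Proof. by apply: val_inj; exact: lie_linearr. Qed.

Fact liesub_liexx x : liesub_lie x x = 0.
Proof. by apply: val_inj; exact: liexx. Qed.

Fact liesub_jacobi x y z : liesub_lie x (liesub_lie y z) +
  liesub_lie y (liesub_lie z x) + liesub_lie z (liesub_lie x y) = 0.
Proof. by apply: val_inj; exact: lie_jacobi. Qed.

HB.instance Definition _ := Lmodule_isLie.Build K liesub_of
  liesub_linearl liesub_linearr liesub_liexx liesub_jacobi.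

Definition liesub_val (x : liesub_of) : g := vsval x.

Fact liesub_val_linear : linear liesub_val.
Proof. exact: (linearP (@vsval K g h)). Qed.

HB.instance Definition _ := GRing.isLinear.Build K liesub_of g *:%R liesub_val
  liesub_val_linear.

Fact liesub_valM x y : liesub_val (lie x y) = lie (liesub_val x) (liesub_val y).
Proof. by []. Qed.

Definition liesub_hom : lieHom liesub_of g :=
  @LieHom K liesub_of g liesub_val liesub_valM.

End LieSub.

Section UnivEnv.
Context (K : fieldType) (L : lieAlgType K).

Local Notation F := {malg K[{fmonom L}]}.

Definition fvar (x : L) : F := << fmu x >>.

Variant uea_rel : F -> Prop :=
| UeaLinear (a : K) x y : uea_rel (fvar (a *: x + y) - (a *: fvar x + fvar y))
| UeaLie x y : uea_rel (fvar (lie x y) - (fvar x * fvar y - fvar y * fvar x)).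

Definition uea : Type := ringquot (uea_rel : set F).

HB.instance Definition _ := GRing.PzRing.on uea.

Definition upi (g : F) : uea := rpi _ g.

Fact upi_zmod_morphism : zmod_morphism upi.
Proof. exact: rpiB. Qed.

Fact upi_monoid_morphism : monoid_morphism upi.
Proof. exact: rpi_monoid_morphism. Qed.

HB.instance Definition _ := GRing.isZmodMorphism.Build F uea upi upi_zmod_morphism.
HB.instance Definition _ := GRing.isMonoidMorphism.Build F uea upi
  upi_monoid_morphism.

Lemma upi_surj (u : uea) : exists g, u = upi g.
Proof. exact: rpi_surj. Qed.

Lemma falg_scalarE (c : K) : c%:A = c%:MP :> F.
Proof. by rewrite -mul_malgC mulr1. Qed.

Lemma falg_scalarC (c : K) (g : F) : g * c%:A = c%:A * g.
Proof.
rewrite falg_scalarE mul_malgC malgM_def malgZ_def fgmulgU.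
by apply: eq_bigr => k _; rewrite mulm1 mulrC.
Qed.

Lemma falg_scalarM (a b : K) : (a * b)%:A = a%:A * b%:A :> F.
Proof. by rewrite !falg_scalarE rmorphM. Qed.

Lemma falg_coef1 (x : L) : (fvar x)@_mone = 0.
Proof. by rewrite mcoeffU fm1_eq1. Qed.

Lemma falg_coefM (g g' : F) : (g * g')@_mone = g@_mone * g'@_mone.
Proof. exact: rmorphM. Qed.

Lemma falg_coefB (g g' : F) : (g - g')@_mone = g@_mone - g'@_mone.
Proof. exact: mcoeffB. Qed.

Lemma falg_coef_rel g : uea_rel g -> g@_mone = 0.
Proof.
case=> [a x y|x y].
  rewrite falg_coefB mcoeffD mcoeffZ (falg_coef1 (a *: x + y)).
  by rewrite (falg_coef1 x) (falg_coef1 y) mulr0 addr0 subrr.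
rewrite falg_coefB (falg_coef1 (lie x y)) falg_coefB.
have c0 u v : (fvar u * fvar v)@_mone = 0.
  by rewrite falg_coefM (falg_coef1 u) mul0r.
have := f_equal2 (fun a b : K => 0 - (a - b)) (c0 x y) (c0 y x).
by move=> /= ->; rewrite !subrr.
Qed.

Fact uea_neq0 : 1 != 0 :> uea.
Proof.
apply/eqP => e10; have : rpi (uea_rel : set F) 1 = rpi _ 0.
  by rewrite raddf0; exact: e10.
move/rpi_eq; rewrite subr0 => s1.
suff : (1 : F)@_mone = 0 by rewrite mcoeff1 eqxx => /eqP; rewrite oner_eq0.
move: s1; apply: (@smallest_sub _ _ _ [set g : F | g@_mone = 0]).
  split=> [|x y /= x0 y0|b x /= x0|b x /= x0].
  - exact: mcoeff0.
  - by rewrite mcoeffB x0 y0 subrr.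
  - by rewrite falg_coefM x0 mulr0.
  - by rewrite falg_coefM x0 mul0r.
exact: falg_coef_rel.
Qed.

HB.instance Definition _ := GRing.PzSemiRing_isNonZero.Build uea uea_neq0.

Definition uea_scale (c : K) (u : uea) : uea := upi c%:A * u.

Fact uea_scalerA a b u : uea_scale a (uea_scale b u) = uea_scale (a * b) u.
Proof.
by rewrite /uea_scale falg_scalarM rmorphM mulrA.
Qed.

Fact uea_scale1r : left_id 1 uea_scale.
Proof. by move=> u; rewrite /uea_scale scale1r rmorph1 mul1r. Qed.

Fact uea_scalerDr : right_distributive uea_scale +%R.
Proof. by move=> a u v; rewrite /uea_scale mulrDr. Qed.

Fact uea_scalerDl u : {morph uea_scale^~ u : a b / a + b}.
Proof. by move=> a b; rewrite /uea_scale scalerDl rmorphD mulrDl. Qed.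

HB.instance Definition _ := GRing.Zmodule_isLmodule.Build K uea
  uea_scalerA uea_scale1r uea_scalerDr uea_scalerDl.

Fact uea_scalerAl (c : K) (u v : uea) : c *: (u * v) = (c *: u) * v.
Proof. exact: mulrA. Qed.

HB.instance Definition _ := GRing.Lmodule_isLalgebra.Build K uea uea_scalerAl.

Fact uea_scalerAr (c : K) (u v : uea) : c *: (u * v) = u * (c *: v).
Proof.
rewrite /GRing.scale /= /uea_scale !mulrA; congr (_ * _).
by have [g ->] := upi_surj u; rewrite -!rmorphM falg_scalarC.
Qed.

HB.instance Definition _ := GRing.Lalgebra_isAlgebra.Build K uea uea_scalerAr.

Fact upi_scalable : scalable upi.
Proof. by move=> c g; rewrite -[c *: g]mulr_algl rmorphM. Qed.

HB.instance Definition _ := GRing.isScalable.Build K F uea *:%R upi upi_scalable.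

Fact uin_key : unit. Proof. by []. Qed.
Definition uin : L -> uea := locked_with uin_key (fun x => upi (fvar x)).

Lemma uinE x : uin x = upi (fvar x).
Proof. by rewrite /uin locked_withE. Qed.

Fact uin_linear : linear uin.
Proof.
move=> a x y; rewrite !uinE -linearP; apply/rpi_eq.
exact: sub_gen_smallest (UeaLinear a x y).
Qed.

HB.instance Definition _ := GRing.isLinear.Build K L uea *:%R uin uin_linear.

Lemma uin_lie x y : uin (lie x y) = uin x * uin y - uin y * uin x.
Proof.
rewrite !uinE -!rmorphM -rmorphB; apply/rpi_eq.
exact: sub_gen_smallest (UeaLie x y).
Qed.

Section Lift.
Context (B : algType K) (f : {linear L -> B}).

Fact ulift_key : unit. Proof. by []. Qed.
Definition ulift : uea -> B := locked_with ulift_key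
  (fun u => free_lift (fun w : {fmonom L} => \prod_(x <- w) f x) (repr u)).

Hypothesis fM : forall x y, f (lie x y) = f x * f y - f y * f x.

Local Notation flift := (free_lift (fun w : {fmonom L} => \prod_(x <- w) f x)).

Let flift1 : flift 1 = 1.
Proof. by rewrite free_liftU fm1 big_nil. Qed.

Let flift_var x : flift (fvar x) = f x.
Proof. by rewrite free_liftU fmU big_seq1. Qed.

Let fliftM g g' : flift (g * g') = flift g * flift g'.
Proof.
have flift_sum (I : Type) (r : seq I) (G : I -> F) :
    flift (\sum_(i <- r) G i) = \sum_(i <- r) flift (G i).
  exact: raddf_sum.
rewrite malgME flift_sum mulr_suml; apply: eq_bigr => k _.
rewrite flift_sum mulr_sumr; apply: eq_bigr => k' _.
rewrite free_liftcU fmM big_cat /=.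
by rewrite -scalerAl -scalerAr scalerA.
Qed.

Let fliftB g g' : flift (g - g') = flift g - flift g'.
Proof. exact: raddfB. Qed.

Let flift_rel g : uea_rel g -> flift g = 0.
Proof.
case=> [a x y|x y]; rewrite fliftB.
  rewrite (flift_var (a *: x + y)) free_lift_linear.
  by rewrite (flift_var x) (flift_var y) linearP subrr.
have fvM u v : flift (fvar u * fvar v) = f u * f v.
  by rewrite fliftM (flift_var u) (flift_var v).
rewrite (flift_var (lie x y)) fliftB fM.
have := f_equal2 (fun a b : B => (f x * f y - f y * f x) - (a - b))
  (fvM x y) (fvM y x).
by move=> /= ->; rewrite subrr.
Qed.

Lemma ulift_upi g : ulift (upi g) = flift g.
Proof.
rewrite /ulift locked_withE; apply/eqP; rewrite -subr_eq0 -raddfB; apply/eqP.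
have : ideal_gen (uea_rel : set F) (repr (upi g) - g).
  by apply/rpi_eq; rewrite rpi_repr.
apply: (@smallest_sub _ _ _ [set z | flift z = 0]).
  split=> [|x y /= x0 y0|b x /= x0|b x /= x0].
  - exact: raddf0.
  - by rewrite raddfB /= x0 y0 subrr.
  - by rewrite fliftM x0 mulr0.
  - by rewrite fliftM x0 mul0r.
exact: flift_rel.
Qed.

Fact ulift_monoid_morphism : monoid_morphism ulift.
Proof.
split; first by rewrite -(rmorph1 upi) ulift_upi flift1.
move=> u v; have [g ->] := upi_surj u; have [g' ->] := upi_surj v.
by rewrite -rmorphM !ulift_upi fliftM.
Qed.

Fact ulift_linear : linear ulift.
Proof.
move=> a u v; have [g ->] := upi_surj u; have [g' ->] := upi_surj v.
by rewrite -linearP !ulift_upi free_lift_linear.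
Qed.

Lemma ulift_in x : ulift (uin x) = f x.
Proof. by rewrite uinE ulift_upi flift_var. Qed.

End Lift.

Lemma uea_span (g : F) :
  upi g = \sum_(w <- msupp g) g@_w *: \prod_(x <- w) uin x.
Proof.
rewrite [in LHS](monalgE g) raddf_sum; apply: eq_bigr => w _.
have -> : << g@_w *g w >> = g@_w *: \prod_(x <- w) fvar x.
  rewrite -[g@_w in LHS]mulr1 -free_mkZ; congr (_ *: _).
  case: w => w; rewrite /=; elim: w => [|x w IHw].
    by rewrite big_nil -fmoneE.
  rewrite big_cons -IHw.
  rewrite malgM_def fgmulUU mulr1; congr << _ >>; apply/eqP.
  by rewrite -val_eqE /= fmM fmU.
apply: etrans (linearZ _ _) _; congr (_ *: _).
by apply: etrans (rmorph_prod _ _ _ _) _; apply: eq_bigr => x _; rewrite uinE.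
Qed.

Lemma uea_comm : (forall x y : L, lie x y = 0) -> forall u v : uea, u * v = v * u.
Proof.
move=> L0; have cS (u : uea) :
    (forall x, GRing.comm u (uin x)) -> forall v, GRing.comm u v.
  move=> cu v; have [h ->] := upi_surj v; rewrite uea_span.
  apply: commr_sum => w _; rewrite /GRing.comm -scalerAr -scalerAl.
  by congr (_ *: _); apply: commr_prod => x _; exact: cu.
move=> u v; apply: (cS) => x; apply: commr_sym; apply: (cS) => y.
by apply/eqP; rewrite -subr_eq0 -uin_lie L0 linear0.
Qed.

Lemma uea_ext (B : algType K) (f g : {lrmorphism uea -> B}) :
  (forall x, f (uin x) = g (uin x)) -> f =1 g.
Proof.
move=> fg u; have [h ->] := upi_surj u; rewrite uea_span !raddf_sum.
have fE (k : {lrmorphism uea -> B}) (c : K) (w : {fmonom L}) :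
    k (c *: \prod_(x <- w) uin x) = c *: \prod_(x <- w) k (uin x).
  by apply: etrans (linearZ _ _) _; congr (_ *: _); exact: rmorph_prod.
apply: eq_bigr => w _; apply: etrans (fE f _ _) _.
apply: etrans _ (esym (fE g _ _)); congr (_ *: _).
by apply: eq_bigr => x _.
Qed.

End UnivEnv.

Section UnivEnvMap.
Context (K : fieldType) (L L' : lieAlgType K) (phi : lieHom L L').

Definition uin_hom (x : L) : uea L' := uin (phi x).

Fact uin_hom_linear : linear uin_hom.
Proof. by move=> a x y; rewrite /uin_hom !linearP. Qed.

HB.instance Definition _ := GRing.isLinear.Build K L (uea L') *:%R uin_hom
  uin_hom_linear.

Fact uin_hom_lie x y :
  uin_hom (lie x y) = uin_hom x * uin_hom y - uin_hom y * uin_hom x.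
Proof. by rewrite /uin_hom lie_funM uin_lie. Qed.

Definition umap : uea L -> uea L' := ulift uin_hom.

HB.instance Definition _ := GRing.isLinear.Build K (uea L) (uea L') *:%R umap
  (ulift_linear uin_hom_lie).
HB.instance Definition _ := GRing.isMonoidMorphism.Build (uea L) (uea L') umap
  (ulift_monoid_morphism uin_hom_lie).

Lemma umap_in x : umap (uin x) = uin (phi x).
Proof. exact: (ulift_in uin_hom_lie). Qed.

End UnivEnvMap.

Section Current.
Context (K : fieldType) (g : lieAlgType K) (A : comAlgType K).

Definition scale_graph (x : g) (c : K) (x' : g) : Prop := x' = c *: x.

Definition current : Type := tensor scale_graph A.

HB.instance Definition _ := GRing.Lmodule.on current.

Definition cpure (x : g) (a : A) : current := tpure scale_graph x a.

Lemma cpureDl x y a : cpure (x + y) a = cpure x a + cpure y a.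
Proof. exact: tpureDl. Qed.

Lemma cpureDr x a b : cpure x (a + b) = cpure x a + cpure x b.
Proof. exact: tpureDr. Qed.

Lemma cpureZl c x a : cpure (c *: x) a = c *: cpure x a.
Proof. exact: tpureZ. Qed.

Lemma cpureZr c x a : cpure x (c *: a) = c *: cpure x a.
Proof. by rewrite -cpureZl; apply: esym; exact: tpureB. Qed.

Lemma cpure0l a : cpure 0 a = 0.
Proof. by rewrite -(scale0r 0) cpureZl scale0r. Qed.

Lemma cpureNl x a : cpure (- x) a = - cpure x a.
Proof. by rewrite -scaleN1r cpureZl scaleN1r. Qed.

Lemma current_ind (P : current -> Prop) :
  P 0 -> (forall s t, P s -> P t -> P (s + t)) ->
  (forall x a, P (cpure x a)) -> forall t, P t.
Proof. exact: tensor_ind. Qed.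

Lemma balanced_scale (N : lmodType K) (f : g -> A -> N) :
  (forall c x y a, f (c *: x + y) a = c *: f x a + f y a) ->
  (forall c x a b, f x (c *: a + b) = c *: f x a + f x b) ->
  balanced scale_graph f.
Proof.
move=> fl fr.
have fDl x y a : f (x + y) a = f x a + f y a.
  by rewrite -[x in LHS]scale1r fl scale1r.
have fDr x a b : f x (a + b) = f x a + f x b.
  by rewrite -[a in LHS]scale1r fr scale1r.
have f0l a : f 0 a = 0 by apply: (addrI (f 0 a)); rewrite -fDl !addr0.
have f0r x : f x 0 = 0 by apply: (addrI (f x 0)); rewrite -fDr !addr0.
split=> // [c x a|x c _ a ->].
  by rewrite -[c *: x]addr0 fl f0l addr0.
by rewrite -[c *: x]addr0 fl f0l -[c *: a]addr0 fr f0r.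
Qed.

Definition current_lie_pure (y : g) (b : A) : current -> current :=
  tlift (fun x a => cpure (lie x y) (a * b)).

Fact current_lie_pure_balanced y b :
  balanced scale_graph (fun x a => cpure (lie x y) (a * b)).
Proof.
apply: balanced_scale => [c x z a|c x a a'].
  by rewrite lie_linearl cpureDl cpureZl.
by rewrite mulrDl -scalerAl cpureDr cpureZr.
Qed.

Fact current_lie_pureE y b x a :
  current_lie_pure y b (cpure x a) = cpure (lie x y) (a * b).
Proof. exact: (tlift_pure (current_lie_pure_balanced y b)). Qed.

Fact current_lie_pure_linear y b : linear (current_lie_pure y b).
Proof. exact: (tlift_linear (current_lie_pure_balanced y b)). Qed.

Fact current_lie_pureD y b s t :
  current_lie_pure y b (s + t) = current_lie_pure y b s + current_lie_pure y b t.
Proof. by have := current_lie_pure_linear y b 1 s t; rewrite !scale1r. Qed.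

Fact current_lie_pure0 y b : current_lie_pure y b 0 = 0.
Proof.
by apply: (addrI (current_lie_pure y b 0)); rewrite -current_lie_pureD !addr0.
Qed.

Definition current_lie (s t : current) : current :=
  tlift (fun y b => current_lie_pure y b s) t.

Fact current_lie_balanced s :
  balanced scale_graph (fun y b => current_lie_pure y b s).
Proof.
apply: balanced_scale => [c y z b|c y b b']; move: s; apply: current_ind.
- by rewrite !current_lie_pure0 scaler0 addr0.
- by move=> s t Es Et; rewrite !current_lie_pureD Es Et scalerDr addrACA.
- by move=> x a; rewrite !current_lie_pureE lie_linearr cpureDl cpureZl.
- by rewrite !current_lie_pure0 scaler0 addr0.
- by move=> s t Es Et; rewrite !current_lie_pureD Es Et scalerDr addrACA.
- by move=> x a; rewrite !current_lie_pureE mulrDr -scalerAr cpureDr cpureZr.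
Qed.

Fact current_lieE x a y b :
  current_lie (cpure x a) (cpure y b) = cpure (lie x y) (a * b).
Proof.
apply: etrans (tlift_pure (current_lie_balanced _) y b) _.
exact: current_lie_pureE.
Qed.

Fact current_lie_linearr c s t u :
  current_lie s (c *: t + u) = c *: current_lie s t + current_lie s u.
Proof. exact: (tlift_linear (current_lie_balanced s)). Qed.

Fact current_lie0r s : current_lie s 0 = 0.
Proof.
have := current_lie_linearr 1 s 0 0; rewrite !scale1r addr0 => e.
by apply: (addrI (current_lie s 0)); rewrite -e addr0.
Qed.

Fact current_lieDr s t u :
  current_lie s (t + u) = current_lie s t + current_lie s u.
Proof. by have := current_lie_linearr 1 s t u; rewrite !scale1r. Qed.

Fact current_lie_linearl c s t u :
  current_lie (c *: s + t) u = c *: current_lie s u + current_lie t u.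
Proof.
move: u; apply: current_ind => [|u v Eu Ev|y b].
- by rewrite !current_lie0r scaler0 addr0.
- by rewrite !current_lieDr Eu Ev scalerDr addrACA.
have E r : current_lie r (cpure y b) = current_lie_pure y b r.
  exact: (tlift_pure (current_lie_balanced r)).
by rewrite !E current_lie_pure_linear.
Qed.

Fact current_lie0l s : current_lie 0 s = 0.
Proof.
have := current_lie_linearl 1 0 0 s; rewrite !scale1r addr0 => e.
by apply: (addrI (current_lie 0 s)); rewrite -e addr0.
Qed.

Fact current_lieDl s t u :
  current_lie (s + t) u = current_lie s u + current_lie t u.
Proof. by have := current_lie_linearl 1 s t u; rewrite !scale1r. Qed.

Fact current_lieC s t : current_lie s t + current_lie t s = 0.
Proof.
move: s; apply: current_ind => [|s s' Es Es'|x a].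
- by rewrite current_lie0l current_lie0r addr0.
- by rewrite current_lieDl current_lieDr addrACA Es Es' addr0.
move: t; apply: current_ind => [|t t' Et Et'|y b].
- by rewrite current_lie0l current_lie0r addr0.
- by rewrite current_lieDl current_lieDr addrACA Et Et' addr0.
by rewrite !current_lieE [b * a]mulrC -cpureDl (lieC y x) addNr cpure0l.
Qed.

Fact current_liexx s : current_lie s s = 0.
Proof.
move: s; apply: current_ind => [|s t Es Et|x a].
- exact: current_lie0l.
- by rewrite current_lieDl !current_lieDr Es Et add0r addr0 current_lieC.
by rewrite current_lieE liexx cpure0l.
Qed.

Fact current_sum3 (a a' b b' c c' : current) :
  (a + a') + (b + b') + (c + c') = (a + b + c) + (a' + b' + c').
Proof. by rewrite [X in X + _]addrACA [LHS]addrACA. Qed.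

Fact current_jacobi s t u : current_lie s (current_lie t u) +
  current_lie t (current_lie u s) + current_lie u (current_lie s t) = 0.
Proof.
move: s; apply: current_ind => [|s s' Es Es'|x a].
- by rewrite !(current_lie0l, current_lie0r) !addr0.
- rewrite !(current_lieDl, current_lieDr).
  by rewrite current_sum3 Es Es' addr0.
move: t; apply: current_ind => [|s s' Es Es'|y b].
- by rewrite !(current_lie0l, current_lie0r) !addr0.
- rewrite !(current_lieDl, current_lieDr).
  by rewrite current_sum3 Es Es' addr0.
move: u; apply: current_ind => [|s s' Es Es'|z c].
- by rewrite !(current_lie0l, current_lie0r) !addr0.
- rewrite !(current_lieDl, current_lieDr).
  by rewrite current_sum3 Es Es' addr0.
rewrite !current_lieE.
have -> : b * (c * a) = a * (b * c) by rewrite [c * a]mulrC mulrCA.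
have -> : c * (a * b) = a * (b * c) by rewrite mulrCA [c * b]mulrC.
by rewrite -!cpureDl lie_jacobi cpure0l.
Qed.

HB.instance Definition _ := Lmodule_isLie.Build K current
  current_lie_linearl current_lie_linearr current_liexx current_jacobi.

Lemma lie_cpure x a y b : lie (cpure x a) (cpure y b) = cpure (lie x y) (a * b).
Proof. exact: current_lieE. Qed.

Definition current_in (x : g) : current := cpure x 1.

Fact current_in_linear : linear current_in.
Proof. by move=> c x y; rewrite /current_in cpureDl cpureZl. Qed.

HB.instance Definition _ := GRing.isLinear.Build K g current *:%R current_in
  current_in_linear.

Fact current_in_lie x y : current_in (lie x y) = lie (current_in x) (current_in y).
Proof. by rewrite /current_in lie_cpure mulr1. Qed.

Definition current_incl : lieHom g current :=
  @LieHom K g current current_in current_in_lie.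

End Current.

Section CurrentMap.
Context (K : fieldType) (g g' : lieAlgType K) (phi : lieHom g g').
Context (A : comAlgType K).

Definition current_map : current g A -> current g' A :=
  tlift (fun x a => cpure (phi x) a).

Fact current_map_balanced :
  balanced (@scale_graph K g) (fun x (a : A) => cpure (phi x) a).
Proof.
apply: balanced_scale => [c x z a|c x a a'].
  by rewrite linearP cpureDl cpureZl.
by rewrite cpureDr cpureZr.
Qed.

Lemma current_mapE x a : current_map (cpure x a) = cpure (phi x) a.
Proof. exact: (tlift_pure current_map_balanced). Qed.

Fact current_map_linear : linear current_map.
Proof. exact: (tlift_linear current_map_balanced). Qed.

HB.instance Definition _ := GRing.isLinear.Build K (current g A) (current g' A)
  *:%R current_map current_map_linear.

Fact current_map_lie s t :
  current_map (lie s t) = lie (current_map s) (current_map t).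
Proof.
move: s; apply: current_ind => [|s s' Es Es'|x a].
- by rewrite lie0x !raddf0 lie0x.
- by rewrite lieDl !raddfD /= Es Es' -lieDl.
move: t; apply: current_ind => [|t t' Et Et'|y b].
- by rewrite liex0 !raddf0 liex0.
- by rewrite lieDr !raddfD /= Et Et' -lieDr.
by rewrite lie_cpure !current_mapE lie_cpure lie_funM.
Qed.

Definition current_hom : lieHom (current g A) (current g' A) :=
  @LieHom K (current g A) (current g' A) current_map current_map_lie.

End CurrentMap.

Definition restr (R S : pzRingType) (phi : {rmorphism R -> S}) (V : lmodType S)
  : Type := V.

Section Restriction.
Context (R S : pzRingType) (phi : {rmorphism R -> S}) (V : lmodType S).

Local Notation restr := (restr phi V).

HB.instance Definition _ := GRing.Zmodule.on restr.

Definition restr_scale (a : R) (v : restr) : restr := phi a *: (v : V).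

Fact restr_scalerA a b v : restr_scale a (restr_scale b v) = restr_scale (a * b) v.
Proof. by rewrite /restr_scale scalerA rmorphM. Qed.

Fact restr_scale1r : left_id 1 restr_scale.
Proof. by move=> v; rewrite /restr_scale rmorph1 scale1r. Qed.

Fact restr_scalerDr : right_distributive restr_scale +%R.
Proof. by move=> a u v; exact: scalerDr. Qed.

Fact restr_scalerDl v : {morph restr_scale^~ v : a b / a + b}.
Proof. by move=> a b; rewrite /restr_scale rmorphD scalerDl. Qed.

HB.instance Definition _ := GRing.Zmodule_isLmodule.Build R restr
  restr_scalerA restr_scale1r restr_scalerDr restr_scalerDl.

End Restriction.

Section RootData.
Context (K : fieldType) (g : finLieAlgType K).

Definition is_simple_lie : Prop :=
  (exists x y : g, lie x y != 0) /\
  (forall I : {vspace g}, (forall x y : g, y \in I -> lie x y \in I) ->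
    I = 0%VS \/ I = fullv).

Definition ad_semisimple (x : g) : Prop :=
  exists2 b : (\dim {:g}).-tuple g, basis_of {:g} b &
    forall v, v \in b -> exists c : K, lie x v = c *: v.

(* Definition of a Cartan subalgebra of a semisimple Lie algebra over an
   algebraically closed field of characteristic 0: a commutative subalgebra
   of ad-semisimple elements that coincides with its centralizer. *)
Definition is_cartan (h : {vspace g}) : Prop :=
  [/\ forall x y, x \in h -> y \in h -> lie x y = 0,
      forall x, x \in h -> ad_semisimple x
    & forall x, (forall y, y \in h -> lie x y = 0) -> x \in h].

Definition dual (h : lieSub g) := 'Hom(liesub_of h, K^o).

Definition root_space (h : lieSub g) (b : dual h) : set g :=
  [set x | forall t : liesub_of h, lie (liesub_val t) x = (b t : K) *: x].

Definition is_root (h : lieSub g) (b : dual h) : Prop :=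
  b != 0 /\ exists2 x, x != 0 & root_space b x.

Definition nat_span (V : nmodType) (n : nat) (a : 'I_n -> V) : set V :=
  [set v | exists c : 'I_n -> nat, v = \sum_i a i *+ c i].

Definition is_simple_system (h : lieSub g) n (a : 'I_n -> dual h) : Prop :=
  [/\ basis_of fullv [tuple a i | i < n],
      forall i, is_root (a i)
    & forall b, is_root b -> nat_span a b \/ nat_span a (- b)].

(* [coroot i] is the element t of [g_b, g_(-b)], for b the i-th simple root,
   with b t = 2. *)
Record cartanDatum := CartanDatum {
  cartan : lieSub g;
  rank : nat;
  sroot : 'I_rank -> dual cartan;
  coroot : 'I_rank -> liesub_of cartan;
  fweight : 'I_rank -> dual cartan;
  cartanP : is_cartan cartan;
  srootP : is_simple_system sroot;
  corootP : forall i, sroot i (coroot i) = 2%:R /\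
    exists x y, [/\ root_space (sroot i) x, root_space (- sroot i) y
                  & liesub_val (coroot i) = lie x y];
  fweightP : forall i j, fweight i (coroot j) = (i == j)%:R
}.

Variable D : cartanDatum.

Definition weight := dual (cartan D).
Definition Qplus : set weight := nat_span (@sroot D).
Definition Pplus : set weight := nat_span (@fweight D).
Definition wle (mu lam : weight) : Prop := Qplus (lam - mu).

End RootData.

(* A module over a Lie algebra L is a left module over [uea L]. *)
Section Modules.
Context (K : fieldType) (g : finLieAlgType K) (D : cartanDatum g).

Definition finite_dim (B : algType K) (V : lmodType B) (N : set V) : Prop :=
  exists n (e : 'I_n -> V),
    forall v, N v <-> exists c : 'I_n -> K, v = \sum_i (c i)%:A *: e i.

Definition locally_finite_dim (V : lmodType (uea g)) : Prop :=
  forall v : V, exists N : set V, [/\ is_submodule N, finite_dim N & N v].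

Definition weight_space (V : lmodType (uea g)) (mu : weight D) : set V :=
  [set v | forall t, uin (liesub_val t) *: v = (mu t : K)%:A *: v].

Definition irreducible_module (B : pzRingType) (V : lmodType B) : Prop :=
  (exists v : V, v != 0) /\
  (forall N : set V, is_submodule N -> N = [set 0] \/ N = setT).

Definition highest_weight_vector (V : lmodType (uea g)) (lam : weight D) (v : V)
  : Prop :=
  [/\ v != 0, weight_space lam v
    & forall b : weight D, Qplus b -> b != 0 ->
        forall x, root_space b x -> uin x *: v = 0].

Definition is_hw_irrep (V : lmodType (uea g)) (lam : weight D) (v : V) : Prop :=
  [/\ finite_dim (@setT V), irreducible_module V & highest_weight_vector lam v].

End Modules.

Section Weyl.
Context (K : fieldType) (g : finLieAlgType K) (A : comAlgType K).
Variable D : cartanDatum g.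

Local Notation UA := (uea (current g A)).

Definition g_to_current : uea g -> UA := umap (current_incl g A).
HB.instance Definition _ := GRing.RMorphism.on g_to_current.

Definition h_to_current : uea (current (liesub_of (cartan D)) A) -> UA :=
  umap (current_hom (liesub_hom (cartan D)) A).
HB.instance Definition _ := GRing.RMorphism.on h_to_current.

Definition resg (V : lmodType UA) : lmodType (uea g) :=
  [the lmodType (uea g) of restr g_to_current V].

Definition in_IA (V : lmodType UA) : Prop := locally_finite_dim (resg V).

(* the union of the V_mu with not (mu <= nu) *)
Definition off_weights (nu : weight D) (V : lmodType UA) : set V :=
  [set v | exists2 mu : weight D, ~ wle mu nu & @weight_space _ _ D (resg V) mu v].

Definition truncation (nu : weight D) (V : lmodType UA) : lmodType UA :=
  [the lmodType UA of modquot (off_weights nu (V := V))].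

(* V = V^nu: the kernel of V -> V^nu is zero *)
Definition in_IA_le (nu : weight D) (V : lmodType UA) : Prop :=
  in_IA V /\ span (@off_weights nu V) = [set 0].

Definition induced_ract (u : UA^o) (y : uea g) (u' : UA^o) : Prop :=
  u' = u * g_to_current y.

Definition induced (V : lmodType (uea g)) : lmodType UA :=
  [the lmodType UA of tensor induced_ract V].

Variables (lam : weight D) (Vlam : lmodType (uea g)) (vlam : Vlam).

Definition global_weyl : lmodType UA := truncation lam (induced Vlam).

Fact weyl_gen_key : unit. Proof. by []. Qed.
Definition weyl_gen : global_weyl :=
  locked_with weyl_gen_key (mpi _ (tpure induced_ract 1 vlam)).

Definition weyl_ann : set (uea (current (liesub_of (cartan D)) A)) :=
  [set u | h_to_current u *: weyl_gen = 0].

Lemma cartan_current_abelian (s t : current (liesub_of (cartan D)) A) :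
  lie s t = 0.
Proof.
move: s; apply: current_ind => [|s s' Es Es'|x a].
- exact: lie0x.
- by rewrite lieDl Es Es' addr0.
move: t; apply: current_ind => [|t t' Et Et'|y b].
- exact: liex0.
- by rewrite lieDr Et Et' addr0.
rewrite lie_cpure; suff -> : lie x y = 0 by rewrite cpure0l.
have [cD _ _] := cartanP D; apply: val_inj.
exact: (cD _ _ (subvsP x) (subvsP y)).
Qed.

(* [weyl_ann] is already a two-sided ideal, so that [weyl_alg] below is
   U(h (x) A) / Ann(w_lam). *)
Lemma weyl_annE : ideal_gen weyl_ann = weyl_ann.
Proof.
apply: smallest_id.
have aL b x : weyl_ann x -> weyl_ann (b * x).
  by rewrite /weyl_ann /= rmorphM -scalerA => ->; rewrite scaler0.
split=> [|x y|//|b x xA].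
- by rewrite /weyl_ann /= rmorph0 scale0r.
- by rewrite /weyl_ann /= rmorphB scalerBl => -> ->; rewrite subrr.
by rewrite (uea_comm cartan_current_abelian); exact: aL.
Qed.

Definition weyl_alg : pzRingType := [the pzRingType of ringquot weyl_ann].

(* The graph of the right action (u w_lam) y = (u y) w_lam, for u in
   U(g (x) A) and y in U(h (x) A). *)
Definition weyl_ract (w : global_weyl) (b : weyl_alg) (w' : global_weyl) : Prop :=
  exists u y, [/\ w = u *: weyl_gen, b = rpi weyl_ann y
                & w' = (u * h_to_current y) *: weyl_gen].

Definition weyl_functor (M : lmodType weyl_alg) : lmodType UA :=
  [the lmodType UA of tensor weyl_ract M].

Definition weyl_functor_map (M M' : lmodType weyl_alg) (f : {linear M -> M'}) :
  {linear weyl_functor M -> weyl_functor M'} := tmap (ract := weyl_ract) f.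

End Weyl.

Definition short_exact (R : pzRingType) (M1 M2 M3 : lmodType R)
    (f : {linear M1 -> M2}) (h : {linear M2 -> M3}) : Prop :=
  [/\ injective f, forall y, h y = 0 <-> exists x, f x = y
    & forall z, exists y, h y = z].

Definition exact_functor (R S : pzRingType) (F : lmodType R -> lmodType S)
    (Fmap : forall M M' : lmodType R, {linear M -> M'} -> {linear F M -> F M'})
  : Prop :=
  forall (M1 M2 M3 : lmodType R) (f : {linear M1 -> M2}) (h : {linear M2 -> M3}),
    short_exact f h -> short_exact (Fmap _ _ f) (Fmap _ _ h).

Section Ext2.
Context (R : pzRingType) (C : lmodType R -> Prop) (V U : lmodType R).

(* exact sequences 0 -> U -> E1 -> E2 -> V -> 0 *)
Record extension2 := Extension2 {
  ext_E1 : lmodType R;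
  ext_E2 : lmodType R;
  ext_i : {linear U -> ext_E1};
  ext_d : {linear ext_E1 -> ext_E2};
  ext_p : {linear ext_E2 -> V};
  ext_i_inj : injective ext_i;
  ext_exact1 : forall y, ext_d y = 0 <-> exists x, ext_i x = y;
  ext_exact2 : forall y, ext_p y = 0 <-> exists x, ext_d x = y;
  ext_p_surj : forall z, exists y, ext_p y = z
}.

Definition ext_in (E : extension2) : Prop := C (ext_E1 E) /\ C (ext_E2 E).

Definition ext_morph (E E' : extension2) : Prop :=
  exists (f1 : {linear ext_E1 E -> ext_E1 E'}) (f2 : {linear ext_E2 E -> ext_E2 E'}),
    [/\ forall x, f1 (ext_i E x) = ext_i E' x,
        forall x, f2 (ext_d E x) = ext_d E' (f1 x)
      & forall x, ext_p E' (f2 x) = ext_p E x].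

Definition ext_step (E E' : extension2) : Prop :=
  [/\ ext_in E, ext_in E' & ext_morph E E'].

(* Yoneda equivalence of 2-extensions in the full subcategory C *)
Definition yoneda_equiv : extension2 -> extension2 -> Prop :=
  clos_refl_sym_trans extension2 ext_step.

Fact trivial_ext_exact1 (y : U) :
  (\0%R : {linear U -> V}) y = 0 <-> exists x, (idfun : {linear U -> U}) x = y.
Proof. by split=> // _; exists y. Qed.

Fact trivial_ext_exact2 (y : V) :
  (idfun : {linear V -> V}) y = 0 <-> exists x, (\0%R : {linear U -> V}) x = y.
Proof. by split=> [/= ->|[x <-]//]; exists 0. Qed.

Fact trivial_ext_surj (z : V) : exists y, (idfun : {linear V -> V}) y = z.
Proof. by exists z. Qed.

(* 0 -> U = U -0-> V = V -> 0, the zero element of Ext^2(V, U) *)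
Definition trivial_ext : extension2 :=
  Extension2 (fun x y (e : (idfun : {linear U -> U}) x = idfun y) => e)
    trivial_ext_exact1 trivial_ext_exact2 trivial_ext_surj.

Definition Ext2_eq0 : Prop :=
  forall E : extension2, ext_in E -> yoneda_equiv E trivial_ext.

End Ext2.

(* Main.v *)
Require Import Defs.
From HB Require Import structures.
From Stdlib Require Import Relation_Operators.
From mathcomp Require Import all_boot all_order all_algebra.
From mathcomp Require Import boolp classical_sets functions reals complex.
From mathcomp Require Import ring ssrAC.

(** Write F for the Weyl functor, V_lam for the weight space at lam, and I for the
    category of modules with weights at most lam. Two facts about F carry the
    proof. First, F is left adjoint to V |-> V_lam (weyl_lift): W is the universal
    module of I with a vector of weight lam (global_univ), so maps F M -> V are
    A_lam-linear maps M -> V_lam. Secondly, (F M)_lam is M (top_weyl, pure_inj).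
    As V |-> V_lam is exact (weight_lift), it follows that a surjection X -> Z in
    I whose kernel U satisfies U_lam = 0 lets every map F M -> Z lift to X
    (weyl_lifting): Ext^1(F M, U) vanishes.

    If F is exact, let E = (U -> E1 -> E2 -> F M) be an extension with U_lam = 0.
    Its weight spaces at lam form a short exact sequence L1 -> L2 -> M, and the
    extension (U -> U + F L1 -> F L2 -> F M) maps both to E, by the adjunction, and
    to the trivial extension (Ext2_eq0_of_exact).

    Conversely, F is right exact, and for M1 -> M2 -> M3 short exact the kernel U
    of F M1 -> F M2 satisfies U_lam = 0. Triviality of the Yoneda class of
    (U -> F M1 -> F M2 -> F M3) means that F M1 embeds in an extension X of F M2 by
    U (extends_trivial). By weyl_lifting X splits over F M2. Two maps F M1 -> X, the
    embedding and the one through the section, agree in weight lam, hence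
    everywhere; the second kills U, so U = 0 (no_top_split).

    The universal property of W rests on the Lie theory of g. For v in V_lam, the
    submodule generated by (v_lam, v) in V(lam) + V projects onto V(lam), and a
    g-equivariant section of this projection is the graph of a map v_lam |-> v,
    because the weight lam occurs once in that submodule (singular_map). Sections
    exist by complete reducibility (equivariant_section), derived from the
    vanishing of first cohomology (cocycles_innerP) with the Casimir operator of a
    trace form. The trace form of a nontrivial irreducible module is nondegenerate
    as coroots have real eigenvalues (trace_form_nondeg). Complete reducibility
    also makes every locally finite module the sum of its weight spaces
    (rep_sum_of_weights, lfd_weights), which is what exactness of V |-> V_lam
    needs.

    The enveloping algebras are kept abstract until the last part, where the
    equivalence is obtained over any algebraically closed numeric field. *)

Set Implicit Arguments.
Unset Strict Implicit.
Unset Printing Implicit Defensive.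

Import GRing.Theory Num.Theory passmx.
Local Open Scope classical_set_scope.
Local Open Scope ring_scope.

(** * Linear algebra *)

Section LinearAlgebra.
Context (K : fieldType).

Lemma linear_homP (V W : vectType K) (f : V -> W) : linear f ->
  exists F : 'Hom(V, W), forall x, F x = f x.
Proof.
move=> fL.
pose ff : {linear V -> W} := HB.pack f (GRing.isLinear.Build K V W *:%R f fL).
by exists (linfun ff) => x; rewrite lfunE.
Qed.

(** A vspace of maximal dimension inside S is all of S. *)
Lemma subspace_vspaceP (V : vectType K) (S : V -> Prop) :
  S 0 -> (forall a x y, S x -> S y -> S (a *: x + y)) ->
  exists U : {vspace V}, forall v, v \in U <-> S v.
Proof.
move=> S0 SP.
suff: forall n (U : {vspace V}), (\dim {:V} - \dim U < n)%N ->
    (forall v, v \in U -> S v) ->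
    exists U : {vspace V}, forall v, v \in U <-> S v.
  move=> /(_ _ 0%VS (ltnSn _)); apply=> v; rewrite memv0 => /eqP ->.
  exact: S0.
elim=> // n IHn U; rewrite ltnS => dU US.
case: (pselect (forall v, S v -> v \in U)) => [SU|]; first by exists U => v; split; auto.
move/existsNP=> [v /not_implyP[Sv /negP vU]].
apply: (IHn (U + <[v]>)%VS) => [|w /memv_addP[u uU [_ /vlineP[k ->] ->]]]; last first.
  by rewrite addrC; apply: SP => //; exact: US.
have dUv : (\dim U < \dim (U + <[v]>))%N.
  rewrite ltnNge; apply: contra vU => le.
  have /eqP -> : U == (U + <[v]>)%VS by rewrite eqEdim addvSl.
  by rewrite (subvP (addvSr U <[v]>)) ?memv_line.
have dV : (\dim (U + <[v]>) <= \dim {:V})%N by rewrite dimvS ?subvf.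
by apply: leq_trans dU; rewrite ltn_sub2l // (leq_trans dUv).
Qed.

Definition lfun_mx (V : vectType K) (f : 'End(V)) :=
  mxof (vbasis {:V}) (vbasis {:V}) f.

Lemma lfun_mx_linear (V : vectType K) : linear (@lfun_mx V).
Proof. exact: mxof_linear. Qed.

HB.instance Definition _ (V : vectType K) :=
  GRing.isLinear.Build K _ _ *:%R (@lfun_mx V) (@lfun_mx_linear V).

Lemma lfun_mx_comp (V : vectType K) (f h : 'End(V)) :
  lfun_mx (f \o h)%VF = lfun_mx h *m lfun_mx f.
Proof. by apply: mxof_comp; exact: vbasisP. Qed.

Definition lfun_tr (V : vectType K) (f : 'End(V)) : K := \tr (lfun_mx f).

Lemma lfun_tr_linear (V : vectType K) : linear_for *%R (@lfun_tr V).
Proof. by move=> a f h; rewrite /lfun_tr !linearP. Qed.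

HB.instance Definition _ (V : vectType K) :=
  GRing.isLinear.Build K _ _ *%R (@lfun_tr V) (@lfun_tr_linear V).

Lemma lfun_trC (V : vectType K) (f h : 'End(V)) : lfun_tr (f \o h)%VF = lfun_tr (h \o f)%VF.
Proof. by rewrite /lfun_tr !lfun_mx_comp mxtrace_mulC. Qed.

Lemma lfun_mx_eigen (V : vectType K) (f : 'End(V)) a :
  root (char_poly (lfun_mx f)) a <-> exists2 v, v != 0 & f v = a *: v.
Proof.
have bV := vbasisP {:V}.
rewrite -eigenvalue_root_char; split.
  move=> /eigenvalueP[u uf u0]; exists (vecof (vbasis {:V}) u).
    by rewrite vecof_eq0.
  by rewrite (hom_vecof _ bV) uf linearZ.
move=> [v v0 vf]; apply/eigenvalueP; exists (rVof (vbasis {:V}) v).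
  by rewrite -(rVof_app _ bV) vf linearZ.
by rewrite rVof_eq0.
Qed.

End LinearAlgebra.

Section ClosedField.
Context (C : numClosedFieldType).

(** The characteristic polynomial splits, and its subleading coefficient is the
    opposite of the trace. *)
Lemma lfun_tr_eigen (V : vectType C) (f : 'End(V)) : exists rs : seq C,
  lfun_tr f = \sum_(r <- rs) r /\ forall r, r \in rs <-> exists2 v, v != 0 & f v = r *: v.
Proof.
have [rs rsE] := closed_field_poly_normal (char_poly (lfun_mx f)).
rewrite (monicP (char_poly_monic _)) scale1r in rsE.
have srs : size rs = \dim {:V}.
  by apply: succn_inj; rewrite -(size_prod_XsubC rs (fun x => x)) -rsE size_char_poly.
exists rs; split; last first.
  by move=> r; rewrite -root_prod_XsubC -rsE; exact: lfun_mx_eigen.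
have [d0|d0] := posnP (\dim {:V}).
  rewrite d0 in srs; rewrite (size0nil srs) big_nil /lfun_tr.
  by rewrite /mxtrace big1 // => i; have := ltn_ord i; rewrite [X in (_ < X)%N]d0.
apply: oppr_inj; rewrite -coefPn_prod_XsubC; last by rewrite srs -lt0n.
by rewrite -rsE srs char_poly_trace.
Qed.

(** The vectors e^k v have the pairwise distinct eigenvalues a + k c, so only
    finitely many of them are nonzero. *)
Lemma weight_string (V : vectType C) (h e : 'End(V)) c a v : c != 0 ->
  (forall u, h (e u) = e (h u) + c *: e u) -> v != 0 -> h v = a *: v ->
  exists k, iter k e v != 0 /\ e (iter k e v) = 0.
Proof.
move=> c0 he v0 hv.
have hk k : h (iter k e v) = (a + c *+ k) *: iter k e v.
  elim: k => [|k IHk]; first by rewrite addr0.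
  by rewrite iterS he IHk linearZ -scalerDl /= mulrSr addrA.
case: (pselect (exists k, iter k e v = 0)) => [ek|].
  have ek' : exists k, iter k e v == 0 by case: ek => k /eqP; exists k.
  case: (ex_minnP ek') => -[|k] /eqP k0 kmin; first by move/eqP: v0; case.
  exists k; split=> //; apply/negP => /kmin; by rewrite ltnn.
move=> nz; have {}nz : forall j, iter j e v <> 0 by move=> j itj0; apply: nz; exists j.
exfalso.
pose p := char_poly (lfun_mx h).
have p0 : p != 0 by rewrite monic_neq0 ?char_poly_monic.
pose rs := [seq a + c *+ k | k <- iota 0 (size p)].
have urs : uniq rs.
  rewrite map_inj_uniq ?iota_uniq // => k l /addrI /eqP.
  rewrite -[c *+ k]mulr_natr -[c *+ l]mulr_natr (inj_eq (mulfI c0)) eqr_nat.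
  by move/eqP.
have rrs : all (root p) rs.
  apply/allP => _ /mapP[k _ ->]; apply/lfun_mx_eigen; exists (iter k e v) => //.
  exact/eqP.
have := max_poly_roots p0 rrs urs.
by rewrite size_map size_iota ltnn.
Qed.

End ClosedField.

(** * Finite-dimensional representations *)

Section Representations.
Context (K : fieldType) (g : finLieAlgType K).

(** The axioms are pointwise and rho is a bare function, so that the actions
    obtained below by choice are representations without further packaging. *)
Record is_rep (M : vectType K) (rho : g -> 'End(M)) : Prop := IsRep {
  repP : forall a x y m, rho (a *: x + y) m = a *: rho x m + rho y m;
  rep_lie : forall x y m, rho (lie x y) m = rho x (rho y m) - rho y (rho x m)
}.

Definition stable (M : vectType K) (rho : g -> 'End(M)) (U : {vspace M}) :=
  forall x m, m \in U -> rho x m \in U.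

Definition equivariant (M N : vectType K) (rho : g -> 'End(M))
  (sigma : g -> 'End(N)) (f : 'Hom(M, N)) :=
  forall x m, f (rho x m) = sigma x (f m).

Section Basics.
Context (M : vectType K) (rho : g -> 'End(M)) (rhoP : is_rep rho).

Lemma repD x y m : rho (x + y) m = rho x m + rho y m.
Proof. by have := repP rhoP 1 x y m; rewrite !scale1r. Qed.

Lemma rep0 m : rho 0 m = 0.
Proof. by apply: (addrI (rho 0 m)); rewrite -repD !addr0. Qed.

Lemma repZ a x m : rho (a *: x) m = a *: rho x m.
Proof. by have := repP rhoP a x 0 m; rewrite rep0 !addr0. Qed.

Lemma rep_sum I (r : seq I) (F : I -> g) m :
  rho (\sum_(i <- r) F i) m = \sum_(i <- r) rho (F i) m.
Proof.
elim: r => [|i r IHr]; first by rewrite !big_nil rep0.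
by rewrite !big_cons repD IHr.
Qed.

Lemma rep_linear : linear rho.
Proof.
by move=> a x y; apply/lfunP => m; rewrite add_lfunE scale_lfunE (repP rhoP).
Qed.

Lemma sub_rep (U : {vspace M}) : stable rho U ->
  exists (N : vectType K) (sigma : g -> 'End(N)) (j : 'Hom(N, M)),
    [/\ is_rep sigma, injective j, equivariant sigma rho j,
        forall m, m \in U <-> exists n, j n = m & \dim {:N} = \dim U].
Proof.
move=> sU; pose N : vectType K := subvs_of U.
pose j : 'Hom(N, M) := linfun (@vsval _ _ U).
pose sigma x : 'End(N) := (linfun (@vsproj _ _ U) \o rho x \o j)%VF.
have sE x (n : N) : j (sigma x n) = rho x (j n).
  rewrite /sigma /j !comp_lfunE !lfunE /= vsprojK //.
  by apply: sU; exact: subvsP.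
have jI : injective j by move=> n n'; rewrite /j !lfunE => /subvs_inj.
exists N, sigma, j; split=> //.
- split=> [a x y n|x y n]; apply: jI.
    by rewrite linearP /= !sE (repP rhoP).
  by rewrite linearB /= !sE (rep_lie rhoP).
- move=> m; split=> [mU|[n <-]]; last by rewrite /j lfunE; exact: subvsP.
  by exists (vsproj U m); rewrite /j lfunE /= vsprojK.
- by rewrite dimvf /dim.
Qed.

(** The quotient lives on a complement of U and g acts on it through the
    projection along U. *)
Lemma quot_rep (U : {vspace M}) : stable rho U ->
  exists (N : vectType K) (sigma : g -> 'End(N)) (p : 'Hom(M, N)),
    [/\ is_rep sigma, forall n, exists m, p m = n, equivariant rho sigma p,
        forall m, m \in U <-> p m = 0 & (\dim {:N} + \dim U = \dim {:M})%N].
Proof.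
move=> sU; pose V := (U^C)%VS; pose N : vectType K := subvs_of V.
have UV : (V :&: U = 0)%VS by rewrite capvC capv_compl.
have UV' : (U :&: V = 0)%VS by rewrite capv_compl.
pose q := daddv_pi V U.
pose p : 'Hom(M, N) := (linfun (@vsproj _ _ V) \o q)%VF.
pose i : 'Hom(N, M) := linfun (@vsval _ _ V).
have ip m : i (p m) = q m.
  by rewrite /i /p comp_lfunE !lfunE /= vsprojK // memv_pi.
have pi n : p (i n) = n.
  have iI : injective i by move=> u v; rewrite /i !lfunE => /subvs_inj.
  by apply: iI; rewrite ip /q /i lfunE daddv_pi_id //; exact: subvsP.
have qU m : m - q m \in U.
  have mVU : m \in (V + U)%VS by rewrite addvC addv_complf memvf.
  by rewrite -{1}(daddv_pi_add UV mVU) addrAC subrr add0r memv_pi.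
have pU m : m \in U <-> p m = 0.
  have q0 : p m = 0 <-> q m = 0.
    rewrite -ip; split=> [->|im0]; first by rewrite linear0.
    by rewrite -[p m]pi im0 linear0.
  rewrite q0; split=> [mU|qm0]; last by have := qU m; rewrite qm0 subr0.
  have mVU : m \in (V + U)%VS by rewrite addvC addv_complf memvf.
  have := daddv_pi_add UV mVU; rewrite (daddv_pi_id UV') // => qm.
  by apply: (addIr m); rewrite qm add0r.
pose sigma x : 'End(N) := (p \o rho x \o i)%VF.
have sE x m : p (rho x m) = sigma x (p m).
  have -> : sigma x (p m) = p (rho x (q m)).
    by rewrite -ip /sigma comp_lfunE [LHS]comp_lfunE.
  by apply/eqP; rewrite -subr_eq0 -!linearB; apply/eqP/pU/sU.
have pS n : exists m, p m = n by exists (i n).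
exists N, sigma, p; split=> //.
- split=> [a x y n|x y n]; have [m <-] := pS n.
    by rewrite -!sE (repP rhoP) linearP.
  by rewrite -!sE (rep_lie rhoP) linearB.
- rewrite -(limg_ker_dim p fullv) capfv addnC; congr (_ + _)%N.
    congr (\dim _); apply/vspaceP => m; rewrite memv_ker.
    by apply/idP/eqP => /pU.
  congr (\dim _); apply/vspaceP => n; rewrite memvf; have [m <-] := pS n.
  by rewrite memv_img ?memvf.
Qed.

End Basics.
End Representations.

(** * Weights and roots *)

Section Sums.
Context (V : zmodType).

Inductive sum_of (T : V -> Prop) : V -> Prop :=
| sum_of0 : sum_of T 0
| sum_of_cons x v of T x & sum_of T v : sum_of T (x + v).

Lemma sum_of1 (T : V -> Prop) x : T x -> sum_of T x.
Proof. by move=> Tx; rewrite -[x]addr0; apply: sum_of_cons => //; exact: sum_of0. Qed.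

Lemma sum_ofD (T : V -> Prop) u v : sum_of T u -> sum_of T v -> sum_of T (u + v).
Proof.
move=> Tu Tv; elim: Tu => [|x w Tx _ IHw]; first by rewrite add0r.
by rewrite -addrA; apply: sum_of_cons.
Qed.

Lemma sum_of_sum (T : V -> Prop) I (r : seq I) (F : I -> V) :
  (forall i, sum_of T (F i)) -> sum_of T (\sum_(i <- r) F i).
Proof.
by move=> TF; elim/big_ind: _ => // [|u v]; [exact: sum_of0|exact: sum_ofD].
Qed.

End Sums.

Lemma sum_of_map (V W : zmodType) (f : {additive V -> W}) (T : V -> Prop)
  (T' : W -> Prop) : (forall x, T x -> sum_of T' (f x)) ->
  forall v, sum_of T v -> sum_of T' (f v).
Proof.
move=> fT v; elim=> [|x w Tx _ IHw]; first by rewrite raddf0; exact: sum_of0.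
by rewrite raddfD; apply: sum_ofD => //; exact: fT.
Qed.

Section Weights.
Context (C : numClosedFieldType) (g : finLieAlgType C) (D : cartanDatum g).

Local Notation H := (liesub_of (cartan D)).
Local Notation hv := (@liesub_val _ _ (cartan D)).


Definition ad (x : g) : 'End(g) :=
  linfun (HB.pack_for {linear g -> g} (lie x)
    (GRing.isLinear.Build C g g *:%R (lie x) (fun a y z => lie_linearr a x y z))).

Lemma adE x y : ad x y = lie x y.
Proof. by rewrite /ad lfunE. Qed.

Lemma ad_rep : is_rep ad.
Proof.
split=> [a x y m|x y m]; first by rewrite !adE lie_linearl.
rewrite !adE; have := lie_jacobi x y m => /eqP.
rewrite addr_eq0 => /eqP j; rewrite [LHS]lieC -j [lie m x]lieC.
by rewrite -scaleN1r lieZr scaleN1r.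
Qed.

(** The change of basis matrix lists the eigenvectors of ad x by rows. *)
Lemma ad_semisimple_diag x : ad_semisimple x -> diagonalizable (lfun_mx (ad x)).
Proof.
move=> [b bB bx]; have bV := vbasisP {:g}; set e := vbasis {:g} in bV.
pose P : 'M[C]_(\dim {:g}) := \matrix_i rVof e b`_i.
have uP : P \in unitmx.
  rewrite -row_free_unit; apply/inj_row_free => v vP0.
  have : \sum_i v 0 i *: b`_i = 0.
    apply/eqP; rewrite -(rVof_eq0 bV) linear_sum -[X in _ == X]vP0 mulmx_sum_row.
    by apply/eqP/eq_bigr => i _; rewrite linearZ rowK.
  have /freeP bf := basis_free bB.
  by move=> /bf v0; apply/rowP => i; rewrite mxE.
exists P => //; rewrite /similar_to conjumx //; apply/is_diag_mxP => i j ij.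
have [c bc] : exists c, lie x b`_i = c *: b`_i.
  by apply: bx; rewrite mem_nth // size_tuple.
have rPA : row i (P *m lfun_mx (ad x) *m invmx P) = c *: delta_mx 0 i.
  rewrite !row_mul rowK -(rVof_app _ bV) adE bc linearZ /= -scalemxAl.
  congr (_ *: _); rewrite -[rVof _ _](rowK (fun i => rVof e b`_i) i) -/P.
  by rewrite -row_mul mulmxV // row1.
have := congr1 (fun r : 'rV_ _ => r 0 j) rPA; rewrite !mxE => ->.
by rewrite eqxx -val_eqE [val j == _]eq_sym (negPf ij) mulr0.
Qed.

Section Rep.
Context (M : vectType C) (rho : g -> 'End(M)) (rhoP : is_rep rho).

Definition rep_weight (mu : weight D) (m : M) : Prop :=
  forall t, rho (hv t) m = (mu t : C) *: m.

Definition rep_weights (m : M) : Prop := exists mu, rep_weight mu m.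

(** As m is nonzero, its eigenvalue under t determines a linear function of t. *)
Lemma eigen_weight m :
  (forall t, exists c, rho (hv t) m = c *: m) -> rep_weights m.
Proof.
move=> me; have [->|m0] := eqVneq m 0.
  by exists 0 => t; rewrite linear0 scaler0.
have [c cE] := choice me.
have cL : linear (c : H -> C^o).
  move=> a t u; apply/eqP; rewrite -subr_eq0.
  have /eqP := esym (cE (a *: t + u)).
  rewrite linearP (repP rhoP) !cE scalerA -scalerDl -subr_eq0 -scalerBl scaler_eq0.
  by rewrite (negPf m0) orbF.
by have [mu muE] := linear_homP cL; exists mu => t; rewrite muE.
Qed.

Lemma eigen_basis m :
  (forall t, t \in vbasis {:H} -> exists c, rho (hv t) m = c *: m) -> rep_weights m.
Proof.
move=> me; apply: eigen_weight => t.
rewrite (coord_basis (vbasisP _) (memvf t)) linear_sum (rep_sum rhoP).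
pose X := (fun n : M => exists c, n = c *: m).
have: X (\sum_(i < \dim {:H}) rho (hv (coord (vbasis {:H}) i t *: (vbasis {:H})`_i)) m).
  elim/big_ind: _ => [|_ _ [a ->] [b ->]|i _].
  - by exists 0; rewrite scale0r.
  - by exists (a + b); rewrite scalerDl.
  have [|c ci] := me (vbasis {:H})`_i; first by rewrite mem_nth // size_tuple.
  by exists (coord (vbasis {:H}) i t * c); rewrite linearZ /= (repZ rhoP) ci scalerA.
by [].
Qed.

Lemma cartan_comm t u m : rho (hv t) (rho (hv u) m) = rho (hv u) (rho (hv t) m).
Proof.
have [hC _ _] := cartanP D; apply/eqP; rewrite -subr_eq0 -(rep_lie rhoP).
by rewrite hC ?(rep0 rhoP) //; exact: subvsP.
Qed.

Lemma lfun_mx_comm (f h : 'End(M)) : (forall m, f (h m) = h (f m)) ->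
  comm_mx (lfun_mx f) (lfun_mx h).
Proof.
by move=> fh; rewrite /comm_mx -!lfun_mx_comp; congr lfun_mx; apply/lfunP => m; rewrite !comp_lfunE fh.
Qed.

Lemma common_weight : (0 < \dim {:M})%N -> exists2 m, m != 0 & rep_weights m.
Proof.
move=> dM; pose As := [seq lfun_mx (rho (hv t)) | t <- vbasis {:H}].
have bV := vbasisP {:M}.
have [|v v0 /allP vA] := @common_eigenvector C _ As dM.
  move=> _ _ /mapP[t _ ->] /mapP[u _ ->]; apply: lfun_mx_comm => m.
  exact: cartan_comm.
exists (vecof (vbasis {:M}) v); first by rewrite vecof_eq0.
apply: eigen_basis => t tB; have /sub_rVP[c vc] := vA _ (map_f _ tB).
by exists c; rewrite (hom_vecof _ bV) vc linearZ.
Qed.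

(** Commuting diagonalizable operators share an eigenbasis. *)
Lemma codiag_weights : (forall t, diagonalizable (lfun_mx (rho (hv t)))) ->
  forall m, sum_of rep_weights m.
Proof.
move=> rD m; pose As := [seq lfun_mx (rho (hv t)) | t <- vbasis {:H}].
have bV := vbasisP {:M}; set e := vbasis {:M} in bV.
have [|P uP /allP PA] := (codiagonalizableP As).1.
  split; last by move=> _ /mapP[t _ ->].
  by move=> _ _ /mapP[t _ ->] /mapP[u _ ->]; apply: lfun_mx_comm => n; exact: cartan_comm.
rewrite -(rVofK bV m) -(mulmxKV uP (rVof e m)) mulmx_sum_row linear_sum.
apply: sum_of_sum => i; apply: sum_of1; rewrite linearZ /=.
set a := (_ *m _) _ _; set w := vecof _ _.
have [mu wmu] : rep_weights w; last first.
  by exists mu => t; rewrite linearZ /= wmu !scalerA mulrC.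
apply: eigen_basis => t tB.
have /= := PA _ (map_f _ tB); rewrite /similar_to conjumx //.
set Q := P *m _ *m _ => /is_diag_mxP Qd.
exists (Q i i); rewrite /w (hom_vecof _ bV) -linearZ; congr (vecof _ _).
rewrite -row_mul -[P *m _](mulmxKV uP) -/Q row_mul.
suff -> : row i Q = Q i i *: delta_mx 0 i by rewrite -scalemxAl -rowE.
move: Q Qd => Q Qd; apply/rowP => j; rewrite !mxE eqxx /=.
have [->|ij] := eqVneq j i; first by rewrite mulr1.
by rewrite mulr0 Qd // val_eqE eq_sym.
Qed.

Lemma rep_weight_root b x mu m : root_space b x -> rep_weight mu m ->
  rep_weight (mu + b) (rho x m).
Proof.
move=> xb mmu t; rewrite add_lfunE scalerDl.
have := rep_lie rhoP (hv t) x m; rewrite xb (repZ rhoP) mmu linearZ /= => /eqP.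
by rewrite -subr_eq0 opprB addrA subr_eq0 addrC => /eqP.
Qed.

End Rep.

(** The Cartan subalgebra consists of commuting ad-semisimple elements. *)
Lemma root_decomposition x : sum_of (fun y => exists b : weight D, root_space b y) x.
Proof.
have adD t : diagonalizable (lfun_mx (ad (hv t))).
  by have [_ hS _] := cartanP D; apply/ad_semisimple_diag/hS; exact: subvsP.
have := codiag_weights ad_rep adD x.
apply: (@sum_of_map _ _ (idfun : {additive g -> g})) => y [b yb].
by apply: sum_of1; exists b => t; rewrite -adE.
Qed.

End Weights.

(** * The trace form of an irreducible representation *)

Section Simple.
Context (C : numClosedFieldType) (g : finLieAlgType C) (D : cartanDatum g).
Hypothesis g_simple : is_simple_lie g.

Local Notation H := (liesub_of (cartan D)).
Local Notation hv := (@liesub_val _ _ (cartan D)).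

Lemma simple_ideal (S : g -> Prop) : S 0 ->
  (forall a x y, S x -> S y -> S (a *: x + y)) ->
  (forall x y, S y -> S (lie x y)) ->
  (forall x, S x -> x = 0) \/ (forall x, S x).
Proof.
move=> S0 SP SI; have [I IE] := subspace_vspaceP S0 SP.
have [_ /(_ I)[x y /IE Sy|I0|I1]] := g_simple; first exact/IE/SI.
  by left=> x /IE; rewrite I0 memv0 => /eqP.
by right=> x; apply/IE; rewrite I1 memvf.
Qed.

(** Without simple roots every root is zero, so g centralizes its Cartan
    subalgebra, hence equals it, and is abelian. *)
Lemma rank_gt0 : 'I_(rank D).
Proof.
have [r0|r0] := posnP (rank D); last by exact: Ordinal r0.
exfalso; have [[x [y xy]] _] := g_simple; have [hC _ hZ] := cartanP D.
have d0 (b : weight D) : b = 0.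
  have [bB _ _] := srootP D; apply/eqP; rewrite -memv0.
  have -> : 0%VS = fullv :> {vspace weight D}; last exact: memvf.
  have /andP[/eqP <- _] := bB; apply/eqP; rewrite eq_sym -subv0.
  apply/span_subvP => v /tnthP[i _]; have := ltn_ord i.
  by rewrite [X in (_ < X)%N]r0.
have gh z : z \in (cartan D : {vspace g}).
  apply: hZ => u hu; have := root_decomposition D z; elim=> [|w v [b wb] _ IHv].
    by rewrite lie0x.
  rewrite lieDl IHv addr0 lieC; have := wb (vsproj (cartan D) u).
  rewrite /liesub_val /= vsprojK // => ->.
  by rewrite (d0 b) zero_lfunE scale0r oppr0.
by rewrite (hC x y) ?eqxx in xy.
Qed.

Section Rep.
Context (M : vectType C) (rho : g -> 'End(M)) (rhoP : is_rep rho).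

Definition irreducible_rep := forall U, stable rho U -> U = 0%VS \/ U = fullv.

Lemma rep_weightZ mu a m : @rep_weight _ _ D _ rho mu m -> rep_weight rho mu (a *: m).
Proof. by move=> mmu t; rewrite linearZ /= mmu !scalerA mulrC. Qed.

(** Root vectors shift weights and root spaces span g, so the sums of weight
    vectors are stable. *)
Lemma weights_submodule : exists U : {vspace M},
  stable rho U /\ forall m, m \in U <-> sum_of (rep_weights D rho) m.
Proof.
have [|a x y Tx Ty|U UE] := subspace_vspaceP (S := sum_of (rep_weights D rho)).
- exact: sum_of0.
- apply: sum_ofD => //; apply: (@sum_of_map _ _ ( *:%R a) (rep_weights D rho)) => //.
  by move=> z [mu zmu]; apply: sum_of1; exists mu; exact: rep_weightZ.
exists U; split=> // x m /UE Tm; apply/UE.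
elim: Tm => [|{}m n [mu mmu] _ IHm]; first by rewrite linear0; exact: sum_of0.
rewrite linearD /=; apply: sum_ofD => //.
have := root_decomposition D x; elim=> [|y z [b yb] _ IHz].
    by rewrite (rep0 rhoP); exact: sum_of0.
rewrite (repD rhoP); apply: sum_of_cons => //.
by exists (mu + b); exact: rep_weight_root.
Qed.

Lemma irreducible_weights : irreducible_rep ->
  forall m, sum_of (rep_weights D rho) m.
Proof.
move=> rI m; have [U [sU UE]] := weights_submodule.
have [d0|dM] := posnP (\dim {:M}).
  have /eqP -> : m == 0; last exact: sum_of0.
  by move/eqP: d0; rewrite dimv_eq0 -memv0 => /eqP <-; exact: memvf.
have [m' m'0 wm'] := common_weight D rhoP dM.
apply/UE; have [U0|->] := rI U sU; last exact: memvf.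
have : m' \in 0%VS by rewrite -U0; apply/UE; exact: sum_of1.
by rewrite memv0 (negPf m'0).
Qed.

(** A finite string of eigenvectors under the raising and then the lowering
    operator pins the eigenvalue down to an integer. *)
Lemma coroot_eigen_real i (m : M) a : m != 0 ->
  rho (hv (coroot i)) m = a *: m -> a \is Num.real.
Proof.
move=> m0 hm; have [s2 [x [y [xr yr hE]]]] := corootP i.
set h := rho (hv (coroot i)); pose e := rho x; pose f := rho y.
have he u : h (e u) = e (h u) + 2%:R *: e u.
  have := rep_lie rhoP (hv (coroot i)) x u; rewrite xr s2 (repZ rhoP) => /eqP.
  by rewrite -subr_eq0 opprB addrA subr_eq0 addrC => /eqP.
have hf u : h (f u) = f (h u) + (- 2%:R) *: f u.
  have := rep_lie rhoP (hv (coroot i)) y u; rewrite yr opp_lfunE s2 (repZ rhoP) => /eqP.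
  by rewrite -subr_eq0 opprB addrA subr_eq0 addrC => /eqP.
have ef u : e (f u) = f (e u) + h u.
  by rewrite /h hE (rep_lie rhoP) addrCA subrr addr0.
have two0 : 2%:R != 0 :> C by rewrite pnatr_eq0.
have [k [v0 ev]] := weight_string two0 he m0 hm.
have hek j : h (iter j e m) = (a + j.*2%:R) *: iter j e m.
  elim: j => [|j IHj]; first by rewrite double0 mulr0n addr0.
  rewrite iterS he IHj linearZ -scalerDl /=; congr (_ *: _).
  by rewrite doubleS -[j.*2.+2]addn2 natrD [RHS]addrA.
set v := iter k e m in v0 ev; have hv := hek k; rewrite -/v in hv.
set b := a + _ in hv.
have mtwo0 : - 2%:R != 0 :> C by rewrite oppr_eq0.
have [l [fl0 ffl]] := weight_string mtwo0 hf v0 hv.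
have hfj j : h (iter j f v) = (b - j.*2%:R) *: iter j f v.
  elim: j => [|j IHj]; first by rewrite double0 mulr0n subr0.
  rewrite iterS hf IHj linearZ -scalerDl /=; congr (_ *: _).
  by rewrite doubleS -[j.*2.+2]addn2 natrD [X in _ = _ + X]opprD [RHS]addrA.
have efj j : e (iter j.+1 f v) = (j.+1%:R * (b - j%:R)) *: iter j f v.
  elim: j => [|j IHj].
    by rewrite /= ef ev linear0 add0r hv mul1r subr0.
  rewrite iterS ef IHj hfj linearZ -scalerDl /=; congr (_ *: _).
  by rewrite -!muln2 natrM -[j.+2]addn1 -[j.+1]addn1 !natrD; ring.
have := efj l; rewrite iterS ffl linear0 => /esym/eqP.
rewrite scaler_eq0 (negPf fl0) orbF mulf_eq0 pnatr_eq0 /= subr_eq0 => /eqP bl.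
have -> : a = l%:R - k.*2%:R by rewrite -bl addrK.
by rewrite rpredB ?realn.
Qed.

Lemma rep_lieE x y : rho (lie x y) = (rho x \o rho y)%VF - (rho y \o rho x)%VF.
Proof.
apply/lfunP => m; rewrite (rep_lie rhoP) add_lfunE opp_lfunE.
by rewrite !comp_lfunE.
Qed.

Definition trace_form x y := lfun_tr (rho x \o rho y)%VF.

Lemma trace_formC x y : trace_form x y = trace_form y x.
Proof. exact: lfun_trC. Qed.

Lemma trace_form_linear x : linear_for *%R (trace_form x).
Proof.
move=> a y z; rewrite /trace_form (rep_linear rhoP) comp_lfunDr -comp_lfunZr.
by rewrite linearP.
Qed.

Lemma trace_form0 x : trace_form 0 x = 0.
Proof.
have := trace_form_linear x 1 0 0; rewrite scaler0 addr0 mul1r => /eqP.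
by rewrite -subr_eq subrr eq_sym trace_formC => /eqP.
Qed.

Lemma trace_formN x y : trace_form (- x) y = - trace_form x y.
Proof.
rewrite trace_formC -[- x]addr0 -scaleN1r trace_form_linear.
by rewrite (trace_formC y 0) trace_form0 addr0 mulN1r trace_formC.
Qed.

Lemma trace_form_inv x y z : trace_form (lie x y) z = trace_form x (lie y z).
Proof.
rewrite /trace_form !rep_lieE.
rewrite comp_lfunDl comp_lfunDr comp_lfunNl comp_lfunNr !linearB /=.
rewrite -!comp_lfunA; congr (_ - _).
by rewrite lfun_trC -comp_lfunA.
Qed.

Lemma rep_kernel x : x != 0 -> (forall m, rho x m = 0) -> forall y m, rho y m = 0.
Proof.
move=> x0 rx.
have [||z y ky|k0|//] := @simple_ideal (fun x => forall m, rho x m = 0).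
- exact: (rep0 rhoP).
- by move=> a y z ky kz m; rewrite (repP rhoP) ky kz scaler0 addr0.
- by move=> m; rewrite (rep_lie rhoP) !ky linear0 subrr.
by rewrite (k0 _ rx) eqxx in x0.
Qed.

(** The radical is an ideal. If it were g, then each squared coroot h would have
    trace 0. This trace is the sum of the eigenvalues of the square of h, which
    are squares of real eigenvalues of h; so h would kill every weight vector, and
    the kernel of the representation would be a nonzero ideal. *)
Lemma trace_form_nondeg : irreducible_rep -> (exists x m, rho x m != 0) ->
  forall x, (forall y, trace_form x y = 0) -> x = 0.
Proof.
move=> rI [x0 [m0 xm0]].
have [||z x kx y|//|kT] := @simple_ideal (fun x => forall y, trace_form x y = 0).
- by move=> y; exact: trace_form0.
- move=> a x y kx ky z; rewrite trace_formC trace_form_linear.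
  by rewrite !(trace_formC z) kx ky mulr0 addr0.
- by rewrite lieC trace_formN trace_form_inv kx oppr0.
pose i := rank_gt0; pose h := hv (coroot i).
have h0 : h != 0.
  apply/eqP => h0; have [s2 _] := corootP i.
  have c0 : coroot i = 0 by apply: val_inj; rewrite linear0; exact: h0.
  by move/eqP: s2; rewrite c0 linear0 eq_sym pnatr_eq0.
move: (kT h h); rewrite /trace_form.
have [rs [-> rsE]] := lfun_tr_eigen (rho h \o rho h)%VF => sum0.
(* r = s ^ 2: either v or h v - s v is an eigenvector of h, for s or - s *)
have rs_ge0 r : r \in rs -> 0 <= r.
  move=> /rsE[v v0]; rewrite comp_lfunE => vr.
  pose s := sqrtC r; have sE : s ^+ 2 = r by rewrite sqrtCK.
  pose w := rho h v - s *: v.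
  suff [c cr ->] : exists2 c : C, c \is Num.real & r = c ^+ 2.
    by rewrite real_exprn_even_ge0.
  have [w0|w0] := eqVneq w 0.
    exists s; last by rewrite sE.
    apply: (@coroot_eigen_real i _ _ v0).
    by apply/eqP; rewrite -subr_eq0; apply/eqP.
  exists (- s); last by rewrite sqrrN sE.
  apply: (@coroot_eigen_real i _ _ w0).
  rewrite /w linearB linearZ /= vr -sE expr2 -scalerA scalerBr !scaleNr opprK.
  by rewrite addrC.
have rs0 r : r \in rs -> r = 0.
  move=> rrs; have /eqP := sum0; rewrite big_seq psumr_eq0; last exact: rs_ge0.
  by move=> /allP/(_ _ rrs)/implyP/(_ rrs)/eqP.
suff rh m : rho h m = 0 by rewrite (rep_kernel h0 rh) eqxx in xm0.
have := irreducible_weights rI m; elim=> [|{}m n [mu mmu] _ IHn].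
  by rewrite linear0.
rewrite linearD /= IHn addr0; have [->|mn0] := eqVneq m 0; first by rewrite linear0.
rewrite mmu; suff /eqP : (mu (coroot i) : C) ^+ 2 = 0.
  by rewrite expf_eq0 /= => /eqP ->; rewrite scale0r.
apply/rs0/rsE; exists m => //.
by rewrite comp_lfunE mmu linearZ /= mmu scalerA expr2.
Qed.

End Rep.
End Simple.

(** * Complete reducibility *)

Section DualFamilies.
Context (K : fieldType) (V : vectType K) (B : V -> V -> K).
Hypothesis BC : forall x y, B x y = B y x.
Hypothesis Blin : forall x, linear_for *%R (B x).
Hypothesis Bnd : forall x, (forall y, B x y = 0) -> x = 0.

Lemma form_sumr I (r : seq I) (F : I -> V) x :
  B x (\sum_(i <- r) F i) = \sum_(i <- r) B x (F i).
Proof.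
have B0 : B x 0 = 0.
  have := Blin x 1 0 0; rewrite scaler0 addr0 mul1r => /eqP.
  by rewrite -subr_eq subrr eq_sym => /eqP.
elim: r => [|i r IHr]; first by rewrite !big_nil.
by rewrite !big_cons -IHr -[F i]scale1r Blin mul1r scale1r.
Qed.

Lemma formZr a x y : B x (a *: y) = a * B x y.
Proof.
have B0 : B x 0 = 0.
  have := Blin x 1 0 0; rewrite scaler0 addr0 mul1r => /eqP.
  by rewrite -subr_eq subrr eq_sym => /eqP.
by rewrite -[_ *: _]addr0 Blin B0 addr0.
Qed.

Lemma form_suml I (r : seq I) (F : I -> V) y :
  B (\sum_(i <- r) F i) y = \sum_(i <- r) B (F i) y.
Proof. by rewrite BC form_sumr; apply: eq_bigr => i _; rewrite BC. Qed.

Lemma formZl a x y : B (a *: x) y = a * B x y.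
Proof. by rewrite BC formZr BC. Qed.

(** The family f comes from the inverse of the Gram matrix of the basis e. *)
Lemma dual_families : exists e f : 'I_(\dim {:V}) -> V,
  [/\ forall x, x = \sum_i B (f i) x *: e i,
      forall x, x = \sum_i B x (e i) *: f i & forall i, B (e i) (f i) = 1].
Proof.
have bV := vbasisP {:V}; set b := vbasis {:V} in bV.
pose e (i : 'I_(\dim {:V})) := b`_i.
have xE x : x = \sum_i coord b i x *: e i by exact: coord_basis (memvf x).
pose G : 'M[K]_(\dim {:V}) := \matrix_(i, j) B (e i) (e j).
have e0 x : (forall j, B x (e j) = 0) -> x = 0.
  move=> xe; apply: Bnd => y; rewrite [y]xE form_sumr big1 // => i _.
  by rewrite formZr xe mulr0.
have uG : G \in unitmx.
  rewrite -row_free_unit; apply/inj_row_free => v vG0.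
  have /e0 : forall j, B (\sum_i v 0 i *: e i) (e j) = 0.
    move=> j; have := congr1 (fun r : 'rV_ _ => r 0 j) vG0; rewrite !mxE => <-.
    by rewrite form_suml; apply: eq_bigr => i _; rewrite formZl mxE.
  have /freeP bf := basis_free bV.
  by move=> /bf v0; apply/rowP => i; rewrite mxE.
pose f i := \sum_k invmx G i k *: e k.
have fe i j : B (f i) (e j) = (i == j)%:R.
  have := congr1 (fun A : 'M_ _ => A i j) (mulVmx uG); rewrite !mxE => <-.
  by rewrite form_suml; apply: eq_bigr => k _; rewrite formZl mxE.
exists e, f; split=> [x|x|i]; last by rewrite BC fe eqxx.
  rewrite {1}[x]xE; apply: eq_bigr => i _; congr (_ *: _).
  rewrite [x in RHS]xE form_sumr (bigD1 i) //= big1 ?addr0 => [|j ji].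
    by rewrite formZr fe eqxx mulr1.
  by rewrite formZr fe eq_sym (negPf ji) mulr0.
apply/eqP; rewrite -subr_eq0; apply/eqP/e0 => j.
rewrite BC -scaleN1r addrC Blin mulN1r !(BC (e j)) form_suml (bigD1 j) //= big1.
  by rewrite formZl fe eqxx mulr1 addr0 addNr.
by move=> i ij; rewrite formZl fe (negPf ij) mulr0.
Qed.

End DualFamilies.

Section Whitehead.
Context (C : numClosedFieldType) (g : finLieAlgType C) (D : cartanDatum g).
Hypothesis g_simple : is_simple_lie g.

Definition cocycles_inner (M : vectType C) (rho : g -> 'End(M)) : Prop :=
  forall d : 'Hom(g, M), (forall x y, d (lie x y) = rho x (d y) - rho y (d x)) ->
  exists m, forall x, d x = rho x m.

(** The kernel of d contains all brackets, so it is an ideal, and it is not 0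
    because g is not abelian. *)
Lemma trivial_cocycles (M : vectType C) (rho : g -> 'End(M)) :
  (forall x m, rho x m = 0) -> cocycles_inner rho.
Proof.
move=> r0 d dE; exists 0 => x; rewrite r0.
have dl y z : d (lie y z) = 0 by rewrite dE !r0 subrr.
have [|a y z dy dz|//|d0|//] := @simple_ideal _ _ g_simple (fun y => d y = 0).
- exact: linear0.
- by rewrite linearP /= dy dz scaler0 addr0.
have [[y [z yz]] _] := g_simple.
by rewrite (d0 _ (dl y z)) eqxx in yz.
Qed.

(** With c the Casimir operator of the trace form and d a cocycle, the vector
    m = sum_i e_i d(f_i) satisfies x m = c d(x); c is invertible, being
    an equivariant map of nonzero trace dim g on an irreducible module. *)
Lemma irreducible_cocycles (M : vectType C) (rho : g -> 'End(M)) :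
  is_rep rho -> irreducible_rep rho -> (exists x m, rho x m != 0) ->
  cocycles_inner rho.
Proof.
move=> rhoP rI rN d dE; pose B := trace_form rho.
have BL := trace_form_linear rhoP.
have Binv := trace_form_inv rhoP.
have [e [f [eE fE ef1]]] := dual_families (trace_formC rho) BL
  (trace_form_nondeg D g_simple rhoP rI rN).
(* the tensor sum_i e_i (x) f_i is g-invariant *)
have inv (N : vectType C) (phi : g -> g -> N) y :
    (forall x, linear (phi x)) -> (forall x, linear (phi^~ x)) ->
  \sum_i (phi (lie y (e i)) (f i) + phi (e i) (lie y (f i))) = 0.
  move=> phr phl.
  have phrE x := linear_homP (phr x); have phlE x := linear_homP (phl x).
  have phr_sum x (F : 'I_(\dim {:g}) -> g) (c : 'I_(\dim {:g}) -> C) :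
      phi x (\sum_i c i *: F i) = \sum_i c i *: phi x (F i).
    have [F' F'E] := phrE x; rewrite -F'E linear_sum; apply: eq_bigr => i _.
    by rewrite linearZ /= F'E.
  have phl_sum x (F : 'I_(\dim {:g}) -> g) (c : 'I_(\dim {:g}) -> C) :
      phi (\sum_i c i *: F i) x = \sum_i c i *: phi (F i) x.
    have [F' F'E] := phlE x; rewrite -F'E linear_sum; apply: eq_bigr => i _.
    by rewrite linearZ /= F'E.
  rewrite big_split /=.
  under eq_bigr do rewrite [lie y (e _)]eE phl_sum.
  under [X in _ + X]eq_bigr do rewrite [lie y (f _)]fE phr_sum.
  rewrite [X in _ + X]exchange_big -big_split big1 //= => i _.
  rewrite -big_split big1 //= => j _; rewrite -scalerDl.
  rewrite -Binv [lie (f j) y]lieC trace_formN // addNr scale0r //.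

have key (psi : 'Hom(g, M)) y : rho y (\sum_i rho (e i) (psi (f i))) =
    \sum_i rho (e i) (rho y (psi (f i)) - psi (lie y (f i))).
  rewrite linear_sum -[LHS]subr0 -[X in _ - X](inv M (fun u v => rho u (psi v)) y).
  - rewrite -sumrB; apply: eq_bigr => i _.
    by rewrite (rep_lie rhoP) linearB /= opprD addrA opprB addrCA subrr addr0.
  - by move=> x a u v; rewrite !linearP.
  - by move=> x a u v; rewrite (repP rhoP).
have [c cE] : exists c : 'End(M), forall m, c m = \sum_i rho (e i) (rho (f i) m).
  apply: linear_homP => a m n; rewrite scaler_sumr -big_split; apply: eq_bigr => i _.
  by rewrite !linearP.
have cC x m : rho x (c m) = c (rho x m).
  have [psi psiE] := linear_homP (fun a u v => repP rhoP a u v m).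
  rewrite !cE; under eq_bigr do rewrite -psiE.
  rewrite key; apply: eq_bigr => i _; rewrite !psiE (rep_lie rhoP).
  by rewrite opprB addrC subrK.
have c_inj : lker c == 0%VS.
  have sk : stable rho (lker c).
    by move=> x m; rewrite !memv_ker => /eqP cm; rewrite -cC cm linear0.
  have [->//|kT] := rI _ sk.
  have /eqP : lfun_tr c = (\dim {:g})%:R.
    have -> : c = \sum_i (rho (e i) \o rho (f i))%VF.
      apply/lfunP => m; rewrite cE sum_lfunE; apply: eq_bigr => i _.
      by rewrite comp_lfunE.
    rewrite linear_sum (eq_bigr (fun=> 1)) => [|i _]; last exact: ef1.
    by rewrite sumr_const card_ord.
  have -> : c = 0.
    by apply/lfunP => m; rewrite zero_lfunE; apply/eqP; rewrite -memv_ker kT memvf.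
  rewrite linear0 eq_sym pnatr_eq0 dimv_eq0 => /eqP g0.
  have [x [m]] := rN; have : x \in fullv by exact: memvf.
  by rewrite g0 memv0 => /eqP ->; rewrite (rep0 rhoP) eqxx.
pose m := \sum_i rho (e i) (d (f i)).
have cd y : c (d y) = rho y m.
  rewrite key cE; apply: eq_bigr => i _; rewrite dE.
  by rewrite opprB addrC subrK.
exists (c^-1%VF m) => x; apply: (lker0P c_inj).
by rewrite cd -cC lker0_lfunVK.
Qed.

(** Whitehead's first lemma. For a proper nonzero stable U, a primitive of the
    cocycle modulo U reduces it to a cocycle with values in U. *)
Lemma cocycles_innerP (M : vectType C) (rho : g -> 'End(M)) :
  is_rep rho -> cocycles_inner rho.
Proof.
have [n] := ubnP (\dim {:M}); elim: n M rho => // n IHn M rho leMn rhoP.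
case: (pselect (irreducible_rep rho)) => [rI|].
  case: (pselect (exists x m, rho x m != 0)) => [|r0].
    exact: irreducible_cocycles.
  apply: trivial_cocycles => x m; apply/eqP; apply/negPn/negP => rxm.
  by apply: r0; exists x, m.
move=> /existsNP[U /not_implyP[sU /not_orP[U0 UT]]] d dE.
have dU : (0 < \dim U)%N by rewrite lt0n dimv_eq0; apply/eqP.
have dUM : (\dim U < \dim {:M})%N.
  rewrite ltnNge; apply/negP => le; apply: UT; apply/eqP.
  by rewrite eqEdim subvf.
have [N [sigma [p [sP pS pE pU dN]]]] := quot_rep rhoP sU.
have [||m mE] := IHn N sigma _ sP (p \o d)%VF.
- by rewrite -ltnS (leq_trans _ leMn) // ltnS -dN -addn1 leq_add2l.
- by move=> x y; rewrite !comp_lfunE dE linearB /= !pE.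
have [m' pm'] := pS m.
have [L [tau [j [tP jI jE jU dL]]]] := sub_rep rhoP sU.
have d1E x : exists l, j l = d x - rho x m'.
  apply/jU/pU; rewrite linearB /= pE pm' -mE comp_lfunE subrr //.
have [d1 d1P] := choice d1E.
have [|d2 d2E] := @linear_homP _ g L d1.
  move=> a x y; apply: jI; rewrite linearP /= !d1P linearP (repP rhoP) /=.
  by rewrite scalerBr opprD addrACA.
have [||l lE] := IHn L tau _ tP d2.
- by rewrite dL (leq_trans dUM).
- move=> x y; apply: jI; rewrite linearB /= !jE !d2E !d1P dE (rep_lie rhoP).
  by rewrite !linearB /= [LHS]addrACA.
exists (m' + j l) => x; rewrite linearD /= -jE -lE d2E d1P.
by rewrite addrC subrK.
Qed.

(** Complete reducibility: correcting a linear section by a cocycle with values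
    in the homomorphisms from N to the kernel makes it equivariant. *)
Lemma equivariant_section (M N : vectType C) (rho : g -> 'End(M))
  (sigma : g -> 'End(N)) (p : 'Hom(M, N)) :
  is_rep rho -> is_rep sigma -> equivariant rho sigma p ->
  (forall n, exists m, p m = n) ->
  exists s : 'Hom(N, M), equivariant sigma rho s /\ forall n, p (s n) = n.
Proof.
move=> rP sP pE pS.
pose act x (f : 'Hom(N, M)) : 'Hom(N, M) := (rho x \o f)%VF - (f \o sigma x)%VF.
have actE x f n : act x f n = rho x (f n) - f (sigma x n).
  by rewrite /act add_lfunE opp_lfunE !comp_lfunE.
move: act actE => act actE.
have actL x : exists F : 'End('Hom(N, M)), forall f, F f = act x f.
  apply: linear_homP => a f h; apply/lfunP => n.
  rewrite add_lfunE scale_lfunE !actE !add_lfunE !scale_lfunE linearP /=.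
  by rewrite scalerBr opprD addrACA.
have [tau tauE] := choice actL.
have tP : is_rep tau.
  split=> [a x y f|x y f]; apply/lfunP => n.
    rewrite add_lfunE scale_lfunE !tauE !actE (repP rP) (repP sP) linearP /=.
    by rewrite scalerBr opprD addrACA.
  rewrite add_lfunE opp_lfunE !tauE !actE (rep_lie rP) (rep_lie sP) !linearB /= !opprK.
  rewrite [RHS](AC ((2*2)*(2*2)) (1*5*(8*4)*(3*6)*(2*7))) /=.
  by rewrite !addNr !addr0.
have sK : exists U : {vspace 'Hom(N, M)}, forall f, f \in U <-> (forall n, p (f n) = 0).
  apply: subspace_vspaceP => [n|a f h pf ph n]; first by rewrite zero_lfunE linear0.
  by rewrite add_lfunE scale_lfunE linearP /= pf ph scaler0 addr0.
have [U UE] := sK.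
have sU : stable tau U.
  by move=> x f /UE pf; apply/UE => n; rewrite tauE actE linearB /= pE !pf linear0 subrr.
have [L [lam [j [lP jI jE jU _]]]] := sub_rep tP sU.
have [s0 s0E] : exists s0 : 'Hom(N, M), forall n, p (s0 n) = n.
  exists (p^-1)%VF => n; apply: limg_lfunVK.
  by have [m <-] := pS n; rewrite memv_img ?memvf.
have dE x : exists l, j l = tau x s0.
  by apply/jU/UE => n; rewrite tauE actE linearB /= pE !s0E subrr.
have [d0 d0E] := choice dE.
have [|d dP] := @linear_homP _ g L d0.
  by move=> a x y; apply: jI; rewrite linearP /= !d0E (repP tP).
have [|l lE] := @cocycles_innerP L lam lP d.
  move=> x y; apply: jI; rewrite linearB /= !jE !dP !d0E.
  exact: (rep_lie tP).
have tj x : tau x (s0 - j l) = 0.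
  by rewrite linearB /= -d0E -dP lE jE subrr.
exists (s0 - j l); split=> [x n|n].
  have := congr1 (fun f : 'Hom(N, M) => f n) (tj x); rewrite tauE actE zero_lfunE => /eqP.
  by rewrite subr_eq0 => /eqP.
rewrite add_lfunE opp_lfunE linearB /= s0E.
have /jU/UE -> : exists l', j l' = j l by exists l.
by rewrite subr0.
Qed.

(** A weight vector of the quotient by the span U of the weight vectors lifts to a
    weight vector, by an equivariant section, hence to an element of U. *)
Lemma rep_sum_of_weights (M : vectType C) (rho : g -> 'End(M)) :
  is_rep rho -> forall m, sum_of (rep_weights D rho) m.
Proof.
move=> rP m; have [U [sU UE]] := weights_submodule D rP.
apply/UE; have [N [sigma [p [sP pS pE pU dN]]]] := quot_rep rP sU.
have [d0|dM] := posnP (\dim {:N}).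
  apply/pU/eqP; rewrite -memv0; have /eqP : \dim {:N} == 0 by apply/eqP.
  by move=> /eqP; rewrite dimv_eq0 => /eqP <-; exact: memvf.
have [n n0 [mu nw]] := common_weight D sP dM.
have [s [sE ps]] := equivariant_section rP sP pE pS.
have : s n \in U.
  by apply/UE; apply: sum_of1; exists mu => t; rewrite -sE nw linearZ.
by move/pU; rewrite ps => n00; rewrite n00 eqxx in n0.
Qed.

End Whitehead.

(** * Modules over an algebra receiving a Lie algebra *)

Section FiniteDimLinear.
Context (K : fieldType) (W : lmodType K).

Definition k_bound (S : W -> Prop) : Prop :=
  exists n (e : 'I_n -> W), forall v, S v -> exists c : 'I_n -> K, v = \sum_i c i *: e i.

(** The coordinates of the elements of S in a finite spanning family form a
    subspace; phi is defined on a complement of the relations. *)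
Lemma k_bound_vect (S : W -> Prop) :
  S 0 -> (forall a u v, S u -> S v -> S (a *: u + v)) -> k_bound S ->
  exists (M : vectType K) (phi : M -> W),
    [/\ injective phi, linear phi & forall v, S v <-> exists m, phi m = v].
Proof.
move=> S0 SD [n [e eS]].
pose psi (c : 'rV[K]_n) : W := \sum_i c 0 i *: e i.
have psiP : linear psi.
  move=> a c d; rewrite /psi scaler_sumr -big_split; apply: eq_bigr => i _.
  by rewrite !mxE scalerDl scalerA.
have psi0 : psi 0 = 0 by rewrite /psi big1 // => i _; rewrite mxE scale0r.
have [|a c d Sc Sd|U UE] := @subspace_vspaceP _ _ (fun c => S (psi c)).
- by rewrite psi0.
- by rewrite psiP; exact: SD.
have [|a c d c0 d0|Z ZE] := @subspace_vspaceP _ _ (fun c => psi c = 0).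
- exact: psi0.
- by rewrite psiP c0 d0 scaler0 addr0.
pose M : vectType K := subvs_of (U :\: Z)%VS.
pose phi (m : M) := psi (vsval m).
have phiP : linear phi by move=> a m l; rewrite /phi linearP psiP.
exists M, phi; split=> //.
  move=> m l e0; apply: subvs_inj; apply/eqP; rewrite -subr_eq0 -memv0.
  rewrite -(capv_diff U Z) memv_cap; apply/andP; split.
    by rewrite memvB ?subvsP.
  by apply/ZE; rewrite addrC -scaleN1r psiP -/(phi m) e0 scaleN1r addNr.
move=> v; split=> [Sv|[m <-]]; last first.
  by apply/UE; apply: (subvP (diffvSl U Z)); exact: subvsP.
have [c vE] := eS v Sv; pose c' : 'rV[K]_n := \row_i c i.
have c'E : psi c' = v by rewrite vE; apply: eq_bigr => i _; rewrite mxE.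
have /UE : S (psi c') by rewrite c'E.
rewrite -(addv_diff_cap U Z) => /memv_addP[a aU [b /memv_capP[_ /ZE b0] cE]].
exists (vsproj (U :\: Z) a); rewrite /phi vsprojK // -c'E cE.
by rewrite -[a in RHS]scale1r psiP b0 addr0 scale1r.
Qed.

Lemma k_bound_vectP (M : vectType K) (phi : M -> W) : linear phi ->
  k_bound (fun v => exists m, phi m = v).
Proof.
move=> phiP; pose f : {linear M -> W} := HB.pack phi (GRing.isLinear.Build K M W *:%R phi phiP).
exists (\dim {:M}), (fun i => f (vbasis {:M})`_i) => _ [m <-].
exists (fun i => coord (vbasis {:M}) i m).
rewrite -[phi m]/(f m) {1}(coord_basis (vbasisP _) (memvf m)) linear_sum.
by apply: eq_bigr => i _; rewrite linearZ.
Qed.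

Lemma k_boundS (S T : W -> Prop) : (forall v, S v -> T v) -> k_bound T -> k_bound S.
Proof. by move=> ST [n [e eT]]; exists n, e => v /ST; exact: eT. Qed.

Lemma k_bound_gens (I : finType) (e : I -> W) (S : W -> Prop) :
  (forall v, S v -> exists c : I -> K, v = \sum_i c i *: e i) -> k_bound S.
Proof.
move=> eS; exists #|I|, (fun i => e (enum_val i)) => v /eS[c ->].
by exists (fun i => c (enum_val i)); rewrite (reindex _ (onW_bij _ (@enum_val_bij I))).
Qed.

End FiniteDimLinear.


Section UeaInduction.
Context (K : fieldType) (L : lieAlgType K).

Lemma uea_ind (P : uea L -> Prop) : P 0 ->
  (forall c u v, P u -> P v -> P (c *: u + v)) -> P 1 ->
  (forall x u, P u -> P (uin x * u)) -> forall u, P u.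
Proof.
move=> P0 PD P1 Px u; have [h ->] := upi_surj u; rewrite uea_span.
elim/big_rec: _ => // w v _ Pv; apply: PD => //.
by elim/big_rec: _ => // x u' _; exact: Px.
Qed.

End UeaInduction.

(** The algebra R stands for the enveloping algebra of L, or of a Lie algebra
    containing L, and iota for the inclusion of L; keeping R abstract confines
    the quotient that defines an enveloping algebra to the instances. *)
Section LieModules.
Context (K : fieldType) (L : lieAlgType K) (R : algType K).
Context (iota : {linear L -> R}).
Hypothesis iotaM : forall x y, iota (lie x y) = iota x * iota y - iota y * iota x.

Definition kmod (V : lmodType R) : lmodType K :=
  [the lmodType K of restr (in_alg R) V].

Lemma kmodE (V : lmodType R) (c : K) (v : V) : c *: (v : kmod V) = c%:A *: v.
Proof. by []. Qed.

Lemma kmod_addE (V : lmodType R) (u v : V) : (u : kmod V) + (v : kmod V) = u + v :> V.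
Proof. by []. Qed.

Lemma kmod_sumE (V : lmodType R) n (c : 'I_n -> K) (F : 'I_n -> V) :
  \sum_i c i *: (F i : kmod V) = \sum_i (c i)%:A *: F i :> V.
Proof.
elim: n c F => [|n IHn] c F; first by rewrite !big_ord0.
by rewrite !big_ord_recl IHn kmodE kmod_addE.
Qed.

Lemma alg_scaleE (V : lmodType R) (c : K) (u : R) (v : V) :
  (c *: u) *: v = c%:A *: (u *: v).
Proof. by rewrite scalerA mulr_algl. Qed.

Lemma alg_scaleC (V : lmodType R) (c : K) (u : R) (v : V) :
  u *: (c%:A *: v) = c%:A *: (u *: v).
Proof. by rewrite !scalerA -scalerAl mul1r -scalerAr mulr1. Qed.

Lemma alg_scaleM (V : lmodType R) (a b : K) (v : V) :
  a%:A *: (b%:A *: v) = (a * b)%:A *: v.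
Proof. by rewrite scalerA -scalerAl mul1r [a *: _]scalerA. Qed.

Definition is_subspace (V : lmodType R) (S : V -> Prop) : Prop :=
  S 0 /\ forall (c : K) u v, S u -> S v -> S (c%:A *: u + v).

Definition lie_stable (V : lmodType R) (S : V -> Prop) : Prop :=
  forall x v, S v -> S (iota x *: v).

Lemma subspaceD (V : lmodType R) (S : V -> Prop) u v : is_subspace S ->
  S u -> S v -> S (u + v).
Proof. by move=> [_ SD] Su Sv; rewrite -[u]scale1r -[1]scale1r; exact: SD. Qed.

Lemma subspaceZ (V : lmodType R) (S : V -> Prop) c v : is_subspace S ->
  S v -> S (c%:A *: v).
Proof. by move=> [S0 SD] Sv; rewrite -[_ *: v]addr0; exact: SD. Qed.

(** Only the positions of the negative generators N are controlled: T, the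
    smallest subspace through Y stable under N, is stable under everything
    because z (y t) = [z, y] t + y (z t). *)
Lemma triangular_span (V : lmodType R) (N B : L -> Prop) (Y X : V -> Prop) :
  (forall x, sum_of (fun y => N y \/ B y) x) ->
  is_subspace Y -> is_subspace X ->
  (forall x y, B x -> Y y -> Y (iota x *: y)) ->
  (forall x y, N x -> Y y -> X (iota x *: y)) ->
  (forall x y, N x -> X y -> X (iota x *: y)) ->
  exists T : V -> Prop, [/\ is_subspace T, lie_stable T, forall v, Y v -> T v &
    forall v, T v -> exists y x, [/\ Y y, X x & v = y + x]].
Proof.
move=> Lgen sY sX BY NY NX; have [Y0 YD] := sY; have [X0 XD] := sX.
pose good S := [/\ is_subspace S, forall v, Y v -> S v &
  forall x v, N x -> S v -> S (iota x *: v)].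
pose T v := forall S, good S -> S v.
have sT : is_subspace T.
  split=> [S [[]]//|c u v Tu Tv S gS]; have [[_ SD] _ _] := gS.
  by apply: SD; [exact: Tu|exact: Tv].
have TY v : Y v -> T v by move=> Yv S [_ YS _]; exact: YS.
have TN x v : N x -> T v -> T (iota x *: v).
  by move=> Nx Tv S gS; have [_ _] := gS; apply=> //; exact: Tv.
exists T; split=> //.
- move=> x v Tv; suff [_ +] : T v /\ forall z, T (iota z *: v) by apply.
  apply: (Tv (fun v => T v /\ forall z, T (iota z *: v))); split.
  - split; first by split=> [|z]; rewrite ?scaler0; case: sT.
    move=> c u w [Tu Tuz] [Tw Twz]; split=> [|z]; first by case: sT => _; apply.
    by rewrite scalerDr alg_scaleC; case: sT => _; apply.
  - move=> y Yy; split=> [|z]; first exact: TY.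
    have := Lgen z; elim=> [|x' z' NBx _ Tz].
      by rewrite linear0 scale0r; case: sT.
    rewrite linearD scalerDl /=; apply: (subspaceD sT) => //.
    by case: NBx => Nx; [apply: TN => //; exact: TY|exact: TY (BY _ _ Nx Yy)].
  - move=> y w Ny [Tw Twz]; split=> [|z]; first exact: TN.
    rewrite scalerA -[iota z * iota y](subrK (iota y * iota z)) -iotaM scalerDl.
    by apply: (subspaceD sT) => //; rewrite -scalerA; exact: TN.
move=> v /(_ (fun v => exists y x, [/\ Y y, X x & v = y + x])); apply; split.
- split; first by exists 0, 0; rewrite addr0.
  move=> c u w [y [x [Yy Xx ->]]] [y' [x' [Yy' Xx' ->]]].
  exists (c%:A *: y + y'), (c%:A *: x + x'); split; [exact: YD|exact: XD|].
  by rewrite scalerDr addrACA.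
- by move=> y Yy; exists y, 0; rewrite addr0.
- move=> z w Nz [y [x [Yy Xx ->]]]; exists 0, (iota z *: y + iota z *: x).
  by rewrite scalerDr add0r; split=> //; apply: (subspaceD sX); [exact: NY|exact: NX].
Qed.

Section Generated.
Hypothesis Rgen : forall P : R -> Prop, P 0 ->
  (forall c u v, P u -> P v -> P (c *: u + v)) -> P 1 ->
  (forall x u, P u -> P (iota x * u)) -> forall u, P u.

Lemma lie_submodule (V : lmodType R) (S : V -> Prop) :
  is_subspace S -> lie_stable S -> is_submodule (S : set V).
Proof.
move=> sS Sx; split=> [|u v w Sv Sw]; first by case: sS.
apply: (subspaceD sS) => //; move: u; apply: Rgen => [|c u u' Su Su'||x u Su].
- by rewrite scale0r; case: sS.
- by rewrite scalerDl alg_scaleE; case: sS => _; apply.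
- by rewrite scale1r.
- by rewrite -scalerA; exact: Sx.
Qed.

Lemma lie_linear (V V' : lmodType R) (f : V -> V') :
  (forall (c : K) u v, f (c%:A *: u + v) = c%:A *: f u + f v) ->
  (forall x v, f (iota x *: v) = iota x *: f v) -> linear f.
Proof.
move=> fD fx; have fA u v : f (u + v) = f u + f v.
  by have := fD 1 u v; rewrite !scale1r.
have f0 : f 0 = 0 by apply: (addrI (f 0)); rewrite -fA !addr0.
have fZ (c : K) v : f (c%:A *: v) = c%:A *: f v.
  by have := fD c v 0; rewrite f0 !addr0.
move=> u v w; rewrite fA; congr (_ + _).
move: u; apply: Rgen => [|c u u' Eu Eu'||x u Eu].
- by rewrite !scale0r.
- by rewrite !scalerDl (alg_scaleE c u v) (alg_scaleE c u (f v)) fA fZ Eu Eu'.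
- by rewrite !scale1r.
- by rewrite -!scalerA fx Eu.
Qed.

End Generated.

End LieModules.

Section FiniteDim.
Context (K : fieldType) (g : finLieAlgType K) (R : algType K).
Context (iota : {linear g -> R}).
Hypothesis iotaM : forall x y, iota (lie x y) = iota x * iota y - iota y * iota x.

Lemma fd_rep (V : lmodType R) (S : V -> Prop) :
  is_subspace S -> lie_stable iota S -> k_bound (S : kmod V -> Prop) ->
  exists (M : vectType K) (rho : g -> 'End(M)) (phi : {linear M -> kmod V}),
    [/\ is_rep rho, injective phi,
        forall x m, phi (rho x m) = iota x *: (phi m : V) &
        forall v, S v <-> exists m, phi m = v].
Proof.
move=> sS stS bS; have [S0 SD] := sS.
have [M [phi0 [phi_inj phiP phiS]]] := k_bound_vect (W := kmod V) S0 SD bS.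
pose phi : {linear M -> kmod V} :=
  HB.pack phi0 (GRing.isLinear.Build K M (kmod V) *:%R phi0 phiP).
have actE (xm : g * M) : exists m', phi0 m' = iota xm.1 *: (phi0 xm.2 : V).
  by apply/phiS/stS/phiS; exists xm.2.
have [act0 act0E] := choice actE.
have actL x : exists F : 'End(M), forall m, F m = act0 (x, m).
  apply: linear_homP => a m l; apply: phi_inj; rewrite phiP !act0E /= phiP.
  by rewrite !kmodE scalerDr alg_scaleC.
have [rho rhoE] := choice actL.
have rE x m : phi0 (rho x m) = iota x *: (phi0 m : V) by rewrite rhoE act0E.
exists M, rho, phi; split=> //.
have phiB m l : phi0 (m - l) = (phi0 m : V) - phi0 l.
  by rewrite [m - l]addrC -[- l]scaleN1r phiP scaleN1r addrC.
split=> [a x y m|x y m]; apply: phi_inj.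
  by rewrite phiP !rE linearP scalerDl alg_scaleE.
by rewrite phiB !rE iotaM scalerBl !scalerA.
Qed.

End FiniteDim.

(** * Weight spaces and maps from highest weight modules *)

Section RootCone.
Context (C : numClosedFieldType) (g : finLieAlgType C) (D : cartanDatum g).
Implicit Types (a b mu : weight D).

Lemma Qplus0 : Qplus (0 : weight D).
Proof. by exists (fun=> 0%N); rewrite big1. Qed.

Lemma QplusD a b : Qplus a -> Qplus b -> Qplus (a + b).
Proof.
move=> [c ->] [d ->]; exists (fun i => (c i + d i)%N).
by rewrite -big_split; apply: eq_bigr => i _; rewrite mulrnDr.
Qed.

(** Simple roots are linearly independent and the characteristic is 0. *)
Lemma Qplus_pointed a : Qplus a -> Qplus (- a) -> a = 0.
Proof.
move=> [c ->] [d dE]; have [sB _ _] := srootP D.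
have /freeP sF := basis_free sB.
have e0 : \sum_(i < rank D) ((c i + d i)%:R : C) *: [tuple sroot i | i < rank D]`_i = 0.
  under eq_bigr => i _ do rewrite -tnth_nth tnth_mktuple natrD scalerDl !scaler_nat.
  by rewrite big_split /= -dE subrr.
rewrite big1 // => i _; have /eqP := sF _ e0 i.
by rewrite pnatr_eq0 addn_eq0 => /andP[/eqP -> _].
Qed.

Lemma root_trichotomy (x : g) :
  sum_of (fun y => (exists b, [/\ b != 0, Qplus (- b) & root_space b y]) \/
    (exists b, [/\ b != 0, Qplus b & root_space b y]) \/
    (exists t : liesub_of (cartan D), y = liesub_val t)) x.
Proof.
have [_ _ hZ] := cartanP D; have [_ _ rootP] := srootP D.
have := root_decomposition D x.
apply: (@sum_of_map _ _ (idfun : {additive g -> g})) => {x} x [b bx].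
apply: sum_of1 => /=; have [b0|b0] := eqVneq b 0.
  right; right; exists (vsproj (cartan D) x); rewrite /liesub_val /= vsprojK //.
  apply: hZ => y hy; have := bx (vsproj (cartan D) y).
  rewrite /liesub_val /= vsprojK // b0 zero_lfunE scale0r lieC => /eqP.
  by rewrite oppr_eq0 => /eqP.
have [x0|x0] := eqVneq x 0.
  by right; right; exists 0; rewrite linear0.
have [|bp|bn] := rootP b; first by split=> //; exists x.
  by right; left; exists b.
by left; exists b.
Qed.

End RootCone.

Section WeightModules.
Context (C : numClosedFieldType) (g : finLieAlgType C) (D : cartanDatum g).
Context (R : algType C) (iota : {linear g -> R}).
Hypothesis g_simple : is_simple_lie g.
Hypothesis iotaM : forall x y, iota (lie x y) = iota x * iota y - iota y * iota x.
Implicit Types (V : lmodType R) (mu lam : weight D).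

(** Locally finite-dimensional, at a single vector. *)
Definition lfd V (v : V) : Prop :=
  exists N : V -> Prop,
    [/\ is_subspace N, lie_stable iota N, k_bound (N : kmod V -> Prop) & N v].

Definition wspace V mu (v : V) : Prop :=
  forall t, iota (liesub_val t) *: v = (mu t : C)%:A *: v.

Definition weight_in V (P : weight D -> Prop) (v : V) : Prop :=
  exists2 mu, P mu & wspace mu v.

Lemma weight_in_sub V (P Q : weight D -> Prop) (v : V) :
  (forall mu, P mu -> Q mu) -> sum_of (weight_in P) v -> sum_of (weight_in Q) v.
Proof.
move=> PQ; apply: (@sum_of_map _ _ (idfun : {additive V -> V})) => x [mu Pm wx].
by apply: sum_of1; exists mu => //; exact: PQ.
Qed.

Lemma wspaceD V mu (u v : V) : wspace mu u -> wspace mu v -> wspace mu (u + v).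
Proof. by move=> wu wv t; rewrite !scalerDr wu wv. Qed.

Lemma wspaceZ V mu (c : C) (v : V) : wspace mu v -> wspace mu (c%:A *: v).
Proof. by move=> wv t; rewrite alg_scaleC wv alg_scaleC. Qed.

Lemma wspace0 V mu : wspace mu (0 : V).
Proof. by move=> t; rewrite !scaler0. Qed.

Lemma wspaceB V mu (u v : V) : wspace mu u -> wspace mu v -> wspace mu (u - v).
Proof.
move=> wu wv; apply: wspaceD => //.
by rewrite -[- v]scaleN1r -scaleN1r; exact: wspaceZ.
Qed.

Lemma weight_in_subspace V (P : weight D -> Prop) :
  is_subspace (fun v : V => sum_of (weight_in P) v).
Proof.
split=> [|c u v Tu Tv]; first exact: sum_of0.
apply: sum_ofD => //; elim: Tu => [|x w [mu Pm wx] _ IHw].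
  by rewrite scaler0; exact: sum_of0.
by rewrite scalerDr; apply: sum_of_cons => //; exists mu => //; exact: wspaceZ.
Qed.

Lemma wspace_root V b mu x (v : V) : root_space b x -> wspace mu v ->
  wspace (mu + b) (iota x *: v).
Proof.
move=> xb wv t.
rewrite scalerA -[_ * iota x](subrK (iota x * iota (liesub_val t))).
rewrite -iotaM xb linearZ /= scalerDl -scalerA wv alg_scaleC alg_scaleE.
by rewrite -scalerDl -scalerDl [in RHS]add_lfunE [in RHS]addrC.
Qed.

Lemma wspace_linear V V' (f : {linear V -> V'}) mu v :
  wspace mu v -> wspace mu (f v).
Proof. by move=> wv t; rewrite -[LHS]linearZ /= wv linearZ. Qed.

Lemma weight_in_linear V V' (f : {linear V -> V'}) (P : weight D -> Prop) v :
  sum_of (weight_in P) v -> sum_of (weight_in P) (f v).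
Proof.
apply: sum_of_map => x [mu Pm wx]; apply: sum_of1; exists mu => //.
exact: wspace_linear.
Qed.

Lemma lfd_weights V (v : V) : lfd v -> sum_of (weight_in (fun=> True)) v.
Proof.
move=> [N [sN stN bN Nv]].
have [M [rho [phi [rP phi_inj rE phiN]]]] := fd_rep iotaM sN stN bN.
have [m <-] := (phiN v).1 Nv.
have := rep_sum_of_weights D g_simple rP m.
apply: (@sum_of_map _ _ (phi : {additive M -> V})) => {}m [mu mmu].
by apply: sum_of1; exists mu => // t; rewrite -rE mmu linearZ.
Qed.

Lemma sum_of_family (V : zmodType) (T : V -> Prop) v : sum_of T v ->
  exists n (F : 'I_n -> V), (forall i, T (F i)) /\ v = \sum_i F i.
Proof.
elim=> [|x w Tx _ [n [F [TF ->]]]].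
  by exists 0%N, (fun=> 0); rewrite big_ord0; split=> // i; case: i.
exists n.+1, (fun i => if unlift ord0 i is Some j then F j else x); split.
  by move=> i; case: unliftP.
rewrite big_ord_recl unlift_none; congr (_ + _).
by apply: eq_bigr => i _; rewrite liftK.
Qed.

(** Where a weight mu of the sum differs from lam at t, the operator mu(t) - t
    kills the mu-component and preserves the weights of all the others. *)
Lemma weights_indep V lam (v : V) : wspace lam v ->
  sum_of (weight_in (fun mu => mu <> lam)) v -> v = 0.
Proof.
move=> wv /sum_of_family[n [F [TF vE]]].
elim: n => [|n IHn] in F TF v wv vE *; first by rewrite vE big_ord0.
have [mu mul wF] := TF ord0.
have [t tE] : exists t, (mu t : C) - lam t != 0.
  apply: contrapT => nt; apply: mul; apply/lfunP => t; apply/eqP.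
  by rewrite -subr_eq0; apply/negPn/negP => ne; apply: nt; exists t.
pose u : R := (mu t : C)%:A - iota (liesub_val t).
have uw nu (w : V) : wspace nu w -> u *: w = ((mu t : C) - nu t)%:A *: w.
  by move=> ww; rewrite /u scalerBl ww -scalerBl -scalerBl.
have uw' nu (w : V) : wspace nu w -> wspace nu (u *: w).
  by move=> ww; rewrite (uw nu) //; exact: wspaceZ.
have : u *: v = 0.
  apply: (IHn (fun i => u *: F (lift ord0 i))) => [i||].
  - by have [nu nul wn] := TF (lift ord0 i); exists nu => //; exact: uw'.
  - exact: uw'.
  rewrite vE big_ord_recl scalerDr (uw mu) // subrr scale0r scale0r add0r.
  by rewrite scaler_sumr.
rewrite (uw lam) // => e0.
have : ((mu t : C) - lam t)^-1%:A *: (((mu t : C) - lam t)%:A *: v) = 0.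
  by rewrite e0 scaler0.
by rewrite scalerA -scalerAl mul1r scalerA mulVf // !scale1r.
Qed.

Lemma weight_split V lam (v : V) : sum_of (weight_in (fun=> True)) v ->
  exists a b, [/\ v = a + b, wspace lam a & sum_of (weight_in (fun mu => mu <> lam)) b].
Proof.
elim=> [|x w [mu _ wx] _ [a [b [-> wa wb]]]].
  by exists 0, 0; rewrite addr0; split=> //; [exact: wspace0|exact: sum_of0].
have [e|/eqP ne] := eqVneq mu lam.
  exists (x + a), b; rewrite addrA; split=> //; apply: wspaceD => //.
  by rewrite -e.
exists a, (x + b); rewrite addrCA; split=> //; apply: sum_of_cons => //.
by exists mu.
Qed.

(** The components of v of weights other than lam map to a vector of weight lam
    that is a sum of vectors of other weights, that is, to 0. *)
Lemma weight_lift V V' (f : {linear V -> V'}) lam v :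
  sum_of (weight_in (fun=> True)) v -> wspace lam (f v) ->
  exists2 u, wspace lam u & f u = f v.
Proof.
move=> Vw wfv; have [a [b [vE wa wb]]] := weight_split lam Vw.
have fb : f b = f v - f a by rewrite vE linearD addrAC subrr add0r.
exists a => //; apply/eqP; rewrite eq_sym -subr_eq0 -fb; apply/eqP.
apply: (@weights_indep _ lam); last exact: weight_in_linear.
by rewrite fb; apply: wspaceB => //; exact: wspace_linear.
Qed.

(** Highest weight vectors and 0. *)
Definition singular lam V (v : V) : Prop :=
  wspace lam v /\
  forall b : weight D, Qplus b -> b != 0 -> forall x, root_space b x -> iota x *: v = 0.

Hypothesis Rgen : forall P : R -> Prop, P 0 ->
  (forall c u v, P u -> P v -> P (c *: u + v)) -> P 1 ->
  (forall x u, P u -> P (iota x * u)) -> forall u, P u.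

(** The submodule generated by (v1, v2) projects onto V1; an equivariant section
    of this projection sends v1 to a vector of weight lam, hence to (v1, v2). *)
Lemma singular_map (V1 V2 : lmodType R) lam (v1 : V1) (v2 : V2) :
  k_bound (fun v : kmod V1 => True) -> irreducible_module V1 ->
  v1 != 0 -> singular lam v1 -> lfd v2 -> singular lam v2 ->
  exists f : {linear V1 -> V2}, f v1 = v2.
Proof.
move=> bV1 [_ irrV1] v10 [wv1 pv1] [N [sN stN bN Nv2]] [wv2 pv2].
pose V : lmodType R := (V1 * V2)%type; pose s : V := (v1, v2).
have sE x : iota x *: s = (iota x *: v1, iota x *: v2) by [].
(* Y is spanned by s, and P collects the weights strictly below lam *)
pose Y (v : V) := exists c : C, v = c%:A *: s.
pose P mu := mu <> lam /\ Qplus (lam - mu).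
pose Nn (x : g) := exists b : weight D, [/\ b != 0, Qplus (- b) & root_space b x].
pose Bb (x : g) := (exists b : weight D, [/\ b != 0, Qplus b & root_space b x]) \/
    (exists t : liesub_of (cartan D), x = liesub_val t).
have lower b mu : b != 0 -> Qplus (- b) -> Qplus (lam - mu) -> P (mu + b).
  move=> b0 qb qm; have qmb : Qplus (lam - (mu + b)) by rewrite opprD addrA; exact: QplusD.
  split=> // e; case/eqP: b0; apply: oppr_inj; rewrite oppr0.
  apply: Qplus_pointed => //; rewrite opprK (_ : b = lam - mu) // -e.
  by rewrite addrAC subrr add0r.
have Yw v : Y v -> wspace lam v.
  by move=> [c ->]; apply: wspaceZ => t; rewrite sE wv1 wv2.
have [||||||T [sT stT YT TE]] := @triangular_span _ _ _ iota iotaM V Nn Bb Y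
    (fun v => sum_of (weight_in P) v).
- exact: (root_trichotomy D).
- split; first by exists 0; rewrite scale0r scale0r.
  move=> c _ _ [a ->] [b ->]; exists (c * a + b).
  by rewrite !scalerDl scalerA -scalerAl mul1r scalerA.
- exact: weight_in_subspace.
- move=> x _ [[b [b0 qb xb]]|[t ->]] [c ->]; rewrite alg_scaleC.
    exists 0; rewrite sE (pv1 b) // (pv2 b) // scale0r scale0r.
    exact: (scaler0 V).
  exists (c * lam t); rewrite sE wv1 wv2 -[(_, _)]/((lam t : C)%:A *: s).
  by rewrite scalerA -scalerAl mul1r scalerA.
- move=> x y [b [b0 qb xb]] /Yw wy; apply: sum_of1; exists (lam + b).
    by apply: lower => //; rewrite subrr; exact: Qplus0.
  exact: wspace_root.
- move=> x y [b [b0 qb xb]]; elim=> [|z w [mu [_ qm] wz] _ IHw].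
    by rewrite scaler0; exact: sum_of0.
  rewrite scalerDr; apply: sum_of_cons => //; exists (mu + b); first exact: lower.
  exact: wspace_root.
pose S (v : V) := T v /\ N v.2.
have sS : is_subspace S.
  have [T0 TD] := sT; have [N0 ND] := sN.
  by split=> [|c u v [Tu Nu] [Tv Nv]]; split=> //; [exact: TD|exact: ND].
have stS : lie_stable iota S.
  by move=> x v [Tv Nv]; split; [exact: stT|exact: stN].
have bS : k_bound (S : kmod V -> Prop).
  have [n1 [e1 eV1]] := bV1; have [n2 [e2 eN]] := bN.
  apply: (@k_bound_gens _ _ ('I_n1 + 'I_n2)%type
    (fun i => match i with inl i => (e1 i, 0) | inr i => (0, e2 i) end)) => v [_ Nv].
  have [c1 c1E] := eV1 v.1 I; have [c2 c2E] := eN _ Nv.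
  exists (fun i => match i with inl i => c1 i | inr i => c2 i end).
  rewrite big_sumType /=.
  have -> : \sum_i c1 i *: ((e1 i, 0) : kmod V) = (\sum_i c1 i *: (e1 i : kmod V1), 0) :> V.
    elim/big_rec2: _ => // i y z _ ->.
    rewrite kmodE -[LHS]/((c1 i)%:A *: e1 i + y, (c1 i)%:A *: (0 : V2) + 0).
    by rewrite scaler0 addr0.
  have -> : \sum_i c2 i *: ((0, e2 i) : kmod V) = (0, \sum_i c2 i *: (e2 i : kmod V2)) :> V.
    elim/big_rec2: _ => // i y z _ ->.
    rewrite kmodE -[LHS]/((c2 i)%:A *: (0 : V1) + 0, (c2 i)%:A *: e2 i + y).
    by rewrite scaler0 addr0.
  by rewrite -c1E -c2E kmod_addE; case: v {Nv c1E c2E} => a b; rewrite -[RHS]/(a + 0, 0 + b) addr0 add0r.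
have [M [rho [phi [rP phi_inj rE phiS]]]] := fd_rep iotaM sS stS bS.
have [M1 [rho1 [phi1 [rP1 phi1_inj rE1 phi1S]]]] :=
  @fd_rep _ _ _ iota iotaM V1 (fun=> True) (conj I (fun _ _ _ _ _ => I))
    (fun _ _ _ => I) bV1.
have inv1E v : exists m, phi1 m = v by exact/phi1S.
have [inv1 inv1K] := choice inv1E.
have [|p pE] := @linear_homP _ M M1 (fun m => inv1 (phi m : V).1).
  by move=> a m n; apply: phi1_inj; rewrite !linearP /= !inv1K !kmodE.
have {}pE m : phi1 (p m) = (phi m : V).1 by rewrite pE inv1K.
have p_eq : equivariant rho rho1 p.
  by move=> x m; apply: phi1_inj; rewrite rE1 !pE rE.
have pS n : exists m, p m = n.
  pose Q (v : V1) := exists m, (phi m : V).1 = v.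
  have sQ : is_submodule (Q : set V1).
    apply: (lie_submodule Rgen).
      split; first by exists 0; rewrite linear0.
      by move=> c _ _ [m <-] [l <-]; exists (c *: m + l); rewrite linearP kmodE.
    by move=> x _ [m <-]; exists (rho x m); rewrite rE.
  have [m phim] : exists m, phi m = s.
    by apply/phiS; split=> //; apply: YT; exists 1; rewrite !scale1r.
  have Qv1 : Q v1 by exists m; rewrite phim.
  have [Q0|QT] := irrV1 Q sQ.
    by have : [set 0] v1 by [rewrite -Q0]; move=> /= v1E; rewrite v1E eqxx in v10.
  have [l lE] : Q (phi1 n) by rewrite QT.
  by exists l; apply: phi1_inj; rewrite pE lE.
have [sec [sec_eq secK]] := equivariant_section D g_simple rP rP1 p_eq pS.
have [m1 m1E] := inv1E v1; pose w : V := phi (sec m1).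
have w1 : w.1 = v1 by rewrite /w -pE secK.
have ww : wspace lam w.
  move=> t; rewrite /w -rE -sec_eq.
  have -> : rho1 (liesub_val t) m1 = (lam t : C) *: m1.
    by apply: phi1_inj; rewrite rE1 linearZ m1E wv1.
  by rewrite !linearZ.
have [Tw _] : S w by apply/phiS; exists (sec m1).
have [y [x [[c yE] Xx wE]]] := TE _ Tw.
have x0 : x = 0.
  apply: (@weights_indep _ lam); last by apply: weight_in_sub Xx => mu [].
  rewrite (_ : x = w - y); first by apply: wspaceB => //; apply: Yw; exists c.
  by rewrite wE addrAC subrr add0r.
have c1 : c = 1.
  apply/eqP; rewrite -subr_eq0; apply/negPn/negP => c10; case/eqP: v10.
  have : (c - 1)%:A *: v1 = 0.
    rewrite scalerBl scalerBl -{2}w1 wE x0 addr0 yE scale1r scale1r /=.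
    by rewrite subrr.
  move=> /(congr1 (fun v => (c - 1)^-1%:A *: v)).
  by rewrite scaler0 scalerA -scalerAl mul1r scalerA mulVf // !scale1r.
have w2 : w.2 = v2 by rewrite wE x0 addr0 yE c1 !scale1r.
pose f (v : V1) : V2 := (phi (sec (inv1 v)) : V).2.
have fL : linear f.
  apply: (lie_linear Rgen) => [a u v|z v]; rewrite /f.
    have -> : inv1 (a%:A *: u + v) = a *: inv1 u + inv1 v.
      by apply: phi1_inj; rewrite linearP /= !inv1K.
    by rewrite !linearP.
  have -> : inv1 (iota z *: v) = rho1 z (inv1 v).
    by apply: phi1_inj; rewrite rE1 !inv1K.
  by rewrite sec_eq rE.
exists (HB.pack f (GRing.isLinear.Build R V1 V2 *:%R f fL) : {linear V1 -> V2}).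
rewrite /= /f (_ : inv1 v1 = m1) //.
by apply: phi1_inj; rewrite inv1K.
Qed.

End WeightModules.

(** * Modules over the current algebra *)

Section LinearMaps.
Context (R : pzRingType).

Lemma linear_mapP (V W : lmodType R) (f : V -> W) : linear f ->
  exists F : {linear V -> W}, forall v, F v = f v.
Proof.
move=> fL.
pose F : {linear V -> W} := HB.pack f (GRing.isLinear.Build R V W *:%R f fL).
by exists F.
Qed.

End LinearMaps.

Section CurrentModules.
Context (C : numClosedFieldType) (g : finLieAlgType C) (D : cartanDatum g).
Context (A : comAlgType C) (R : algType C) (j : {linear current g A -> R}).
Hypothesis g_simple : is_simple_lie g.
Hypothesis jM : forall x y, j (lie x y) = j x * j y - j y * j x.
Hypothesis jgen : forall P : R -> Prop, P 0 ->
  (forall c u v, P u -> P v -> P (c *: u + v)) -> P 1 ->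
  (forall x u, P u -> P (j x * u)) -> forall u, P u.
Implicit Types (V : lmodType R) (mu lam : weight D).

Definition const_in : {linear g -> R} := j \o @current_in C g A.

Lemma const_inM x y : const_in (lie x y) = const_in x * const_in y - const_in y * const_in x.
Proof. by rewrite /const_in /= current_in_lie jM. Qed.

Lemma const_inE x : const_in x = j (cpure x 1).
Proof. by []. Qed.

Lemma lfd0 V : lfd const_in (0 : V).
Proof.
exists (fun v => v = 0); split=> //.
- by split=> // c _ _ -> ->; rewrite scaler0 addr0.
- by move=> x _ ->; rewrite scaler0.
by exists 0%N, (fun=> 0) => _ ->; exists (fun=> 0); rewrite big_ord0.
Qed.

Lemma lfdD V (u v : V) : lfd const_in u -> lfd const_in v -> lfd const_in (u + v).
Proof.
move=> [N [sN stN [n [e eN]] Nu]] [N' [sN' stN' [n' [e' eN']] Nv]].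
exists (fun x => exists y z, [/\ N y, N' z & x = y + z]); split.
- have [N0 ND] := sN; have [N0' ND'] := sN'; split.
    by exists 0, 0; rewrite addr0.
  move=> c _ _ [y [z [Ny Nz ->]]] [y' [z' [Ny' Nz' ->]]].
  exists (c%:A *: y + y'), (c%:A *: z + z'); split; [exact: ND|exact: ND'|].
  by rewrite scalerDr addrACA.
- move=> x _ [y [z [Ny Nz ->]]]; exists (const_in x *: y), (const_in x *: z).
  by rewrite scalerDr; split=> //; [exact: stN|exact: stN'].
- apply: (@k_bound_gens _ _ ('I_n + 'I_n')%type
    (fun i => match i with inl i => e i | inr i => e' i end)) => _ [y [z [Ny Nz ->]]].
  have [c cE] := eN _ Ny; have [c' cE'] := eN' _ Nz.
  exists (fun i => match i with inl i => c i | inr i => c' i end).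
  by rewrite big_sumType /= -cE -cE'.
by exists u, v.
Qed.

(** The vectors (x (x) a) n, for x in g and n in N, span a finite-dimensional space,
    stable under g because y (x (x) a) n = ([y, x] (x) a) n + (x (x) a) y n. *)
Lemma lfd_current V z (v : V) : lfd const_in v -> lfd const_in (j z *: v).
Proof.
move=> lv; move: z; apply: current_ind => [|s t ls lt|x a].
- by rewrite linear0 scale0r; exact: lfd0.
- by rewrite linearD scalerDl; exact: lfdD.
have [N [sN stN [n [f fN]] Nv]] := lv; have [N0 ND] := sN.
pose T (u : V) := exists x n, N n /\ u = j (cpure x a) *: n.
exists (sum_of T); split.
- split=> [|c u w Tu Tw]; first exact: sum_of0.
  apply: sum_ofD => //; elim: Tu => [|y z [x' [m [Nm ->]]] _ IHz].
    by rewrite scaler0; exact: sum_of0.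
  rewrite scalerDr; apply: sum_of_cons => //; exists x', (c%:A *: m).
  by rewrite alg_scaleC; split=> //; exact: subspaceZ.
- move=> y u; elim=> [|w z [x' [m [Nm ->]]] _ IHz].
    by rewrite scaler0; exact: sum_of0.
  rewrite scalerDr; apply: sum_ofD => //.
  rewrite scalerA -[const_in y * _](subrK (j (cpure x' a) * const_in y)) scalerDl const_inE.
  rewrite -jM lie_cpure mul1r -scalerA -const_inE.
  apply: sum_of_cons; first by exists (lie y x'), m.
  by apply: sum_of1; exists x', (const_in y *: m); split=> //; exact: stN.
- have bV := vbasisP {:g}; set b := vbasis {:g} in bV.
  apply: (@k_bound_gens _ (kmod V) ('I_(\dim {:g}) * 'I_n)%type
    (fun p => j (cpure b`_p.1 a) *: (f p.2 : V))) => u.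
  elim=> [|w z [x' [m [Nm ->]]] _ [c ->]].
    by exists (fun=> 0); rewrite big1 // => i _; rewrite scale0r.
  have [d dE] := fN _ Nm.
  exists (fun p => coord b p.1 x' * d p.2 + c p).
  under [RHS]eq_bigr do rewrite scalerDl.
  rewrite big_split /=; congr (_ + _).
  rewrite {1}(coord_basis bV (memvf x')).
  have -> : cpure (\sum_(i < \dim {:g}) coord b i x' *: b`_i) a =
      \sum_(i < \dim {:g}) coord b i x' *: cpure b`_i a.
    elim/big_rec2: _ => [|i y1 y2 _ <-]; first exact: cpure0l.
    by rewrite cpureDl cpureZl.
  rewrite linear_sum scaler_suml -(pair_bigA _ (fun i k => (coord b i x' * d k) *:
      (j (cpure b`_i a) *: (f k : V) : kmod V))) /=.
  elim/big_rec2: _ => // i y1 y2 _ ->; congr (_ + _).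
  rewrite linearZ /= dE alg_scaleE; elim/big_rec2: _ => [|k z1 z2 _ IH].
    by rewrite !scaler0.
  rewrite !scalerDr IH !kmodE; congr (_ + _).
  by rewrite (alg_scaleC (d k)); exact: alg_scaleM.
by apply: sum_of1; exists x, v.
Qed.

Lemma lfd_scale V u (v : V) : lfd const_in v -> lfd const_in (u *: v).
Proof.
move=> lv; move: u; apply: jgen => [|c u u' lu lu'||x u lu].
- by rewrite scale0r; exact: lfd0.
- rewrite scalerDl; apply: lfdD => //; rewrite alg_scaleE.
  have [N [sN stN bN Nv]] := lu; exists N; split=> //; exact: subspaceZ.
- by rewrite scale1r.
- by rewrite -scalerA; exact: lfd_current.
Qed.

Lemma lfd_linear V V' (f : {linear V -> V'}) v : lfd const_in v -> lfd const_in (f v).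
Proof.
move=> [N [sN stN [n [e eN]] Nv]]; have [N0 ND] := sN.
exists (fun w => exists u, N u /\ f u = w); split.
- split; first by exists 0; rewrite linear0.
  move=> c _ _ [u [Nu <-]] [u' [Nu' <-]]; exists (c%:A *: u + u').
  by rewrite linearP; split=> //; exact: ND.
- move=> x _ [u [Nu <-]]; exists (const_in x *: u).
  by rewrite linearZ; split=> //; exact: stN.
- exists n, (fun i => f (e i)) => _ [u [Nu <-]]; have [c ->] := eN u Nu.
  exists c; rewrite (kmod_sumE c e) linear_sum (kmod_sumE c (fun i => f (e i))).
  by apply: eq_bigr => i _; rewrite linearZ.
by exists v.
Qed.

(** The vectors of N that come from V form a finite-dimensional space, whose
    preimage is isomorphic to it. *)
Lemma lfd_injective V V' (f : {linear V -> V'}) v : injective f ->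
  lfd const_in (f v) -> lfd const_in v.
Proof.
move=> fI [N [sN stN bN Nv]]; have [N0 ND] := sN.
exists (fun u => N (f u)); split=> //.
- split; first by rewrite linear0.
  by move=> c u w Nu Nw; rewrite linearP; exact: ND.
- by move=> x u Nu; rewrite linearZ; exact: stN.
pose S (w : V') := N w /\ exists u, f u = w.
have [|||M [phi [phiI phiP phiS]]] := @k_bound_vect _ (kmod V') S.
- by split=> //; exists 0; rewrite linear0.
- move=> c x y [Nx [u uE]] [Ny [w wE]]; split; first exact: ND.
  by exists (c%:A *: u + w); rewrite linearP uE wE.
- by apply: k_boundS bN => w [].
have psiE m : exists u, f u = phi m.
  by have [_] : S (phi m) by apply/phiS; exists m.
have [psi psiK] := choice psiE.
have psiP : linear (psi : M -> kmod V).
  by move=> a m l; apply: fI; rewrite kmodE linearP /= !psiK phiP.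
apply: k_boundS (k_bound_vectP psiP) => u Nu.
have /phiS[m mE] : S (f u) by split=> //; exists u.
by exists m; apply: fI; rewrite psiK.
Qed.

(** The modules of the category I_A^lam; the bound on the weights is tested on
    weight vectors, which span by local finiteness. *)
Definition lfd_le lam V : Prop :=
  (forall v : V, lfd const_in v) /\
  (forall mu (v : V), ~ wle mu lam -> wspace const_in mu v -> v = 0).

Lemma lfd_le_weights lam V : lfd_le lam V ->
  forall v : V, sum_of (weight_in const_in (fun mu => wle mu lam)) v.
Proof.
move=> [VL V0] v; have := lfd_weights D g_simple const_inM (VL v).
apply: (@sum_of_map _ _ (idfun : {additive V -> V})) => x [mu _ wx] /=.
case: (pselect (wle mu lam)) => [ml|nl]; first by apply: sum_of1; exists mu.
by rewrite (V0 _ _ nl wx); exact: sum_of0.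
Qed.

Lemma lfd_le_of_weights lam V : (forall v : V, lfd const_in v) ->
  (forall v : V, sum_of (weight_in const_in (fun mu => wle mu lam)) v) -> lfd_le lam V.
Proof.
move=> VL Vw; split=> // mu v nl wv; apply: weights_indep wv _.
by apply: weight_in_sub (Vw v) => nu nul e; apply: nl; rewrite -e.
Qed.

Lemma lfd_le_injective lam V V' (f : {linear V -> V'}) : injective f ->
  lfd_le lam V' -> lfd_le lam V.
Proof.
move=> fI [VL V0]; split=> [v|mu v nl wv]; first exact: lfd_injective fI _.
by apply: fI; rewrite linear0; apply: V0 nl _; exact: wspace_linear.
Qed.

(** Such modules are closed under sums and quotients. *)
Lemma lfd_le_images lam V :
  (forall v : V, sum_of (fun x => exists (W : lmodType R) (f : {linear W -> V}) w,
     lfd_le lam W /\ x = f w) v) -> lfd_le lam V.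
Proof.
move=> Vgen; apply: lfd_le_of_weights => v; elim: (Vgen v).
- exact: lfd0.
- move=> _ u [W [f [w [[WL _] ->]]]] _; apply: lfdD.
  exact: lfd_linear.
- exact: sum_of0.
- move=> _ u [W [f [w [WC ->]]]] _; apply: sum_ofD.
  exact/weight_in_linear/lfd_le_weights.
Qed.

Lemma lfd_le_surjective lam V V' (f : {linear V -> V'}) : (forall w, exists v, f v = w) ->
  lfd_le lam V -> lfd_le lam V'.
Proof.
move=> fS VC; apply: lfd_le_images => w; apply: sum_of1.
by have [v <-] := fS w; exists V, f, v.
Qed.

Lemma lfd_le_prod lam V V' : lfd_le lam V -> lfd_le lam V' -> lfd_le lam (V * V')%type.
Proof.
move=> VC VC'; apply: lfd_le_images => -[v v'].
have [|f fE] := @linear_mapP R V (V * V')%type (fun v => (v, 0)).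
  by move=> a u w; rewrite -[RHS]/(a *: u + w, a *: 0 + 0) scaler0 addr0.
have [|f' fE'] := @linear_mapP R V' (V * V')%type (fun v => (0, v)).
  by move=> a u w; rewrite -[RHS]/(a *: 0 + 0, a *: u + w) scaler0 addr0.
rewrite (_ : (v, v') = f v + f' v'); last first.
  by rewrite fE fE' -[RHS]/(v + 0, 0 + v') addr0 add0r.
by apply: sum_of_cons; [exists V, f, v|apply: sum_of1; exists V', f', v'].
Qed.

Lemma lfd_le_lift lam V V' (f : {linear V -> V'}) mu v : lfd_le lam V ->
  wspace (D := D) const_in mu (f v) -> exists2 u, wspace const_in mu u & f u = f v.
Proof. by move=> [VL _]; apply/weight_lift/(lfd_weights D g_simple const_inM). Qed.

(** The submodule T generated by Y meets the weight space at lam in Y: as the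
    positive part n+ (x) A kills Y, T is spanned by Y and by the vectors obtained
    from Y by applying elements of n- (x) A, of weights strictly below lam. *)
Lemma lfd_le_top lam V (Y : V -> Prop) : lfd_le lam V -> is_subspace Y ->
  (forall y, Y y -> wspace const_in lam y) ->
  (forall t a y, Y y -> Y (j (cpure (liesub_val (h := cartan D) t) a) *: y)) ->
  exists T : V -> Prop, [/\ is_submodule (T : set V), forall v, Y v -> T v &
    forall v, T v -> wspace const_in lam v -> Y v].
Proof.
move=> VC sY Yw YH; have [_ V0] := VC.
pose P mu := mu <> lam /\ Qplus (lam - mu).
pose Nn (z : current g A) := exists (b : weight D) x a,
  [/\ b != 0, Qplus (- b), root_space b x & z = cpure x a].
pose Bb (z : current g A) :=
  (exists (b : weight D) x a, [/\ b != 0, Qplus b, root_space b x & z = cpure x a]) \/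
  (exists (t : liesub_of (cartan D)) a, z = cpure (liesub_val t) a).
have wroot b mu x a (v : V) : root_space b x -> wspace const_in mu v ->
    wspace const_in (mu + b) (j (cpure x a) *: v).
  move=> xb wv t; rewrite scalerA -[_ * j _](subrK (j (cpure x a) * const_in (liesub_val t))).
  rewrite [X in X - _]/(_ * _) const_inE -jM lie_cpure mul1r xb cpureZl linearZ /=.
  rewrite scalerDl -scalerA -const_inE wv alg_scaleC alg_scaleE.
  by rewrite -scalerDl -scalerDl [in RHS]add_lfunE [in RHS]addrC.
have lower b mu : b != 0 -> Qplus (- b) -> Qplus (lam - mu) -> P (mu + b).
  move=> b0 qb qm; have qmb : Qplus (lam - (mu + b)) by rewrite opprD addrA; exact: QplusD.
  split=> // e; case/eqP: b0; apply: oppr_inj; rewrite oppr0.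
  apply: Qplus_pointed => //; rewrite opprK (_ : b = lam - mu) // -e.
  by rewrite addrAC subrr add0r.
have [||||T [sT stT YT TE]] := @triangular_span _ _ _ j jM V Nn Bb Y
    (fun v => sum_of (weight_in const_in P) v) _ sY (weight_in_subspace _ _ _).
- apply: current_ind => [|s t ss st|x a]; first exact: sum_of0.
    exact: sum_ofD.
  have cL : linear ((fun x => cpure x a) : g -> current g A).
    by move=> c x' y; rewrite cpureDl cpureZl.
  have [f fE] := linear_mapP cL; rewrite -fE.
  move: (root_trichotomy D x); apply: (@sum_of_map _ _ f) => y [[b [b0 qb yb]]|[[b [b0 qb yb]]|[t ->]]].
  + by apply: sum_of1; left; exists b, y, a; split=> //; exact: fE.
  + by apply: sum_of1; right; left; exists b, y, a; split=> //; exact: fE.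
  + by apply: sum_of1; right; right; exists t, a; exact: fE.
- move=> x y [[b [z [a [b0 qb zb ->]]]]|[t [a ->]]] Yy; last exact: YH.
  rewrite (_ : _ *: y = 0); first by case: sY.
  apply: (V0 (lam + b)); last by apply: wroot => //; exact: Yw.
  rewrite /wle opprD addrA subrr add0r => qnb.
  by case/eqP: b0; exact: Qplus_pointed.
- move=> x y [b [z [a [b0 qb zb ->]]]] /Yw wy; apply: sum_of1; exists (lam + b).
    by apply: lower => //; rewrite subrr; exact: Qplus0.
  exact: wroot.
- move=> x y [b [z [a [b0 qb zb ->]]]]; elim=> [|u v [mu [_ qm] wu] _ IHv].
    by rewrite scaler0; exact: sum_of0.
  rewrite scalerDr; apply: sum_of_cons => //; exists (mu + b); first exact: lower.
  exact: wroot.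
exists T; split=> //; first exact: (lie_submodule jgen).
move=> v /TE[y [x [Yy Xx ->]]] wv.
suff -> : x = 0 by rewrite addr0.
apply: (@weights_indep _ _ _ _ _ _ lam); last by apply: weight_in_sub Xx => mu [].
rewrite (_ : x = y + x - y); first by apply: wspaceB => //; exact: Yw.
by rewrite addrAC subrr add0r.
Qed.

End CurrentModules.

(** * Submodules, quotients and Yoneda extensions *)

Section ModuleConstructions.

(** The action of B is only required to satisfy the module axioms on P: this
    covers submodules as well as weight spaces under a quotient of the Cartan part. *)
Lemma lmod_of_action (B : pzRingType) (V : zmodType) (P : V -> Prop) (act : B -> V -> V) :
  P 0 -> (forall u v, P u -> P v -> P (u - v)) -> (forall b v, P v -> P (act b v)) ->
  (forall a b v, P v -> act (a * b) v = act a (act b v)) ->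
  (forall v, P v -> act 1 v = v) ->
  (forall b u v, P u -> P v -> act b (u + v) = act b u + act b v) ->
  (forall a b v, P v -> act (a + b) v = act a v + act b v) ->
  exists (L : lmodType B) (val : {additive L -> V}),
    [/\ injective val, forall b l, val (b *: l) = act b (val l) &
        forall v, P v <-> exists l, val l = v].
Proof.
move=> P0 PB Pact actM act1 actDr actDl.
have PN v : P v -> P (- v) by move=> Pv; rewrite -[- v]add0r; exact: PB.
have PD u v : P u -> P v -> P (u + v).
  by move=> Pu Pv; rewrite -[v]opprK; apply/PB/PN.
pose T := {v : V | `[< P v >]}.
have Tval (t : T) : P (val t) by apply/asboolP; exact: (svalP t).
pose mk v (Pv : P v) : T := exist _ v (asboolT Pv).
have mkE v Pv : val (@mk v Pv) = v by [].
pose z : T := mk _ P0; pose N (t : T) := mk _ (PN _ (Tval t)).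
pose Ad (s t : T) := mk _ (PD _ _ (Tval s) (Tval t)).
have AdA : associative Ad by move=> a b c; apply: val_inj; rewrite /= addrA.
have AdC : commutative Ad by move=> a b; apply: val_inj; rewrite /= addrC.
have Ad0 : left_id z Ad by move=> a; apply: val_inj; rewrite /= add0r.
have AdN : left_inverse z N Ad by move=> a; apply: val_inj; rewrite /= addNr.
pose Z : zmodType := HB.pack T (GRing.isZmodule.Build T AdA AdC Ad0 AdN).
pose Sc b (t : Z) : Z := mk _ (Pact b _ (Tval t)).
have ScA a b (v : Z) : Sc a (Sc b v) = Sc (a * b) v.
  by apply: val_inj; rewrite /= actM //; exact: Tval.
have Sc1 : left_id 1 Sc by move=> v; apply: val_inj; rewrite /= act1 //; exact: Tval.
have ScDr : right_distributive Sc +%R.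
  by move=> b u v; apply: val_inj; rewrite /= actDr //; exact: Tval.
have ScDl (v : Z) : {morph Sc^~ v : a b / a + b}.
  by move=> a b; apply: val_inj; rewrite /= actDl //; exact: Tval.
pose L : lmodType B := HB.pack Z
  (GRing.Zmodule_isLmodule.Build B Z ScA Sc1 ScDr ScDl).
pose vl (l : L) : V := val (l : T).
have vlB : zmod_morphism vl by move=> s t.
pose vlA : {additive L -> V} := HB.pack vl (GRing.isZmodMorphism.Build L V vl vlB).
exists L, vlA; split=> [s t /val_inj //|//|v].
by split=> [Pv|[l <-]]; [exists (mk v Pv)|exact: Tval].
Qed.

Lemma submodule_lmod (R : pzRingType) (V : lmodType R) (N : V -> Prop) :
  is_submodule (N : set V) ->
  exists (K : lmodType R) (i : {linear K -> V}),
    injective i /\ forall v, N v <-> exists k, i k = v.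
Proof.
move=> [N0 ND].
have NZ a v : N v -> N (a *: v) by move=> Nv; rewrite -[_ *: _]addr0; exact: ND.
have [|||||||K [i [iI iZ iN]]] := @lmod_of_action R V N *:%R => //.
- by move=> u v Nu Nv; rewrite addrC -scaleN1r; exact: ND.
- by move=> a b v _; rewrite scalerA.
- by move=> v _; rewrite scale1r.
- by move=> b u v _ _; rewrite scalerDr.
- by move=> a b v _; rewrite scalerDl.
have [|f fE] := @linear_mapP R K V i.
  by move=> a u v; rewrite raddfD iZ.
exists K, f; split=> [k l|v]; first by rewrite !fE => /iI.
by rewrite iN; split=> -[k <-]; exists k; rewrite fE.
Qed.

Lemma linear_factor (R : pzRingType) (K V Z : lmodType R) (i : {linear K -> V})
  (f : {linear Z -> V}) : injective i -> (forall z, exists k, i k = f z) ->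
  exists h : {linear Z -> K}, forall z, i (h z) = f z.
Proof.
move=> iI fi; have [h0 h0E] := choice fi.
have [|h hE] := @linear_mapP R Z K h0; last by exists h => z; rewrite hE.
by move=> a u v; apply: iI; rewrite linearP /= !h0E linearP.
Qed.

Lemma linear_descend (R : pzRingType) (V Q Z : lmodType R) (p : {linear V -> Q})
  (f : {linear V -> Z}) : (forall y, exists v, p v = y) ->
  (forall v, p v = 0 -> f v = 0) ->
  exists h : {linear Q -> Z}, forall v, h (p v) = f v.
Proof.
move=> pS pf; have [s sE] := choice pS.
have fp u v : p u = p v -> f u = f v.
  move=> puv; apply/eqP; rewrite -subr_eq0 -linearB; apply/eqP/pf.
  by rewrite linearB puv subrr.
have [|h hE] := @linear_mapP R Q Z (f \o s).
  by move=> a u v; rewrite -linearP; apply: fp; rewrite linearP !sE.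
by exists h => v; rewrite hE; apply: fp; rewrite sE.
Qed.

Lemma span_id (R : pzRingType) (V : lmodType R) (N : V -> Prop) :
  is_submodule (N : set V) -> forall v, Defs.span (N : set V) v <-> N v.
Proof. by move=> sN v; rewrite /Defs.span smallest_id. Qed.

Lemma quotient_lmod (R : pzRingType) (V : lmodType R) (N : V -> Prop) :
  is_submodule (N : set V) ->
  exists (Q : lmodType R) (p : {linear V -> Q}),
    (forall y, exists v, p v = y) /\ forall v, N v <-> p v = 0.
Proof.
move=> sN; exists [the lmodType R of modquot (N : set V)].
exists [the {linear _ -> _} of Defs.mpi (N : set V)]; split=> [y|v] /=.
  by have [v ->] := mpi_surj y; exists v.
rewrite -(span_id sN); split=> [Nv|e].
  by rewrite -(raddf0 (Defs.mpi _)); apply/mpi_eq; rewrite subr0.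
by rewrite -[v]subr0; apply/mpi_eq; rewrite raddf0.
Qed.

Section Pairs.
Context (R : pzRingType) (V W Z : lmodType R).

Lemma pair_map (f : {linear Z -> V}) (h : {linear Z -> W}) :
  exists F : {linear Z -> (V * W)%type}, forall z, F z = (f z, h z).
Proof. by apply: linear_mapP => a u v; rewrite !linearP. Qed.

Lemma copair_map (f : {linear V -> Z}) (h : {linear W -> Z}) :
  exists F : {linear (V * W)%type -> Z}, forall p, F p = f p.1 + h p.2.
Proof.
by apply: linear_mapP => a u v; rewrite /= !linearP scalerDr addrACA.
Qed.

Lemma fst_map : exists F : {linear (V * W)%type -> V}, forall p, F p = p.1.
Proof. exact: linear_mapP. Qed.

Lemma snd_map : exists F : {linear (V * W)%type -> W}, forall p, F p = p.2.
Proof. exact: linear_mapP. Qed.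

End Pairs.

End ModuleConstructions.

Section YonedaSplitting.
Context (R : pzRingType) (Cat : lmodType R -> Prop).
Hypothesis Cat_inj : forall (V V' : lmodType R) (f : {linear V -> V'}),
  injective f -> Cat V' -> Cat V.
Hypothesis Cat_surj : forall (V V' : lmodType R) (f : {linear V -> V'}),
  (forall w, exists v, f v = w) -> Cat V -> Cat V'.
Hypothesis Cat_prod : forall V V' : lmodType R, Cat V -> Cat V' -> Cat (V * V')%type.
Context (V U : lmodType R).
Implicit Types E : extension2 V U.

(** The form in which the vanishing of the class of E is used: with K the kernel
    of E_2 -> V, the extension of K by U extends to an extension X of E_2. *)
Definition extends E : Prop :=
  exists (X : lmodType R) (a : {linear ext_E1 E -> X}) (q : {linear X -> ext_E2 E}),
    [/\ Cat X, forall e, q (a e) = ext_d E e, forall y, exists x, q x = y,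
        forall u, a (ext_i E u) = 0 -> u = 0 &
        forall x, q x = 0 -> exists u, a (ext_i E u) = x].

(** Pull X' back along E_2 -> E'_2. *)
Lemma extends_pullback E E' : ext_step Cat E E' -> extends E' -> extends E.
Proof.
move=> [[E1C E2C] _ [f1 [f2 [f1i f2d pf2]]]] [X' [a' [q' [X'C qa qS aI aK]]]].
pose N (y : (X' * ext_E2 E)%type) := q' y.1 = f2 y.2.
have sN : is_submodule (N : set _).
  split; first by rewrite /N /= !linear0.
  by move=> c x y Nx Ny; rewrite /N /= !linearP Nx Ny.
have [X [i [iI iN]]] := submodule_lmod sN.
have [fs fsE] := fst_map X' (ext_E2 E); have [sn snE] := snd_map X' (ext_E2 E).
have [b bE] := pair_map [the {linear _ -> _} of a' \o f1] (ext_d E).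
have [|a aE] := @linear_factor _ _ _ _ i b iI.
  by move=> e; apply/iN; rewrite /N bE /= qa f2d.
exists X, a, [the {linear _ -> _} of sn \o i]; split.
- exact: Cat_inj iI (Cat_prod X'C E2C).
- by move=> e /=; rewrite snE aE bE.
- move=> y; have [x' x'E] := qS (f2 y).
  have [x xE] : exists x, i x = (x', y) by apply/iN.
  by exists x; rewrite /= snE xE.
- move=> u au0; apply: aI; have := aE (ext_i E u).
  by rewrite au0 linear0 bE => -[/esym e0 _]; rewrite -f1i.
- move=> x /=; rewrite snE => x2.
  have /iN Nx : exists k, i k = i x by exists x.
  have [|u uE] := aK (i x).1; first by rewrite Nx x2 linear0.
  exists u; apply: iI; rewrite aE bE /= f1i uE.
  have -> : ext_d E (ext_i E u) = 0 by apply/ext_exact1; exists u.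
  by rewrite -x2; case: (i x).
Qed.

(** Push X out along E_1 -> E'_1. *)
Lemma extends_pushout E E' : ext_step Cat E E' -> extends E -> extends E'.
Proof.
move=> [_ [E1C' E2C'] [f1 [f2 [f1i f2d pf2]]]] [X [a [q [XC qa qS aI aK]]]].
have di0 e : ext_d E (ext_i E e) = 0 by apply/ext_exact1; exists e.
have di0' e : ext_d E' (ext_i E' e) = 0 by apply/ext_exact1; exists e.
pose N (y : (ext_E1 E' * X)%type) := exists e, y = (f1 e, - a e).
have sN : is_submodule (N : set _).
  split; first by exists 0; rewrite !linear0.
  move=> c _ _ [e ->] [e' ->]; exists (c *: e + e').
  rewrite (linearP f1) (linearP a) opprD -scalerN; exact: erefl.
have [X' [p [pS pN]]] := quotient_lmod sN.
have [h hE] := copair_map (ext_d E') [the {linear _ -> _} of f2 \o q].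
have [|q' q'E] := @linear_descend _ _ _ _ p h pS.
  move=> v /pN[e ->]; rewrite hE /= linearN /= linearN /= qa f2d.
  exact: subrr.
have [b bE] := pair_map (idfun : {linear ext_E1 E' -> ext_E1 E'})
  (\0%R : {linear ext_E1 E' -> X}).
have [c cE] := pair_map (\0%R : {linear X -> ext_E1 E'}) (idfun : {linear X -> X}).
exists X', [the {linear _ -> _} of p \o b], q'; split.
- exact: Cat_surj pS (Cat_prod E1C' XC).
- by move=> e /=; rewrite q'E hE bE /= !linear0 addr0.
- move=> y; have [e2 e2E] := @ext_p_surj _ _ _ E (ext_p E' y).
  have [e1 e1E] : exists e1, ext_d E' e1 = y - f2 e2.
    by apply/ext_exact2; rewrite linearB pf2 e2E subrr.
  have [x xE] := qS e2; exists (p (e1, x)).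
  by rewrite q'E hE /= e1E xE subrK.
- move=> u /= /pN[e]; rewrite bE /= => -[ue /esym/eqP].
  rewrite oppr_eq0 => /eqP ae0.
  have /ext_exact1[u' u'E] : ext_d E e = 0 by rewrite -qa ae0 linear0.
  have u'0 : u' = 0 by apply: aI; rewrite u'E.
  by apply: (@ext_i_inj _ _ _ E'); rewrite ue -u'E u'0 !linear0.
move=> x'; have [[e1 x] <-] := pS x'; rewrite q'E hE /= => e0.
have /ext_exact2[e eE] : ext_p E (q x) = 0.
  rewrite -pf2 (_ : f2 (q x) = - ext_d E' e1); last first.
    by apply/eqP; rewrite -addr_eq0 addrC; apply/eqP.
  rewrite linearN; apply/eqP; rewrite oppr_eq0; apply/eqP/ext_exact2.
  by exists e1.
have [u uE] : exists u, a (ext_i E u) = x - a e.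
  by apply: aK; rewrite linearB /= qa eE subrr.
have /ext_exact1[u' u'E] : ext_d E' (e1 + f1 e) = 0.
  by rewrite linearD /= -f2d eE.
exists (u' + u); rewrite /= -[LHS]subr0; apply/eqP; rewrite subr0 -subr_eq0 -linearB.
apply/eqP/pN; exists (e + ext_i E u); rewrite bE /=.
rewrite -[LHS]/(_ - e1, 0 - x) sub0r linearD /= u'E linearD /= f1i addrC; congr (_, _).
  by rewrite !addrA addNr add0r.
by rewrite linearD /= uE addrC subrK.
Qed.

(** For the trivial extension X is U + V; the property then spreads along the
    zigzag of morphisms. *)
Lemma extends_trivial E : Cat U -> Cat V -> yoneda_equiv Cat E (trivial_ext V U) ->
  extends E.
Proof.
move=> UC VC.
have et : extends (trivial_ext V U).
  have [b bE] := pair_map (idfun : {linear U -> U}) (\0%R : {linear U -> V}).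
  have [sn snE] := snd_map U V.
  exists (U * V)%type, b, sn; split.
  - exact: Cat_prod.
  - by move=> e; rewrite snE bE.
  - by move=> y; exists (0, y); rewrite snE.
  - by move=> u; rewrite bE => -[].
  - by move=> [u v]; rewrite snE /= => ->; exists u; rewrite bE.
suff iff E1 E2 : yoneda_equiv Cat E1 E2 -> (extends E1 <-> extends E2).
  by move=> /iff[_]; apply.
elim=> [{E2} {}E1 {}E2 st|//|{E2} {}E1 {}E2 _ [? ?]//|E3 E4 E5 _ [? ?] _ [? ?]].
- by split; [exact: extends_pushout|exact: extends_pullback].
- by split; auto.
Qed.

End YonedaSplitting.

(** * The Weyl functor and its adjoint *)

(** Here R is U(g (x) A) and kappa the inclusion of H = U(h (x) A), while W, w
    and q : H -> B are the global Weyl module, its generator and the projection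
    onto A_lam. They enter only through the universal property of (W, w) and the
    fact that the kernel of q is the annihilator of w. *)
Section WeylFunctor.
Context (C : numClosedFieldType) (g : finLieAlgType C) (D : cartanDatum g).
Context (A : comAlgType C) (R : algType C) (j : {linear current g A -> R}).
Hypothesis g_simple : is_simple_lie g.
Hypothesis jM : forall x y, j (lie x y) = j x * j y - j y * j x.
Hypothesis jgen : forall P : R -> Prop, P 0 ->
  (forall c u v, P u -> P v -> P (c *: u + v)) -> P 1 ->
  (forall x u, P u -> P (j x * u)) -> forall u, P u.
Context (lam : weight D).
Context (H B : pzRingType) (kappa : {rmorphism H -> R}) (q : {rmorphism H -> B}).
Hypothesis HC : forall y y' : H, y * y' = y' * y.
Hypothesis kappa_scalar : forall c : C, exists y, kappa y = c%:A.
Hypothesis kappa_cartan : forall t a,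
  exists y, kappa y = j (cpure (liesub_val (h := cartan D) t) a).
Hypothesis q_surj : forall b, exists y, q y = b.
Context (W : lmodType R) (w : W).
Hypothesis W_lfd_le : lfd_le j lam W.
Hypothesis w_top : wspace (const_in j) lam w.
Hypothesis W_gen : forall x, exists u, x = u *: w.
Hypothesis W_univ : forall (V : lmodType R) (v : V), lfd_le j lam V ->
  wspace (const_in j) lam v -> exists f : {linear W -> V}, f w = v.
Hypothesis q_ker : forall y, q y = 0 <-> kappa y *: w = 0.


Definition ract (w1 : W) (b : B) (w2 : W) : Prop :=
  exists u y, [/\ w1 = u *: w, b = q y & w2 = (u * kappa y) *: w].

(* the tensor product with W over B, through its universal property *)
Context (F : lmodType B -> lmodType R) (pure : forall M : lmodType B, W -> M -> F M).
Local Notation "x '(x)' m" := (pure x m) (at level 40).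
Hypothesis pureDl : forall (M : lmodType B) x x' (m : M), (x + x') (x) m = x (x) m + x' (x) m.
Hypothesis pureDr : forall (M : lmodType B) x (m m' : M), x (x) (m + m') = x (x) m + x (x) m'.
Hypothesis pureZ : forall (M : lmodType B) r x (m : M), (r *: x) (x) m = r *: (x (x) m).
Hypothesis pureB : forall (M : lmodType B) x b x' (m : M),
  ract x b x' -> x' (x) m = x (x) (b *: m).
Hypothesis pure_ind : forall (M : lmodType B) (P : F M -> Prop), P 0 ->
  (forall s t, P s -> P t -> P (s + t)) -> (forall x m, P (x (x) m)) -> forall t, P t.
Hypothesis pure_lift : forall (M : lmodType B) (V : lmodType R) (f : W -> M -> V),
  balanced ract f -> exists h : {linear F M -> V}, forall x m, h (x (x) m) = f x m.
Context (Fmap : forall M M' : lmodType B, {linear M -> M'} -> {linear F M -> F M'}).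
Hypothesis Fmap_pure : forall (M M' : lmodType B) (f : {linear M -> M'}) x m,
  Fmap f (x (x) m) = x (x) f m.

Local Notation cat := (lfd_le j lam).
Local Notation top := (wspace (const_in j) lam).

Lemma kappaC y y' : kappa y * kappa y' = kappa y' * kappa y.
Proof. by rewrite -!rmorphM HC. Qed.

Lemma top_kappa (V : lmodType R) y (v : V) : top v -> top (kappa y *: v).
Proof.
move=> tv t; have [y' y'E] := kappa_cartan t 1.
by rewrite const_inE -y'E scalerA kappaC -scalerA y'E -const_inE tv alg_scaleC.
Qed.

(** Every vector of weight lam is an image of w, so the annihilator of w kills it. *)
Lemma kappa_eq (V : lmodType R) y y' (v : V) : cat V -> top v ->
  q y = q y' -> kappa y *: v = kappa y' *: v.
Proof.
move=> VC tv /eqP; rewrite -subr_eq0 -rmorphB => /eqP/q_ker.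
have [f <-] := W_univ VC tv; rewrite -!linearZ rmorphB scalerBl => /eqP.
by rewrite subr_eq0 => /eqP ->.
Qed.

Section OnModule.
Context (M : lmodType B).
Implicit Types (m : M) (t : F M).

Lemma pure0 x : x (x) (0 : M) = 0.
Proof. by apply: (addrI (x (x) 0)); rewrite -pureDr !addr0. Qed.

Lemma pureN x m : x (x) (- m) = - (x (x) m).
Proof. by apply/eqP; rewrite -addr_eq0 -pureDr addNr pure0. Qed.

Lemma weyl_ext (V : lmodType R) (f h : {linear F M -> V}) :
  (forall m, f (w (x) m) = h (w (x) m)) -> f =1 h.
Proof.
move=> fh; apply: pure_ind => [|s t fs ft|x m]; first by rewrite !linear0.
  by rewrite !linearD fs ft.
by have [u ->] := W_gen x; rewrite pureZ !linearZ fh.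
Qed.

(** F M is a sum of images of W. *)
Lemma weyl_lfd_le : cat (F M).
Proof.
apply: (lfd_le_images g_simple jM); apply: pure_ind => [|s t|x m].
- exact: sum_of0.
- exact: sum_ofD.
have [|f fE] := @linear_mapP R W (F M) (fun x => x (x) m).
  by move=> a y z; rewrite pureDl pureZ.
by apply: sum_of1; exists W, f, x; rewrite fE.
Qed.

Lemma top_pure m : top (w (x) m).
Proof. by move=> t; rewrite -!pureZ w_top. Qed.

Lemma pure_kappa y m : kappa y *: (w (x) m) = w (x) (q y *: m).
Proof.
rewrite -pureZ; apply: pureB; exists 1, y.
by rewrite scale1r mul1r.
Qed.

(** The Weyl functor is left adjoint to the weight space at lam: each phi m is the
    image of w under a map W -> V, and these maps are balanced in m. *)
Lemma weyl_lift (V : lmodType R) (phi : M -> V) : cat V ->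
  (forall m, top (phi m)) -> (forall m m', phi (m + m') = phi m + phi m') ->
  (forall y m, phi (q y *: m) = kappa y *: phi m) ->
  exists f : {linear F M -> V}, forall m, f (w (x) m) = phi m.
Proof.
move=> VC tphi phiD phiq.
have [f fE] := choice (fun m => W_univ VC (tphi m)).
have [|h hE] := @pure_lift M V (fun x m => f m x); last by exists h => m; rewrite hE.
split=> [x x' m|x m m'|r x m|x b x' m [u [y [-> -> ->]]]].
- by rewrite linearD.
- by have [u ->] := W_gen x; rewrite !linearZ /= !fE phiD scalerDr.
- by rewrite linearZ.
- by rewrite !linearZ /= !fE phiq scalerA.
Qed.

(** The vectors w (x) m are stable under h (x) A and generate F M. *)
Lemma top_weyl t : top t -> exists m, t = w (x) m.
Proof.
pose Y (t : F M) := exists m, t = w (x) m.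
have [|||T [sT YT TY]] := lfd_le_top jM jgen weyl_lfd_le (Y := Y).
- split; first by exists 0; rewrite pure0.
  move=> c _ _ [m ->] [m' ->]; have [y <-] := kappa_scalar c.
  by exists (q y *: m + m'); rewrite pureDr pure_kappa.
- by move=> _ [m ->]; exact: top_pure.
- move=> u a _ [m ->]; have [y <-] := kappa_cartan u a.
  by exists (q y *: m); rewrite pure_kappa.
suff Tt : T t by exact: TY.
have [T0 TD] := sT; move: t; apply: pure_ind => [|s t Ts Tt|x m] //.
  by rewrite -[s]scale1r; exact: TD.
have [u ->] := W_gen x; rewrite pureZ -[_ *: _]addr0; apply: TD => //.
by apply: YT; exists m.
Qed.

End OnModule.

(** W_lam = H w is B, and p is the projection of W onto it along the other weight
    spaces; it commutes with the right action of H since the latter is given by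
    endomorphisms of W. *)
Lemma top_projection : exists p : W -> B,
  [/\ p w = 1, forall x y, p (x + y) = p x + p y &
      forall u y, p ((u * kappa y) *: w) = p (u *: w) * q y].
Proof.
pose Q x b := exists y x', [/\ x = kappa y *: w + x',
  sum_of (weight_in (const_in j) (fun mu => mu <> lam)) x' & b = q y].
have QE x b b' : Q x b -> Q x b' -> b = b'.
  move=> [y [z [-> wz ->]]] [y' [z' [e wz' ->]]].
  apply/eqP; rewrite -subr_eq0 -rmorphB; apply/eqP/q_ker.
  have e' : kappa (y - y') *: w = z' - z.
    rewrite rmorphB scalerBl; apply/eqP; rewrite subr_eq [_ + kappa y' *: w]addrC addrA -e.
    by rewrite addrK.
  apply: (@weights_indep _ _ _ _ (const_in j) _ lam); first exact: top_kappa.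
  rewrite e'; apply: sum_ofD => //; rewrite -scaleN1r -scaleN1r.
  apply: (subspaceZ (-1)) wz; exact: weight_in_subspace.
have Qex x : exists b, Q x b.
  have xw : sum_of (weight_in (const_in j) (fun _ : weight D => True)) x.
    by have := lfd_le_weights g_simple jM W_lfd_le x; apply: weight_in_sub.
  have [a [b [-> ta wb]]] := weight_split lam xw.
  pose Y v := exists y, v = kappa y *: w.
  have [|||T [sT YT TY]] := lfd_le_top jM jgen W_lfd_le (Y := Y).
  - split; first by exists 0; rewrite rmorph0 scale0r.
    move=> c _ _ [y ->] [y' ->]; have [z <-] := kappa_scalar c.
    by exists (z * y + y'); rewrite rmorphD rmorphM scalerDl scalerA.
  - by move=> _ [y ->]; exact: top_kappa.
  - move=> t c _ [y ->]; have [z <-] := kappa_cartan t c.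
    by exists (z * y); rewrite rmorphM scalerA.
  have [y ->] : Y a.
    apply: TY => //; have [u ->] := W_gen a; have [T0 TD] := sT.
    rewrite -[_ *: _]addr0; apply: TD => //; apply: YT.
    by exists 1; rewrite rmorph1 scale1r.
  by exists (q y), y, b.
have [p pQ] := choice Qex; exists p; split.
- apply: QE (pQ w) _; exists 1, 0; rewrite rmorph1 scale1r addr0 rmorph1.
  by split=> //; exact: sum_of0.
- move=> x x'; apply: QE (pQ _) _; have [y [z [xE wz ->]]] := pQ x.
  have [y' [z' [xE' wz' ->]]] := pQ x'.
  exists (y + y'), (z + z'); rewrite rmorphD scalerDl rmorphD xE xE' addrACA.
  by split=> //; exact: sum_ofD.
move=> u y; apply: QE (pQ _) _; have [z [x' [xE wx' ->]]] := pQ (u *: w).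
have [f fE] := W_univ W_lfd_le (top_kappa y w_top).
exists (z * y), (f x'); split; last by rewrite rmorphM.
- rewrite -scalerA -fE -linearZ /= xE linearD /= linearZ /= fE scalerA.
  by rewrite -rmorphM.
- exact: weight_in_linear.
Qed.

(** The additive maps R -> M form an R-module through right translations. Sending
    x (x) m to u |-> p(u x) m is balanced, and evaluation at u = 1 recovers m from
    the image of w (x) m. *)
Lemma pure_inj (M : lmodType B) (m : M) : w (x) m = 0 -> m = 0.
Proof.
have [p [p1 pD pk]] := top_projection.
have [|||||||N [val [valI valZ valP]]] := @lmod_of_action R (R -> M)
  (fun s => forall u u', s (u + u') = s u + s u') (fun r s u => s (u * r)).
- by move=> u u'; rewrite -[RHS]/(0 + 0) addr0.
- move=> s t sD tD u u'; rewrite -[LHS]/(s (u + u') - t (u + u')) sD tD.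
  by rewrite opprD addrACA.
- by move=> r s sD u u'; rewrite mulrDl sD.
- by move=> a b s sD; apply: funext => u; rewrite mulrA.
- by move=> s sD; apply: funext => u; rewrite mulr1.
- by move=> r s t sD tD.
- by move=> a b s sD; apply: funext => u; rewrite mulrDr sD.
have Phi0 (xm : W * M) : exists n, val n = (fun u => p (u *: xm.1) *: xm.2).
  by apply/valP => u u'; rewrite scalerDl pD scalerDl.
have [Phi PhiE] := choice Phi0.
have [|h hE] := @pure_lift M N (fun x m => Phi (x, m)).
  split=> [x x' n|x n n'|r x n|x b x' n [u0 [y [-> -> ->]]]]; apply: valI.
  - rewrite raddfD !PhiE; apply: funext => u /=.
    by rewrite scalerDr pD scalerDl.
  - by rewrite raddfD !PhiE; apply: funext => u /=; rewrite scalerDr.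
  - by rewrite valZ !PhiE; apply: funext => u /=; rewrite scalerA.
  - rewrite !PhiE; apply: funext => u /=.
    by rewrite !scalerA mulrA pk.
move=> wm0; have := hE w m; rewrite wm0 linear0 => /esym/(congr1 val).
rewrite PhiE raddf0 => /(congr1 (fun s => s 1)) /=.
by rewrite scale1r p1 scale1r.
Qed.

(** The values f (w (x) m), of weight lam, have unique preimages of weight lam in
    X; by uniqueness these satisfy the conditions of the adjunction. *)
Lemma weyl_lifting (M : lmodType B) (X Z : lmodType R) (p : {linear X -> Z})
  (f : {linear F M -> Z}) : cat X -> (forall x, top x -> p x = 0 -> x = 0) ->
  (forall t, exists x, p x = f t) ->
  exists s : {linear F M -> X}, forall t, p (s t) = f t.
Proof.
move=> XC p0 fp.
have pI x x' : top x -> top x' -> p x = p x' -> x = x'.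
  move=> tx tx' e; apply/eqP; rewrite -subr_eq0; apply/eqP/p0; first exact: wspaceB.
  by rewrite linearB e subrr.
have liftE m : exists x, top x /\ p x = f (w (x) m).
  have [x0 x0E] := fp (w (x) m).
  have [|x tx xE] := @lfd_le_lift _ _ D _ _ j g_simple jM lam _ _ p lam x0 XC.
    by rewrite x0E; apply/wspace_linear/top_pure.
  by exists x; rewrite xE.
have [phi phiE] := choice liftE.
have [|||s sE] := @weyl_lift M X phi XC.
- by move=> m; have [] := phiE m.
- move=> m m'; have [t1 e1] := phiE m; have [t2 e2] := phiE m'.
  have [t3 e3] := phiE (m + m').
  by apply: pI => //; [exact: wspaceD|rewrite linearD /= e1 e2 e3 pureDr linearD].
- move=> y m; have [t1 e1] := phiE m; have [t2 e2] := phiE (q y *: m).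
  apply: pI => //; first exact: top_kappa.
  by rewrite linearZ /= e1 e2 -pure_kappa linearZ.
exists s; apply: (@weyl_ext M Z [the {linear _ -> _} of p \o s] f) => m /=.
by rewrite sE; have [] := phiE m.
Qed.

(** The quotient of F M2 by the image of F M1 receives a map from F M3, through
    any preimages in M2. *)
Lemma weyl_right_exact (M1 M2 M3 : lmodType B) (f : {linear M1 -> M2})
  (h : {linear M2 -> M3}) : short_exact f h ->
  (forall y, Fmap h y = 0 <-> exists x, Fmap f x = y) /\
  (forall z, exists y, Fmap h y = z).
Proof.
move=> [_ fh hS]; have hf0 x : Fmap h (Fmap f x) = 0.
  move: x; apply: pure_ind => [|s t e e'|x m]; first by rewrite !linear0.
    by rewrite !linearD /= e e' addr0.
  by rewrite !Fmap_pure (_ : h (f m) = 0) ?pure0 //; apply/fh; exists m.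
split; last first.
  apply: pure_ind => [|_ _ [s <-] [t <-]|x m]; first by exists 0; rewrite linear0.
    by exists (s + t); rewrite linearD.
  by have [m' <-] := hS m; exists (x (x) m'); rewrite Fmap_pure.
move=> y; split=> [y0|[x <-]]; last exact: hf0.
pose N y := exists x, Fmap f x = y.
have sN : is_submodule (N : set (F M2)).
  split; first by exists 0; rewrite linear0.
  by move=> a _ _ [u <-] [v <-]; exists (a *: u + v); rewrite linearP.
have [Q [p [_ pN]]] := quotient_lmod sN.
have pE x m m' : h m = h m' -> p (x (x) m) = p (x (x) m').
  move=> e; apply/eqP; rewrite -subr_eq0 -linearB -pureN -pureDr; apply/eqP/pN.
  have [|m1 m1E] := (fh (m - m')).1; first by rewrite linearB e subrr.
  by exists (x (x) m1); rewrite Fmap_pure m1E.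
have [s sE] := choice hS.
have [|k kE] := @pure_lift M3 Q (fun x m => p (x (x) s m)).
  split=> [x x' m|x m m'|r x m|x b x' m xb].
  - by rewrite pureDl linearD.
  - by rewrite -linearD -pureDr; apply: pE; rewrite linearD !sE.
  - by rewrite pureZ linearZ.
  - by rewrite (pureB _ xb); apply: pE; rewrite linearZ !sE.
apply/pN; have <- : k (Fmap h y) = p y; last by rewrite y0 linear0.
apply: (@weyl_ext M2 Q [the {linear _ -> _} of k \o Fmap h] p) => m /=.
by rewrite Fmap_pure kE; apply: pE; rewrite sE.
Qed.

(** X splits over F M2, so that the copy of F M1 inside X, which is generated in
    weight lam, lies in the image of the section and misses U. *)
Lemma no_top_split (U X : lmodType R) (M1 M2 : lmodType B) (b : {linear U -> X})
  (f : {linear M1 -> M2}) (a : {linear F M1 -> X}) (p : {linear X -> F M2}) :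
  cat X -> (forall u : U, top u -> u = 0) -> (forall e, p (a e) = Fmap f e) ->
  (forall y, exists x, p x = y) -> (forall u, b u = 0 -> u = 0) ->
  (forall x, p x = 0 -> exists u, b u = x) ->
  forall u e, a e = b u -> Fmap f e = 0 -> u = 0.
Proof.
move=> XC U0 pa pS b0 bK.
have pI x : top x -> p x = 0 -> x = 0.
  move=> tx /bK[u uE]; rewrite -uE (U0 u) ?linear0 // => t.
  apply/eqP; rewrite -subr_eq0; apply/eqP/b0.
  by rewrite linearB /= [X in X - _]linearZ [X in _ - X]linearZ /= uE tx subrr.
have [|s sE] := @weyl_lifting M2 X (F M2) p idfun XC pI; first by move=> t; exact: pS.
have as0 x : a x = s (Fmap f x).
  apply: (@weyl_ext M1 X a [the {linear _ -> _} of s \o Fmap f]) => m /=.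
  apply/eqP; rewrite -subr_eq0; apply/eqP/pI; last by rewrite linearB /= pa sE subrr.
  by apply: wspaceB; [|rewrite Fmap_pure]; apply/wspace_linear/top_pure.
by move=> u e ae fe; apply: b0; rewrite -ae as0 fe linear0.
Qed.

(** The kernel U of F M1 -> F M2 has no vector of weight lam, and the extension
    U -> F M1 -> F M2 -> F M3 is trivial, so no_top_split applies to it. *)
Lemma exact_of_Ext2_eq0 :
  (forall U : lmodType R, cat U -> (forall u : U, top u -> u = 0) ->
    forall M : lmodType B, Ext2_eq0 cat (F M) U) ->
  exact_functor Fmap.
Proof.
move=> ext M1 M2 M3 f h fh; have [fI _ _] := fh.
have [ex2 hS] := weyl_right_exact fh; split=> //.
pose N x := Fmap f x = 0.
have sN : is_submodule (N : set (F M1)).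
  split; first exact: linear0.
  by move=> a u v Nu Nv; rewrite /N linearP Nu Nv scaler0 addr0.
have [U [i [iI iN]]] := submodule_lmod sN.
have UC : cat U by apply: lfd_le_injective iI _; exact: weyl_lfd_le.
have U0 (u : U) : top u -> u = 0.
  move=> tu; apply: iI; rewrite linear0.
  have [m mE] := top_weyl (wspace_linear i tu).
  rewrite mE (_ : m = 0) ?pure0 //; apply: fI; rewrite linear0.
  apply: pure_inj; rewrite -Fmap_pure -mE.
  by apply/iN; exists u.
pose E := Extension2 iI iN ex2 hS.
have EC : ext_in cat E by split; exact: weyl_lfd_le.
have := extends_trivial (@lfd_le_injective _ _ D _ _ j lam)
  (@lfd_le_surjective _ _ D _ _ j g_simple jM lam) (@lfd_le_prod _ _ D _ _ j g_simple jM lam)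
  UC (weyl_lfd_le M3) (ext U UC U0 M3 E EC).
move=> [X [a [p [XC pa pS aI aK]]]].
have ker0 (u : U) : Fmap f (i u) = 0 -> u = 0.
  exact: (@no_top_split U X M1 M2 [the {linear U -> X} of (a : F M1 -> X) \o i] f a p
    XC U0 pa pS aI aK u (i u)).
move=> x y xy; apply/eqP; rewrite -subr_eq0; apply/eqP.
have Nxy : N (x - y) by rewrite /N linearB xy subrr.
have [u uE] := (iN _).1 Nxy.
by rewrite -uE (ker0 u) ?linear0 // uE.
Qed.

(** The weight space at lam is a B-module, B acting through preimages in H. *)
Lemma top_module (V : lmodType R) : cat V ->
  exists (L : lmodType B) (val : {additive L -> V}),
    [/\ injective val, forall y l, val (q y *: l) = kappa y *: val l &
        forall v, top v <-> exists l, val l = v].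
Proof.
move=> VC; have [s sE] := choice q_surj.
have sEq y y' (v : V) : top v -> q y = q y' -> kappa y *: v = kappa y' *: v.
  exact: kappa_eq.
have [|||||||L [val [valI valZ valP]]] :=
    @lmod_of_action B V top (fun b v => kappa (s b) *: v).
- exact: wspace0.
- by move=> u v; exact: wspaceB.
- by move=> b v; exact: top_kappa.
- by move=> a b v tv; rewrite scalerA -rmorphM; apply: sEq; rewrite // rmorphM !sE.
- move=> v tv; rewrite -[RHS]scale1r -(rmorph1 kappa).
  by apply: sEq; rewrite // rmorph1 sE.
- by move=> b u v _ _; rewrite scalerDr.
- by move=> a b v tv; rewrite -scalerDl -rmorphD; apply: sEq; rewrite // rmorphD !sE.
exists L, val; split=> // y l; rewrite valZ; apply: sEq; last by rewrite sE.
by apply/valP; exists l.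
Qed.

Lemma q_linear (L L' : lmodType B) (f : L -> L') :
  (forall u v, f (u + v) = f u + f v) -> (forall y v, f (q y *: v) = q y *: f v) ->
  exists h : {linear L -> L'}, forall v, h v = f v.
Proof.
move=> fD fq; apply: linear_mapP => b u v; have [y <-] := q_surj b.
by rewrite fD fq.
Qed.

(** Since U has no vector of weight lam, the weight spaces of E at lam form a short
    exact sequence L1 -> L2 -> M. Applying F gives an extension
    U -> U + F L1 -> F L2 -> F M which maps to E by the counits and to the
    trivial extension by the projection onto U. *)
Lemma Ext2_eq0_of_exact : exact_functor Fmap ->
  forall U : lmodType R, cat U -> (forall u : U, top u -> u = 0) ->
    forall M : lmodType B, Ext2_eq0 cat (F M) U.
Proof.
move=> Fex U UC U0 M E [E1C E2C].
set i := ext_i E; set d := ext_d E; set p := ext_p E.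
have iI : injective i by exact: ext_i_inj.
have ex1 y : d y = 0 <-> exists x, i x = y by exact: ext_exact1.
have ex2 y : p y = 0 <-> exists x, d x = y by exact: ext_exact2.
have pS z : exists y, p y = z by exact: ext_p_surj.
have di u : d (i u) = 0 by apply/ex1; exists u.
have pd x : p (d x) = 0 by apply/ex2; exists x.
have [L1 [v1 [v1I v1q v1P]]] := top_module E1C.
have [L2 [v2 [v2I v2q v2P]]] := top_module E2C.
have v1T l : top (v1 l) by apply/v1P; exists l.
have v2T l : top (v2 l) by apply/v2P; exists l.
have winj (m m' : M) : w (x) m = w (x) m' -> m = m'.
  move=> e; apply/eqP; rewrite -subr_eq0; apply/eqP/pure_inj.
  by rewrite pureDr pureN e subrr.
have [c1 c1E] := weyl_lift E1C v1T (fun m m' => raddfD v1 m m') v1q.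
have [c2 c2E] := weyl_lift E2C v2T (fun m m' => raddfD v2 m m') v2q.
have [dL dLE] : exists dL : {linear L1 -> L2}, forall l, v2 (dL l) = d (v1 l).
  have [f fE] := choice (fun l => (v2P _).1 (wspace_linear d (v1T l))).
  have [||h hE] := @q_linear L1 L2 f; last by exists h => l; rewrite hE.
  - by move=> u v; apply: v2I; rewrite raddfD !fE raddfD linearD.
  - by move=> y v; apply: v2I; rewrite v2q !fE v1q linearZ.
have [pL pLE] : exists pL : {linear L2 -> M}, forall l, w (x) pL l = p (v2 l).
  have tp l : exists m, w (x) m = p (v2 l).
    by have [m ->] := top_weyl (wspace_linear p (v2T l)); exists m.
  have [f fE] := choice tp.
  have [||h hE] := @q_linear L2 M f; last by exists h => l; rewrite hE.
  - by move=> u v; apply: winj; rewrite pureDr !fE raddfD linearD.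
  - by move=> y v; apply: winj; rewrite -pure_kappa !fE v2q linearZ.
have topi u : top (i u) -> u = 0.
  move=> tu; apply: U0 => t; apply: iI.
  by rewrite [LHS]linearZ /= tu linearZ.
have [FI Fm FS] : short_exact (Fmap dL) (Fmap pL).
  apply: Fex; split.
  - move=> l l' e; apply/eqP; rewrite -subr_eq0; apply/eqP/v1I.
    have /ex1[u uE] : d (v1 (l - l')) = 0.
      by rewrite -dLE linearB e subrr raddf0.
    by rewrite raddf0 -uE (topi u) ?linear0 // uE.
  - move=> l; split=> [l0|[l1 <-]]; last first.
      by apply: winj; rewrite pLE dLE pd pure0.
    have /ex2[x xE] : p (v2 l) = 0 by rewrite -pLE l0 pure0.
    have [|x' tx' x'E] := @lfd_le_lift _ _ D _ _ j g_simple jM lam _ _ d lam x E1C.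
      by rewrite xE.
    have [l1 l1E] := (v1P x').1 tx'; exists l1; apply: v2I.
    by rewrite dLE l1E x'E.
  - move=> m; have [y yE] := pS (w (x) m).
    have [|y' ty' y'E] := @lfd_le_lift _ _ D _ _ j g_simple jM lam _ _ p lam y E2C.
      by rewrite yE; exact: top_pure.
    have [l lE] := (v2P y').1 ty'; exists l; apply: winj.
    by rewrite pLE lE y'E yE.
have [i' i'E] := pair_map (idfun : {linear U -> U}) (\0%R : {linear U -> F L1}).
have [sn snE] := snd_map U (F L1); have [fs fsE] := fst_map U (F L1).
pose d' := [the {linear _ -> _} of Fmap dL \o sn].
have i'I : injective i' by move=> u v; rewrite !i'E => -[].
have ex1' y : d' y = 0 <-> exists x, i' x = y.
  have d'E : d' y = Fmap dL y.2 by rewrite /d' /= snE.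
  rewrite d'E; split=> [t0|[x <-]]; last by rewrite i'E linear0.
  exists y.1; rewrite i'E /=; case: y t0 {d'E} => u t /= t0; congr (_, _).
  by apply: FI; rewrite t0 linear0.
have ex2' y : Fmap pL y = 0 <-> exists x, d' x = y.
  rewrite Fm; split=> [[t <-]|[x <-]]; last by exists (sn x).
  by exists (0, t); rewrite /d' /= snE.
pose E' : extension2 (F M) U := Extension2 i'I ex1' ex2' FS.
have E'C : ext_in cat E'.
  by split; [apply: (lfd_le_prod g_simple jM) => //|]; exact: weyl_lfd_le.
have [c cE] := copair_map i c1.
have toE : ext_morph E' E.
  exists c, c2; split=> [x|x|x] /=.
  - by rewrite cE i'E /= linear0 addr0.
  - rewrite /d' /= snE cE linearD /= di add0r.
    apply: (@weyl_ext L1 _ [the {linear _ -> _} of c2 \o Fmap dL]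
      [the {linear _ -> _} of d \o c1]) => l /=.
    by rewrite Fmap_pure c2E dLE c1E.
  - apply: (@weyl_ext L2 _ [the {linear _ -> _} of p \o c2] (Fmap pL)) => l /=.
    by rewrite Fmap_pure c2E pLE.
have toT : ext_morph E' (trivial_ext (F M) U).
  exists fs, (Fmap pL); split=> [x|x|x] //=; first by rewrite fsE i'E.
  by apply/ex2'; exists x.
apply: (@rst_trans _ _ _ E').
  by apply: rst_sym; apply: rst_step; split.
by apply: rst_step; split=> //; split=> //; exact: weyl_lfd_le.
Qed.

End WeylFunctor.

(** * The global Weyl module *)

Section GlobalWeyl.
Context (C : numClosedFieldType) (g : finLieAlgType C) (D : cartanDatum g).
Context (A : comAlgType C) (R : algType C) (j : {linear current g A -> R}).
Hypothesis g_simple : is_simple_lie g.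
Hypothesis jM : forall x y, j (lie x y) = j x * j y - j y * j x.
Hypothesis jgen : forall P : R -> Prop, P 0 ->
  (forall c u v, P u -> P v -> P (c *: u + v)) -> P 1 ->
  (forall x u, P u -> P (j x * u)) -> forall u, P u.
Context (G : algType C) (iota : {linear g -> G}).
Hypothesis iotaM : forall x y, iota (lie x y) = iota x * iota y - iota y * iota x.
Hypothesis Ggen : forall P : G -> Prop, P 0 ->
  (forall c u v, P u -> P v -> P (c *: u + v)) -> P 1 ->
  (forall x u, P u -> P (iota x * u)) -> forall u, P u.
Context (gamma : {rmorphism G -> R}).
Hypothesis gammaE : forall x, gamma (iota x) = const_in j x.
Hypothesis gammaA : forall c : C, gamma c%:A = c%:A.
Context (lam : weight D) (Vl : lmodType G) (vl : Vl).
Hypothesis Vl_fd : k_bound (fun v : kmod Vl => True).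
Hypothesis Vl_irr : irreducible_module Vl.
Hypothesis vl0 : vl != 0.
Hypothesis vl_sing : singular iota lam vl.

Local Notation cat := (lfd_le j lam).
Local Notation top := (wspace (const_in j) lam).
Local Notation res V := [the lmodType G of restr gamma V].

Lemma resE (V : lmodType R) u (v : V) : u *: (v : res V) = gamma u *: v.
Proof. by []. Qed.

Lemma wspace_res (V : lmodType R) mu (v : V) :
  wspace (D := D) iota mu (v : res V) <-> wspace (const_in j) mu v.
Proof.
by split=> wv t; have := wv t; rewrite !resE gammaE gammaA.
Qed.

Lemma kmod_resE (V : lmodType R) n (c : 'I_n -> C) (e : 'I_n -> V) :
  \sum_i c i *: (e i : kmod (res V)) = \sum_i c i *: (e i : kmod V) :> V.
Proof.
elim: n c e => [|n IHn] c e; first by rewrite !big_ord0.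
rewrite !big_ord_recl -[RHS]kmod_addE -IHn; congr (_ + _).
by rewrite !kmodE resE gammaA.
Qed.

Lemma lfd_res (V : lmodType R) (v : V) : lfd iota (v : res V) <-> lfd (const_in j) v.
Proof.
split=> -[N [[N0 ND] stN [n [e eN]] Nv]]; exists N; split=> //.
- by split=> // c u u' Nu Nu'; have := ND c _ _ Nu Nu'; rewrite resE gammaA.
- by move=> x u /(stN x); rewrite resE gammaE.
- by exists n, e => u /eN[c ->]; exists c; exact: kmod_resE.
- by split=> // c u u' Nu Nu'; rewrite resE gammaA; exact: ND.
- by move=> x u /(stN x); rewrite resE gammaE.
- by exists n, e => u /eN[c ->]; exists c; exact: (esym (kmod_resE c e)).
Qed.

(** The vectors of weight lam are singular because lam is maximal in V. *)
Lemma singular_top (V : lmodType R) (v : V) : cat V -> top v ->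
  exists f : {linear Vl -> res V}, f vl = v.
Proof.
move=> [VL V0] tv; apply: (singular_map g_simple iotaM Ggen (lam := lam)) => //.
  exact/lfd_res.
split=> [|b qb b0 x xb]; first exact/wspace_res.
rewrite resE gammaE; apply: (V0 (lam + b)); last exact: (wspace_root (const_inM jM) xb tv).
rewrite /wle opprD addrA subrr add0r => qnb.
by case/eqP: b0; exact: Qplus_pointed.
Qed.

(* the induced module, through its universal property *)
Context (Ind : lmodType R) (one : Vl -> Ind).
Hypothesis oneD : forall x y, one (x + y) = one x + one y.
Hypothesis oneZ : forall y x, one (y *: x) = gamma y *: one x.
Hypothesis one_ind : forall P : Ind -> Prop, P 0 ->
  (forall s t, P s -> P t -> P (s + t)) -> (forall u x, P (u *: one x)) -> forall t, P t.
Hypothesis one_lift : forall (V : lmodType R) (th : Vl -> V),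
  (forall x y, th (x + y) = th x + th y) -> (forall y x, th (y *: x) = gamma y *: th x) ->
  exists f : {linear Ind -> V}, forall x, f (one x) = th x.
(* the largest quotient with weights at most lam *)
Context (W : lmodType R) (p : {linear Ind -> W}).
Hypothesis p_surj : forall y, exists t, p t = y.
Hypothesis p_off : forall mu t, ~ wle mu lam -> wspace (D := D) (const_in j) mu t -> p t = 0.
Hypothesis p_ker : forall (V : lmodType R) (f : {linear Ind -> V}),
  (forall mu t, ~ wle mu lam -> wspace (D := D) (const_in j) mu t -> f t = 0) ->
  forall t, p t = 0 -> f t = 0.

(** Ind is generated by a finite-dimensional g-module. *)
Lemma lfd_induced (t : Ind) : lfd (const_in j) t.
Proof.
move: t; apply: one_ind => [|s t|u x]; [exact: lfd0|exact: lfdD|].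
apply: (lfd_scale jM jgen); have [n [e eV]] := Vl_fd.
exists (fun t => exists x, one x = t); split; last by exists x.
- split; first by exists 0; apply: (addrI (one 0)); rewrite -oneD !addr0.
  move=> c _ _ [y <-] [z <-]; exists (c%:A *: y + z).
  by rewrite oneD oneZ gammaA.
- by move=> z _ [y <-]; exists (iota z *: y); rewrite oneZ gammaE.
exists n, (fun i => one (e i)) => _ [y <-]; have [c ->] := eV y I.
exists c; rewrite (kmod_sumE c e) (kmod_sumE c (fun i => one (e i))).
have one0 : one 0 = 0 by apply: (addrI (one 0)); rewrite -oneD !addr0.
by elim/big_rec2: _ => // i a b _ <-; rewrite oneD oneZ gammaA.
Qed.

(** A weight vector of W lifts to one of the same weight in Ind, which p kills
    unless the weight is at most lam. *)
Lemma global_lfd_le : cat W.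
Proof.
split=> [y|mu y nl wy]; have [t tE] := p_surj y; rewrite -?tE.
  exact/lfd_linear/lfd_induced.
have [|t' wt' <-] := weight_lift (f := p) (lam := mu)
    (lfd_weights D g_simple (const_inM jM) (lfd_induced t)); first by rewrite tE.
exact: p_off wt'.
Qed.

Lemma global_top : top (p (one vl)).
Proof.
apply: wspace_linear => t; have [wv _] := vl_sing.
by rewrite -gammaE -oneZ wv oneZ gammaA.
Qed.

Lemma global_gen y : exists u, y = u *: p (one vl).
Proof.
have [t <-] := p_surj y; move: t; apply: one_ind => [|s t [u uE] [u' uE']|u x].
- by exists 0; rewrite scale0r linear0.
- by exists (u + u'); rewrite linearD uE uE' scalerDl.
have [_ /(_ (fun x => exists z, x = z *: vl))] := Vl_irr; case.
- split; first by exists 0; rewrite scale0r.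
  by move=> a _ _ [z ->] [z' ->]; exists (a * z + z'); rewrite scalerDl scalerA.
- move=> e; case/eqP: vl0; have : [set 0] vl by rewrite -e; exists 1; rewrite scale1r.
  by [].
move=> e; have [z ->] : exists z, x = z *: vl.
  exact: (eq_ind_r (fun S : set Vl => S x) I e).
by exists (u * gamma z); rewrite oneZ scalerA linearZ.
Qed.

(** A map from the highest weight module extends to Ind by induction, and factors
    through p because V has no weights outside lam - Q+. *)
Lemma global_univ (V : lmodType R) (v : V) : cat V -> top v ->
  exists f : {linear W -> V}, f (p (one vl)) = v.
Proof.
move=> VC tv; have [th thE] := singular_top VC tv.
have [||f fE] := @one_lift V th; [exact: linearD|by move=> y x; rewrite linearZ|].
have [_ V0] := VC.
have [|h hE] := linear_descend (f := f) p_surj; last by exists h; rewrite hE fE.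
by apply: p_ker => mu t nl wt; apply: V0 nl _; exact: wspace_linear.
Qed.

End GlobalWeyl.

(** * Exactness and second extensions for current algebras *)

Section FiniteDimSets.
Context (K : fieldType) (R : algType K).

Lemma finite_dimP (V : lmodType R) (N : V -> Prop) : is_subspace N ->
  (finite_dim (N : set V) <-> k_bound (N : kmod V -> Prop)).
Proof.
move=> [N0 ND]; split=> [[n [e eN]]|bN].
  by exists n, e => w /eN[c ->]; exists c; exact: (esym (kmod_sumE c e)).
have [M [phi [_ phiP phiN]]] := k_bound_vect (W := kmod V) N0 ND bN.
have [f fE] := linear_mapP phiP.
exists (\dim {:M}), (fun i => f (vbasis {:M})`_i) => v.
have sumE (c : 'I_(\dim {:M}) -> K) : \sum_i (c i)%:A *: (f (vbasis {:M})`_i : V) =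
    phi (\sum_i c i *: (vbasis {:M})`_i).
  rewrite -fE linear_sum; apply: etrans (esym (kmod_sumE _ _)) _.
  by apply: eq_bigr => i _; rewrite linearZ.
split=> [/phiN[m <-]|[c ->]]; last by apply/phiN; eexists; exact: (esym (sumE c)).
exists (fun i => coord (vbasis {:M}) i m); rewrite sumE.
by rewrite -(coord_basis (vbasisP _) (memvf m)).
Qed.

End FiniteDimSets.

Section Concrete.
Context (C : numClosedFieldType) (g : finLieAlgType C) (D : cartanDatum g).
Hypothesis g_simple : is_simple_lie g.
Context (A : comAlgType C).
Local Notation UA := (uea (current g A)).
Local Notation Uh := (uea (current (liesub_of (cartan D)) A)).

Definition current_uin : {linear current g A -> UA} := @uin C (current g A).

Lemma g_to_current_in x : g_to_current A (uin x) = const_in current_uin x.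
Proof. by rewrite /g_to_current umap_in. Qed.

Lemma g_to_current_scalar (c : C) : g_to_current A (c%:A : uea g) = c%:A.
Proof.
have e : g_to_current A (1 : uea g) = 1 by exact: rmorph1.
apply: etrans (congr1 (fun u => c *: u) e).
by rewrite /g_to_current linearZ.
Qed.

Lemma h_to_current_scalar (c : C) : @h_to_current C g A D (c%:A : Uh) = c%:A.
Proof.
have e : @h_to_current C g A D (1 : Uh) = 1 by exact: rmorph1.
apply: etrans (congr1 (fun u => c *: u) e).
by rewrite /h_to_current linearZ.
Qed.

Lemma h_to_current_in t a :
  @h_to_current C g A D (uin (cpure t a)) = current_uin (cpure (liesub_val t) a).
Proof.
rewrite /h_to_current umap_in; congr (uin _).
exact: current_mapE.
Qed.

Lemma in_IA_leP lam (V : lmodType UA) : in_IA_le lam V <-> lfd_le current_uin (lam : weight D) V.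
Proof.
have wE mu (v : V) : weight_space mu (v : resg V) <-> wspace (const_in current_uin) (mu : weight D) v.
  exact: (wspace_res g_to_current_in g_to_current_scalar).
have lE : in_IA V <-> forall v : V, lfd (const_in current_uin) v.
  split=> [VL v|VL v].
    have [N [sN fN Nv]] := VL v.
    apply/(lfd_res g_to_current_in g_to_current_scalar); exists N.
    have [N0 ND] := sN.
    have sN' : is_subspace (N : resg V -> Prop) by split=> // c u w; exact: ND.
    split=> //; last exact/finite_dimP.
    by move=> x u Nu; rewrite -[_ *: _]addr0; exact: ND.
  have /(lfd_res g_to_current_in g_to_current_scalar)[N [sN stN bN Nv]] := VL v.
  exists N; split=> //; first exact: (lie_submodule (@uea_ind _ _)).
  exact/finite_dimP.
split=> -[V1 V2].
  split=> [|mu v nl /wE wv]; first exact/lE.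
  have : Defs.span (off_weights lam (V := V)) v by apply: span_gen; exists mu.
  by rewrite V2.
split; first exact/lE.
apply/seteqP; split=> v; last by move=> ->; have [] := span_submodule (off_weights lam (V := V)).
apply: (@smallest_sub _ _ _ [set 0]) v; first by split=> // a x y -> ->; rewrite scaler0 addr0.
by move=> v [mu nl /wE wv]; exact: V2 nl wv.
Qed.

Context (lam : weight D) (Vlam : lmodType (uea g)) (vlam : Vlam).
Hypothesis Vlam_irr : is_hw_irrep lam vlam.

Local Notation Ind := (induced A Vlam).
Local Notation W := (global_weyl A lam Vlam).
Local Notation w := (weyl_gen A lam vlam).

Definition induced_in (x : Vlam) : Ind := tpure (induced_ract (g := g) (A := A)) 1 x.

Lemma induced_inD x y : induced_in (x + y) = induced_in x + induced_in y.
Proof. exact: tpureDr. Qed.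

Lemma induced_pureE (u : UA) x : tpure (induced_ract (g := g) (A := A)) u x = u *: induced_in x.
Proof. by rewrite /induced_in -tpureZ; congr (tpure _ _ _); rewrite -[RHS]/(u * 1) mulr1. Qed.

Lemma induced_inZ y x : induced_in (y *: x) = g_to_current A y *: induced_in x.
Proof.
rewrite -induced_pureE; apply: esym; apply: tpureB.
by rewrite /induced_ract mul1r.
Qed.

Lemma induced_in_ind (P : Ind -> Prop) : P 0 ->
  (forall s t, P s -> P t -> P (s + t)) -> (forall u x, P (u *: induced_in x)) -> forall t, P t.
Proof.
by move=> P0 PD Px; apply: tensor_ind => // u x; rewrite induced_pureE.
Qed.

Lemma induced_in_lift (V : lmodType UA) (th : Vlam -> V) :
  (forall x y, th (x + y) = th x + th y) ->
  (forall y x, th (y *: x) = g_to_current A y *: th x) ->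
  exists f : {linear Ind -> V}, forall x, f (induced_in x) = th x.
Proof.
move=> thD thZ.
have bal : balanced (induced_ract (g := g) (A := A)) (fun (u : UA) x => u *: th x).
  split=> [u u' x|u x x'|r u x|u y u' x ->].
  - exact: scalerDl.
  - by rewrite thD; exact: scalerDr.
  - by rewrite scalerA.
  - by rewrite thZ scalerA.
have [f fE] := linear_mapP (tlift_linear bal).
by exists f => x; rewrite fE tlift_pure // scale1r.
Qed.

Definition truncation_map : {linear Ind -> W} := Defs.mpi (off_weights lam (V := Ind)).

Lemma truncation_map_gen : w = truncation_map (induced_in vlam).
Proof. by rewrite /weyl_gen locked_withE. Qed.

Lemma truncation_map_surj y : exists t, truncation_map t = y.
Proof. by have [t ->] := mpi_surj y; exists t. Qed.

Lemma weight_spaceP (V : lmodType UA) mu (v : V) :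
  weight_space mu (v : resg V) <-> wspace (const_in current_uin) (mu : weight D) v.
Proof. exact: (wspace_res g_to_current_in g_to_current_scalar). Qed.

Lemma truncation_map_off mu t : ~ wle mu lam -> wspace (const_in current_uin) (mu : weight D) t -> truncation_map t = 0.
Proof.
move=> nl /weight_spaceP wt; rewrite -(raddf0 truncation_map); apply/mpi_eq.
by rewrite subr0; apply: span_gen; exists mu.
Qed.

Lemma truncation_map_ker (V : lmodType UA) (f : {linear Ind -> V}) :
  (forall mu t, ~ wle mu lam -> wspace (const_in current_uin) (mu : weight D) t -> f t = 0) ->
  forall t, truncation_map t = 0 -> f t = 0.
Proof.
move=> f0 t; rewrite -(raddf0 truncation_map) => /mpi_eq; rewrite subr0.
apply: (@smallest_sub _ _ _ [set t | f t = 0]).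
  split=> [|a x y /= fx fy]; first exact: linear0.
  by rewrite linearP fx fy scaler0 addr0.
by move=> s [mu nl /weight_spaceP ws]; exact: f0 nl ws.
Qed.

Let Vlam_bound : k_bound (fun v : kmod Vlam => True).
Proof.
have [[n [e eV]] _ _] := Vlam_irr; exists n, e => v _.
have [c ->] := (eV v).1 I; exists c; exact: (esym (kmod_sumE c e)).
Qed.

Let vlam_singular : singular (@uin C g) lam vlam.
Proof. by have [_ _ [_ wv pv]] := Vlam_irr; split. Qed.

Let vlam_neq0 : vlam != 0.
Proof. by have [_ _ []] := Vlam_irr. Qed.

Let Vlam_simple : irreducible_module Vlam.
Proof. by have [_ ? _] := Vlam_irr. Qed.

Lemma global_weyl_lfd_le : lfd_le current_uin lam W.
Proof.
exact: (@global_lfd_le _ _ D A _ current_uin g_simple (@uin_lie _ _) (@uea_ind _ _) _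
  (@uin C g) (g_to_current A) g_to_current_in g_to_current_scalar lam Vlam Vlam_bound Ind
  induced_in induced_inD induced_inZ induced_in_ind W truncation_map truncation_map_surj truncation_map_off).
Qed.

Lemma global_weyl_top : wspace (const_in current_uin) lam w.
Proof.
rewrite truncation_map_gen.
exact: (@global_top _ _ D A _ current_uin _ (@uin C g) (g_to_current A) g_to_current_in
  g_to_current_scalar lam Vlam vlam vlam_singular Ind induced_in induced_inZ W truncation_map).
Qed.

Lemma global_weyl_gen y : exists u, y = u *: w.
Proof.
rewrite truncation_map_gen.
exact: (@global_gen _ _ _ (g_to_current A) Vlam vlam Vlam_simple vlam_neq0 Ind induced_in induced_inZ
  induced_in_ind W truncation_map truncation_map_surj).
Qed.

Lemma global_weyl_univ (V : lmodType UA) (v : V) : lfd_le current_uin lam V ->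
  wspace (const_in current_uin) lam v -> exists f : {linear W -> V}, f w = v.
Proof.
rewrite truncation_map_gen.
exact: (@global_univ _ _ D A _ current_uin g_simple (@uin_lie _ _) _
  (@uin C g) (@uin_lie _ _) (@uea_ind _ _) (g_to_current A) g_to_current_in
  g_to_current_scalar lam Vlam vlam Vlam_bound Vlam_simple vlam_neq0 vlam_singular Ind
  induced_in induced_in_lift W truncation_map truncation_map_surj truncation_map_ker).
Qed.

Lemma weyl_alg_ker (y : Uh) :
  rpi (@weyl_ann C g A D lam Vlam vlam) y = 0 <-> @h_to_current C g A D y *: w = 0.
Proof.
have annE : ideal_gen (@weyl_ann C g A D lam Vlam vlam) y <->
    @weyl_ann C g A D lam Vlam vlam y by rewrite weyl_annE.
split=> [e|ay]; first apply/annE.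
  by rewrite -[y]subr0; apply/rpi_eq; rewrite raddf0.
by rewrite -(raddf0 (rpi _)); apply/rpi_eq; rewrite subr0; apply/annE.
Qed.

Local Notation B := (@weyl_alg C g A D lam Vlam vlam).

Theorem weyl_exact_iff :
  exact_functor (@weyl_functor_map _ g A D lam Vlam vlam) <->
  (forall U : lmodType UA,
     in_IA_le lam U -> weight_space lam (V := resg U) = [set 0] ->
     forall M : lmodType B, Ext2_eq0 (in_IA_le lam) (weyl_functor M) U).
Proof.
have catE : in_IA_le lam = lfd_le current_uin lam.
  by apply: funext => V; apply: propext; exact: in_IA_leP.
rewrite catE.
have wlam (U : lmodType UA) : weight_space lam (V := resg U) = [set 0] <->
    forall u : U, wspace (const_in current_uin) lam u -> u = 0.
  split=> [U0 u /weight_spaceP wu|U0]; first by have : [set 0] u by rewrite -U0.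
  apply/seteqP; split=> u; first by move=> /weight_spaceP; exact: U0.
  by move=> ->; apply/weight_spaceP; exact: wspace0.
pose ra := @weyl_ract C g A D lam Vlam vlam.
have pDl (M : lmodType B) x x' (m : M) : tpure ra (x + x') m = tpure ra x m + tpure ra x' m.
  exact: tpureDl.
have pDr (M : lmodType B) x (m m' : M) : tpure ra x (m + m') = tpure ra x m + tpure ra x m'.
  exact: tpureDr.
have pZ (M : lmodType B) r x (m : M) : tpure ra (r *: x) m = r *: tpure ra x m.
  exact: tpureZ.
have pB (M : lmodType B) x b x' (m : M) : ra x b x' -> tpure ra x' m = tpure ra x (b *: m).
  by move=> xb; exact: tpureB.
have p_ind (M : lmodType B) := @tensor_ind UA B W ra M.
have p_lift (M : lmodType B) (V : lmodType UA) (f : W -> M -> V) : balanced ra f ->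
    exists h : {linear weyl_functor M -> V}, forall x m, h (tpure ra x m) = f x m.
  move=> bal; have [h hE] := linear_mapP (tlift_linear bal).
  by exists h => x m; rewrite hE tlift_pure.
have Fp (M M' : lmodType B) (f : {linear M -> M'}) x m :
    weyl_functor_map f (tpure ra x m) = tpure ra x (f m).
  exact: tmap_pure.
have q_surj (b : B) : exists y, rpi _ y = b by have [y ->] := rpi_surj b; exists y.
have HC : forall y y' : Uh, y * y' = y' * y.
  by apply: uea_comm; exact: cartan_current_abelian.
have kS c : exists y, @h_to_current C g A D y = c%:A.
  by exists c%:A; exact: h_to_current_scalar.
have kH (t : liesub_of (cartan D)) a : exists y, @h_to_current C g A D y = current_uin (cpure (liesub_val t) a).
  by exists (uin (cpure t a)); exact: h_to_current_in.
pose kappa : {rmorphism Uh -> UA} := @h_to_current C g A D.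
pose q : {rmorphism Uh -> B} := rpi (@weyl_ann C g A D lam Vlam vlam).
split=> [ex U UC /wlam U0 M E|ext].
  exact: (@Ext2_eq0_of_exact C g D A UA current_uin g_simple (@uin_lie _ _)
    (@uea_ind _ _) lam Uh B kappa q HC kS kH q_surj W w global_weyl_lfd_le
    global_weyl_top global_weyl_gen global_weyl_univ weyl_alg_ker
    (@weyl_functor C g A D lam Vlam vlam) (fun M => tpure ra (M := M))
    pDl pDr pZ pB p_ind p_lift (@weyl_functor_map C g A D lam Vlam vlam) Fp).
apply: (@exact_of_Ext2_eq0 C g D A UA current_uin g_simple (@uin_lie _ _)
  (@uea_ind _ _) lam Uh B kappa q HC kS kH W w global_weyl_lfd_le
  global_weyl_top global_weyl_gen global_weyl_univ weyl_alg_ker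
  (@weyl_functor C g A D lam Vlam vlam) (fun M => tpure ra (M := M))
  pDl pDr pZ pB p_ind p_lift (@weyl_functor_map C g A D lam Vlam vlam) Fp).
by move=> U UC /wlam U0 M; exact: ext.
Qed.

End Concrete.

Theorem corollary3p7 (R : realType) (g : finLieAlgType R[i])
    (g_simple : is_simple_lie g) (D : cartanDatum g) (A : comAlgType R[i])
    (lam : weight D) (lam_dominant : Pplus lam)
    (Vlam : lmodType (uea g)) (vlam : Vlam)
    (Vlam_irr : is_hw_irrep lam vlam) :
  exact_functor (@weyl_functor_map _ g A D lam Vlam vlam) <->
  (forall U : lmodType (uea (current g A)),
     in_IA_le lam U -> weight_space lam (V := resg U) = [set 0] ->
     forall M : lmodType (weyl_alg A lam vlam),
       Ext2_eq0 (in_IA_le lam) (weyl_functor M) U).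
Proof. exact: (@weyl_exact_iff R[i] g D g_simple A lam Vlam vlam Vlam_irr). Qed.
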